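(* For $g_1,g_2\in SU(2)$ define \[ \zeta^W_{SU(2)}(s;g_1,g_2)=\sum_{\rho\in\widehat{SU(2)}}\frac{\operatorname{trace}(\rho(g_1))\,\operatorname{trace}(\rho(g_2))}{\deg(\rho)^{s+2}}, \] extended meromorphically in $s$. Then $\zeta^W_{SU(2)}(-m;g_1,g_2)=0$ for all $g_1,g_2\in SU(2)$ and every positive even integer $m$.
   Context: $\widehat{SU(2)}$ denotes the set of equivalence classes of irreducible (finite-dimensional, complex) unitary representations of $SU(2)$, and $\deg(\rho)$ is the dimension of $\rho$. The series converges for $\Re(s)>1$, and its value at $s=-m$ means the value of its meromorphic continuation. *)

(* Defs.v *)
From HB Require Import structures.
From mathcomp Require Import all_boot all_order all_algebra finmap.
From mathcomp Require Import spectral generic_quotient complex.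
From mathcomp Require Import all_classical all_reals all_analysis.
From mathcomp Require Import summability.

Set Implicit Arguments.
Unset Strict Implicit.
Unset Printing Implicit Defensive.

Import Order.TTheory GRing.Theory Num.Theory.
Import numFieldNormedType.Exports.

Local Open Scope classical_set_scope.
Local Open Scope ring_scope.
Local Open Scope complex_scope.
Local Open Scope quotient_scope.

(* The usual topology and norm of the complex plane: R[i] carries the structure
   of a normed module over itself, so that below [derivable f z 1] is complex
   differentiability of f : R[i] -> R[i] at z. *)
HB.instance Definition _ (R : realType) :=
  NormedModule.copy R[i] (R[i] : numFieldType)^o.

Definition SU2 (R : realType) : {pred 'M[R[i]]_2} :=
  [pred g | (g \is unitarymx) && (\det g == 1)].

(* An irreducible continuous unitary representation of SU(2), written in an
   orthonormal basis of its space; the values of [irrep_fun] outside SU(2) are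
   irrelevant. *)
Record irrep (R : realType) := Irrep {
  irrep_deg : nat;
  irrep_fun :> 'M[R[i]]_2 -> 'M[R[i]]_irrep_deg;
  irrep_deg_gt0 : (0 < irrep_deg)%N;
  irrep_mul : forall g h, g \in @SU2 R -> h \in @SU2 R ->
    irrep_fun (g *m h) = irrep_fun g *m irrep_fun h;
  irrep_unitary : forall g, g \in @SU2 R -> irrep_fun g \is unitarymx;
  irrep_continuous : {within [set` @SU2 R], continuous irrep_fun};
  irrep_irreducible : forall U : {vspace 'cV[R[i]]_irrep_deg},
    (forall g v, g \in @SU2 R -> v \in U -> irrep_fun g *m v \in U) ->
    U = 0%VS \/ U = fullv }.

HB.instance Definition _ (R : realType) := gen_eqMixin (irrep R).
HB.instance Definition _ (R : realType) := gen_choiceMixin (irrep R).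

Definition irrep_iso (R : realType) (rho sigma : irrep R) : Prop :=
  exists (T : 'M[R[i]]_(irrep_deg sigma, irrep_deg rho))
         (S : 'M[R[i]]_(irrep_deg rho, irrep_deg sigma)),
    [/\ T *m S = 1%:M, S *m T = 1%:M &
        forall g, g \in @SU2 R -> T *m rho g = sigma g *m T].

Definition irrep_isob (R : realType) : rel (irrep R) :=
  fun rho sigma => `[< irrep_iso rho sigma >].

Lemma irrep_isob_equiv (R : realType) : equiv_class_of (@irrep_isob R).
Proof.
split.
- move=> rho; apply/asboolP; exists 1%:M, 1%:M.
  by split=> [||g _]; rewrite ?mulmx1 ?mul1mx.
- suff sym rho sigma : @irrep_isob R rho sigma -> @irrep_isob R sigma rho.
    by move=> rho sigma; apply/idP/idP; exact: sym.
  move=> /asboolP[T [S [TS ST H]]]; apply/asboolP; exists S, T; split=> // g gSU.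
  by rewrite -[LHS]mulmx1 -TS -mulmxA (mulmxA (sigma g)) -(H _ gSU) !mulmxA ST
             mul1mx.
- move=> sigma rho tau /asboolP[T [S [TS ST H]]] /asboolP[T' [S' [TS' ST' H']]].
  apply/asboolP; exists (T' *m T), (S *m S'); split=> [||g gSU].
  + by rewrite -mulmxA (mulmxA T) TS mul1mx.
  + by rewrite -mulmxA (mulmxA S') ST' mul1mx.
  + by rewrite -mulmxA H // mulmxA H' // mulmxA.
Qed.

Canonical irrep_equiv (R : realType) := EquivRelPack (@irrep_isob_equiv R).

(* The unitary dual of SU(2): the set of equivalence classes. *)
Definition SU2hat (R : realType) := {eq_quot @irrep_equiv R}.
HB.instance Definition _ (R : realType) := Choice.on (SU2hat R).

Definition cexp (R : realType) (z : R[i]) : R[i] :=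
  (expR (complex.Re z) * cos (complex.Im z)) +i*
  (expR (complex.Re z) * sin (complex.Im z)).

(* n ^ z for a positive integer n and a complex exponent z *)
Definition natcpow (R : realType) (n : nat) (z : R[i]) : R[i] :=
  cexp (z * (ln n%:R)%:C).

(* Trace and degree depend only on the class, so the term may be computed on
   the chosen representative [repr c]. *)
Definition zetaW_term (R : realType) (g1 g2 : 'M[R[i]]_2) (s : R[i])
    (c : SU2hat R) : R[i] :=
  let rho : irrep R := repr c in
  \tr (rho g1) * \tr (rho g2) / natcpow (irrep_deg rho) (s + 2%:R).

Definition pole (R : realType) (f : R[i] -> R[i]) (p : R[i]) : Prop :=
  exists (k : nat) (a : R[i]),
    [/\ (0 < k)%N, a != 0 & (z - p) ^+ k * f z @[z --> p^'] --> a].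

(* Holomorphic on the whole plane except for isolated singularities that are
   poles; the value of f at a pole is irrelevant. *)
Definition meromorphic (R : realType) (f : R[i] -> R[i]) : Prop :=
  forall p : R[i], (\forall z \near p^', derivable f z 1) /\
                   (derivable f p 1 \/ pole f p).

(* Z is the meromorphic continuation of the series, which is summed
   unconditionally over the set of equivalence classes for Re s > 1. By the
   identity theorem it is unique away from its poles. *)
Definition zetaW_continuation (R : realType) (g1 g2 : 'M[R[i]]_2)
    (Z : R[i] -> R[i]) : Prop :=
  meromorphic Z /\
  forall s : R[i], 1 < complex.Re s ->
    partial_sum (zetaW_term g1 g2 s) @ totally --> Z s.

(* Main.v *)
(* Let [lambda_j, lambda_j^-1] be the eigenvalues of g_j. The irreducible
   representations of SU(2) are the symmetric powers Sym^(n-1), n >= 1, of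
   dimension n, so the zeta function is
     sum_n chi_n(g_1) chi_n(g_2) n^(-s-2),
     chi_n(g_j) = (lambda_j^n - lambda_j^(-n)) / (lambda_j - lambda_j^-1),
   where the quotient is n lambda_j^(n-1) if lambda_j = +1 or -1. It is
   therefore a combination of shifts of F(z, s) = sum_n z^n n^(-s) with |z| = 1.

   Classification. In a unitary representation, the component of a vector orthogonal
   to all differences of points of its orbit is both invariant and an affine
   combination of these points. This is enough for the orthogonality of
   characters without an integral: an irreducible representation whose character
   is a combination of finitely many irreducible characters is one of these. The
   character of any representation of SU(2) is an even trigonometric polynomial
   on the torus, hence a combination of the characters of the Sym^n.

   Continuation. Write z = w^2. The differences of w^(2x) x^(-s) over the
   intervals [n - 1/2, n + 1/2] telescope; expanding them in powers of 1/n with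
   remainder of order J expresses F(z, s) through F(z, s + 1), ..., F(z, s + J)
   and a function holomorphic for Re s > 1 - J. At s = -k the remainder vanishes,
   and induction on k gives F(z, -k) + (-1)^k F(z^-1, -k) = - [k = 0] for z <> 1,
   and the trivial zeros of the Riemann zeta function for z = 1.

   Conclusion. If g_1 and g_2 are not central, then up to a constant the zeta
   function is, at s + 2, the difference of F(z, .) + F(z^-1, .) for
   z = lambda_1 lambda_2 and for z = lambda_1 / lambda_2; these have the same
   value at s + 2 = 2 - m. If only g_1 is central, it is F(z, .) - F(z^-1, .) at
   s + 1, which vanishes at the odd number 1 - m; if both are, it is F(1, s) or
   F(-1, s). *)

Require Import Defs.
From mathcomp Require Import all_boot all_order all_algebra finmap.
From mathcomp Require Import complex sesquilinear spectral ring lra zify.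
From mathcomp Require Import all_classical all_reals all_analysis.
From mathcomp Require Import summability.

Set Implicit Arguments.
Unset Strict Implicit.
Unset Printing Implicit Defensive.

Import Order.TTheory GRing.Theory Num.Theory.
Import numFieldNormedType.Exports.

Local Open Scope classical_set_scope.
Local Open Scope ring_scope.

(** * Character independence without Haar measure *)

Lemma exists_finite_span (K : fieldType) (V : vectType K) (P : V -> Prop) :
  exists s : seq V, (forall v, v \in s -> P v) /\ (forall v, P v -> v \in << s >>%VS).
Proof.
suff H k (s : seq V) : (forall v, v \in s -> P v) -> (\dim {:V} - \dim << s >> < k)%N ->
    exists s : seq V, (forall v, v \in s -> P v) /\ (forall v, P v -> v \in << s >>%VS).
  by apply: (H (\dim {:V}).+1 [::]) => //; rewrite ltnS leq_subr.
elim: k s => // k IH s Ps ltk.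
have [Hs|/existsNP[v /not_implyP[Pv /negP vs]]] :=
  pselect (forall v, P v -> v \in << s >>%VS); first by exists s.
apply: (IH (v :: s)) => [w|].
  by rewrite inE => /predU1P[->|/Ps].
have ltd : (\dim << s >> < \dim << v :: s >>)%N.
  rewrite ltnNge; apply: contra vs => led.
  have /eqP -> : << s >>%VS == << v :: s >>%VS.
    rewrite eqEdim led andbT; apply: sub_span => x xs; rewrite inE xs orbT //.
  by apply: memv_span; rewrite inE eqxx.
by rewrite -ltnS (leq_trans _ ltk) // ltnS ltn_sub2l // (leq_trans ltd) // dimvS // subvf.
Qed.

Section TraceForm.
Local Open Scope sesquilinear_scope.
Variables (C : numClosedFieldType) (d e : nat).
Implicit Types X Y : 'M[C]_(d, e).
Definition trform X Y : C := \tr (X *m Y^t*).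

Lemma trformDl X1 X2 Y : trform (X1 + X2) Y = trform X1 Y + trform X2 Y.
Proof. by rewrite /trform mulmxDl mxtraceD. Qed.

Lemma trformZl a X Y : trform (a *: X) Y = a * trform X Y.
Proof. by rewrite /trform -scalemxAl mxtraceZ. Qed.

Lemma trformBl X1 X2 Y : trform (X1 - X2) Y = trform X1 Y - trform X2 Y.
Proof. by rewrite trformDl -scaleN1r trformZl mulN1r. Qed.

Lemma trformE X Y : trform X Y = \sum_i \sum_j X i j * (Y i j)^*.
Proof.
by apply: eq_bigr => i _; rewrite mxE; apply: eq_bigr => j _; rewrite !mxE.
Qed.

Lemma trformC X Y : trform X Y = (trform Y X)^*.
Proof.
rewrite !trformE rmorph_sum /=; apply: eq_bigr => i _.
by rewrite rmorph_sum /=; apply: eq_bigr => j _; rewrite rmorphM /= conjCK mulrC.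
Qed.

Lemma trform_eq0 X : trform X X = 0 -> X = 0.
Proof.
rewrite trformE => /eqP; rewrite psumr_eq0; last first.
  by move=> i _; apply: sumr_ge0 => j _; rewrite mul_conjC_ge0.
move=> /allP H; apply/matrixP => i j; rewrite mxE.
have := H i (mem_index_enum _); rewrite psumr_eq0; last first.
  by move=> k _; rewrite mul_conjC_ge0.
by move=> /allP /(_ j (mem_index_enum _)); rewrite mul_conjC_eq0 => /eqP.
Qed.

Lemma trform_ortho_span (s : seq 'M[C]_(d, e)) Y :
  (forall X, X \in s -> trform X Y = 0) -> forall X, X \in << s >>%VS -> trform X Y = 0.
Proof.
elim: s => [|v s IH] H X.
  by rewrite span_nil memv0 => /eqP ->; rewrite /trform mul0mx mxtrace0.
rewrite span_cons => /memv_addP[x /vlineP[k ->]] [y ys ->].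
rewrite trformDl trformZl H ?inE ?eqxx // mulr0 add0r; apply: IH ys => // Z Zs.
by apply: H; rewrite inE Zs orbT.
Qed.

Lemma exists_ortho_proj (s : seq 'M[C]_(d, e)) Y :
  exists Y1, Y1 \in << s >>%VS /\ forall X, X \in << s >>%VS -> trform X (Y - Y1) = 0.
Proof.
suff [Y1 [Y1s H]] : exists Y1, Y1 \in << s >>%VS /\
    forall X, X \in s -> trform X (Y - Y1) = 0.
  by exists Y1; split=> //; apply: trform_ortho_span.
elim: s Y => [|v s IH] Y; first by exists 0; rewrite mem0v.
have [v1 [v1s Hv]] := IH v; have [Y1 [Y1s HY]] := IH Y.
set w := v - v1 in Hv; have [w0|w0] := eqVneq w 0.
  have vs : v \in << s >>%VS by rewrite -[v](subrK v1) -/w w0 add0r.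
  exists Y1; rewrite span_cons; split; first by rewrite (subvP (addvSr _ _)).
  move=> X; rewrite inE => /predU1P[->|/HY//].
  exact: trform_ortho_span HY _ vs.
have ww0 : trform w w != 0 by apply: contra w0 => /eqP/trform_eq0 ->.
pose a := trform (Y - Y1) w / trform w w.
have ws : w \in << v :: s >>%VS.
  rewrite rpredB //; first by rewrite memv_span ?mem_head.
  by rewrite span_cons (subvP (addvSr _ _)).
exists (Y1 + a *: w); split.
  by rewrite rpredD ?rpredZ // span_cons (subvP (addvSr _ _)).
have K X : trform X (Y - (Y1 + a *: w)) = trform X (Y - Y1) - a^* * trform X w.
  rewrite trformC opprD addrA trformBl trformZl rmorphB rmorphM /=.
  by rewrite -!trformC.
have Kw : trform w (Y - (Y1 + a *: w)) = 0.
  rewrite K /a rmorphM /= -trformC fmorphV /= -trformC.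
  by rewrite divfK // subrr.
move=> X; rewrite inE => /predU1P[->|Xs]; last by rewrite K HY // Hv // mulr0 subr0.
rewrite -[v](subrK v1) -/w trformDl Kw add0r.
apply: (trform_ortho_span _ v1s) => Z Zs; by rewrite K HY // Hv // mulr0 subr0.
Qed.
End TraceForm.

Section UnitaryRepresentations.
Local Open Scope sesquilinear_scope.
Variables (C : numClosedFieldType) (m : nat) (G : {pred 'M[C]_m}).
Hypothesis G1 : 1%:M \in G.
Hypothesis GM : forall g h, g \in G -> h \in G -> g *m h \in G.
Hypothesis GV : forall g, g \in G -> g^t* \in G.
Hypothesis GU : forall g, g \in G -> g \is unitarymx.

Definition is_unirep d (rho : 'M[C]_m -> 'M[C]_d) : Prop :=
  (forall g h, g \in G -> h \in G -> rho (g *m h) = rho g *m rho h) /\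
  (forall g, g \in G -> rho g \is unitarymx).

Lemma unirep1 d (rho : 'M[C]_m -> 'M[C]_d) : is_unirep rho -> rho 1%:M = 1%:M.
Proof.
move=> [M U]; have u := unitarymx_unit (U _ G1).
have E := M _ _ G1 G1; rewrite mulmx1 in E.
by apply: (can_inj (mulKmx u)); rewrite -E mulmx1.
Qed.

Lemma unirepV d (rho : 'M[C]_m -> 'M[C]_d) g :
  is_unirep rho -> g \in G -> rho (g^t*) = (rho g)^t*.
Proof.
move=> rr gG; have [M U] := rr; have u := unitarymx_unit (U _ gG).
rewrite -(invmx_unitary (U _ gG)) -(mulKmx u (rho (g^t*))) -M ?GV //.
by rewrite (unitarymxP (GU gG)) unirep1 // mulmx1.
Qed.

Lemma unirep_mulV d (rho : 'M[C]_m -> 'M[C]_d) g :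
  is_unirep rho -> g \in G -> (rho g)^t* *m rho g = 1%:M.
Proof.
move=> [M U] gG; by apply: mulmx1C; apply/unitarymxP/U.
Qed.

(* Lists of weighted group elements of total weight 1 replace the Haar measure. *)
Definition affine (L : seq (C * 'M[C]_m)) : Prop :=
  (forall p, p \in L -> p.2 \in G) /\ \sum_(p <- L) p.1 = 1.

Definition conv (L L' : seq (C * 'M[C]_m)) :=
  [seq (p.1 * q.1, p.2 *m q.2) | p <- L, q <- L'].

Lemma affine_conv L L' : affine L -> affine L' -> affine (conv L L').
Proof.
move=> [H1 H2] [H1' H2']; split.
  by move=> p /allpairsP[[q r] /= [qL rL ->]] /=; apply: GM; [apply: H1|apply: H1'].
rewrite big_allpairs_dep /= -H2.
by apply: eq_bigr => p _; rewrite -mulr_sumr H2' mulr1.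
Qed.

Section Average.
Local Open Scope sesquilinear_scope.
Variables (d e : nat) (rho : 'M[C]_m -> 'M[C]_d) (sigma : 'M[C]_m -> 'M[C]_e).
Hypothesis (rr : is_unirep rho) (rs : is_unirep sigma).
Implicit Types X Y : 'M[C]_(d, e).

Definition hom_act g X := rho g *m X *m (sigma g)^t*.
Definition intertwines X := forall g, g \in G -> hom_act g X = X.
Definition average L X := \sum_(p <- L) p.1 *: hom_act p.2 X.

Lemma hom_actD g X Y : hom_act g (X + Y) = hom_act g X + hom_act g Y.
Proof. by rewrite /hom_act mulmxDr mulmxDl. Qed.
Lemma hom_actZ g a X : hom_act g (a *: X) = a *: hom_act g X.
Proof. by rewrite /hom_act -scalemxAr -scalemxAl. Qed.
Lemma hom_actB g X Y : hom_act g (X - Y) = hom_act g X - hom_act g Y.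
Proof. by rewrite hom_actD -scaleN1r hom_actZ scaleN1r. Qed.
Lemma hom_act0 g : hom_act g 0 = 0.
Proof. by rewrite /hom_act mulmx0 mul0mx. Qed.
Lemma hom_act_sum g (I : Type) (r : seq I) (F : I -> 'M[C]_(d, e)) :
  hom_act g (\sum_(i <- r) F i) = \sum_(i <- r) hom_act g (F i).
Proof. exact: (big_morph _ (hom_actD g) (hom_act0 g)). Qed.
Lemma hom_actM g h X : g \in G -> h \in G ->
  hom_act (g *m h) X = hom_act g (hom_act h X).
Proof.
move=> gG hG; rewrite /hom_act (rr.1 _ _ gG hG) (rs.1 _ _ gG hG).
by rewrite trmx_mul map_mxM !mulmxA.
Qed.

Lemma averageD L X Y : average L (X + Y) = average L X + average L Y.
Proof.
by rewrite -big_split; apply: eq_bigr => p _; rewrite hom_actD scalerDr.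
Qed.
Lemma averageZ L a X : average L (a *: X) = a *: average L X.
Proof.
rewrite scaler_sumr; apply: eq_bigr => p _.
by rewrite hom_actZ !scalerA mulrC.
Qed.
Lemma average_sum L (I : Type) (r : seq I) (F : I -> 'M[C]_(d, e)) :
  average L (\sum_(i <- r) F i) = \sum_(i <- r) average L (F i).
Proof.
apply: (big_morph _ (averageD L)).
by rewrite -[0 in LHS](scale0r 0) averageZ scale0r.
Qed.

Lemma average_conv L L' X : affine L -> affine L' ->
  average (conv L L') X = average L (average L' X).
Proof.
move=> [HL _] [HL' _]; rewrite /average big_allpairs_dep /= big_seq [RHS]big_seq.
apply: eq_bigr => p pL; rewrite hom_act_sum scaler_sumr big_seq [RHS]big_seq.
apply: eq_bigr => q qL; rewrite hom_actZ scalerA hom_actM //; first exact: HL.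
exact: HL'.
Qed.

Lemma average_intertwines L X : affine L -> intertwines X -> average L X = X.
Proof.
move=> [HL H1] iX; rewrite -[RHS]scale1r -H1 scaler_suml /average big_seq.
by rewrite [RHS]big_seq; apply: eq_bigr => p /HL pL; rewrite iX.
Qed.

Lemma trform_hom_act g X Y : g \in G ->
  trform (hom_act g X) Y = trform X (hom_act (g^t*) Y).
Proof.
move=> gG; rewrite /trform /hom_act (unirepV rr) // (unirepV rs) //.
rewrite trmxCK !trmx_mul !map_mxM trmxCK !mulmxA -[RHS]mxtrace_mulC.
by rewrite !mulmxA.
Qed.

(* The component of [Y] orthogonal to all differences [g Y - h Y] is at once an
   affine combination of the orbit of [Y] and invariant. *)
Lemma exists_average1 Y : exists2 L, affine L & intertwines (average L Y).
Proof.
pose P X := exists2 g, g \in G & X = hom_act g Y - Y.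
have [s [sP Ps]] := exists_finite_span P.
have [Y1 [Y1s HY]] := exists_ortho_proj s Y.
have stab g X : g \in G -> X \in << s >>%VS -> hom_act g X \in << s >>%VS.
  move=> gG; suff H t : {subset t <= s} -> forall X, X \in << t >>%VS ->
      hom_act g X \in << s >>%VS by apply: H.
  elim: t => [|v t IH] ts {}X.
    by rewrite span_nil memv0 => /eqP->; rewrite hom_act0 mem0v.
  rewrite span_cons => /memv_addP[x /vlineP[k ->]] [y yt ->].
  rewrite hom_actD hom_actZ rpredD //; last first.
    by apply: IH yt => w wt; apply: ts; rewrite inE wt orbT.
  rewrite rpredZ //; have [h hG ->] := sP v (ts _ (mem_head _ _)).
  have -> : hom_act g (hom_act h Y - Y) =
      (hom_act (g *m h) Y - Y) - (hom_act g Y - Y).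
    by rewrite hom_actB hom_actM // opprB addrA addrNK.
  by apply: rpredB; apply: Ps; [exists (g *m h); first exact: GM|exists g].
have [L [HL L1] LY] : exists2 L, affine L & average L Y = Y - Y1.
  have : {subset s <= s} by [].
  move: Y1s; clear HY; move: {1 2}s => t; elim: t Y1 => [|v t IH] Y1.
    rewrite span_nil memv0 => /eqP-> _; exists [:: (1, 1%:M)].
      by split; [move=> p; rewrite inE => /eqP ->|rewrite big_seq1].
    by rewrite /average big_seq1 scale1r /hom_act !unirep1 // mul1mx trmx1 map_mx1 mulmx1 subr0.
  rewrite span_cons => /memv_addP[x /vlineP[k ->]] [y ys ->] ts.
  have [|L [HL L1] LY] := IH y ys; first by move=> w wt; apply: ts; rewrite inE wt orbT.
  have [h hG ->] := sP v (ts _ (mem_head _ _)).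
  exists [:: (- k, h), (k, 1%:M) & L].
    split; last by rewrite !big_cons /= L1 addKr.
    by move=> p; rewrite !inE => /or3P[/eqP->|/eqP->|/HL].
  rewrite /average !big_cons -/(average L Y) LY /= {2}/hom_act !unirep1 //.
  rewrite mul1mx trmx1 map_mx1 mulmx1 scalerBr scaleNr opprD opprB.
  by rewrite [RHS]addrCA [LHS]addrA (addrC (- _)).
exists L => // g gG; rewrite LY; apply/eqP; rewrite -subr_eq0; apply/eqP.
set Z := _ - _; apply: trform_eq0.
have Zs : Z \in << s >>%VS.
  have -> : Z = (hom_act g Y - Y) - (hom_act g Y1 - Y1).
    by rewrite /Z hom_actB !opprD !opprK addrACA.
  by apply: rpredB; [apply: Ps; exists g|apply: rpredB => //; apply: stab].
have W X : X \in << s >>%VS -> trform (Y - Y1) X = 0.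
  by move=> Xs; rewrite trformC HY // conjC0.
rewrite {1}/Z trformBl W // trform_hom_act // W ?subr0 //.
by apply: stab => //; apply: GV.
Qed.

Definition averages_to_intertwiners L := forall X, intertwines (average L X).

Lemma averages_conv L1 L0 : affine L1 -> affine L0 ->
  averages_to_intertwiners L0 -> averages_to_intertwiners (conv L1 L0).
Proof.
move=> A1 A0 H X; rewrite average_conv // average_intertwines //; exact: H.
Qed.

Lemma exists_averages L0 : affine L0 ->
  exists2 L1, affine L1 & averages_to_intertwiners (conv L1 L0).
Proof.
move=> A0; suff [L1 A1 H1] : exists2 L1, affine L1 &
    forall X, X \in [seq delta_mx i j | i <- enum 'I_d, j <- enum 'I_e] ->
    intertwines (average (conv L1 L0) X).
  exists L1 => // X g gG; rewrite [X]matrix_sum_delta average_sum hom_act_sum.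
  apply: eq_bigr => i _; rewrite average_sum hom_act_sum.
  apply: eq_bigr => j _; rewrite averageZ hom_actZ H1 //.
  by apply/allpairsP; exists (i, j); rewrite !mem_enum.
elim: [seq _ | _ <- _, _ <- _] => [|X t [L1 A1 H1]].
  exists [:: (1, 1%:M)] => //; split; last by rewrite big_seq1.
  by move=> p; rewrite inE => /eqP ->.
have [L2 A2 H2] := exists_average1 (average (conv L1 L0) X).
exists (conv L2 L1) => [|Y]; first exact: affine_conv.
have E Z : average (conv (conv L2 L1) L0) Z = average L2 (average (conv L1 L0) Z).
  by rewrite !average_conv //; apply: affine_conv.
rewrite inE E => /predU1P[-> //|/H1 Yt].
by rewrite average_intertwines.
Qed.

Lemma character_average L :
  \sum_(p <- L) p.1 * (\tr (rho p.2) * (\tr (sigma p.2))^*) =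
  \sum_i \sum_j (average L (delta_mx i j)) i j.
Proof.
under [RHS]eq_bigr do (under eq_bigr do rewrite /average summxE; rewrite exchange_big).
rewrite exchange_big; apply: eq_bigr => p _ /=.
rewrite rmorph_sum big_distrlr /= mulr_sumr; apply: eq_bigr => i _.
rewrite mulr_sumr; apply: eq_bigr => j _; rewrite !mxE (bigD1 j) //= !mxE.
rewrite (bigD1 i) //= !mxE !eqxx mulr1 big1 => [|k /negPf kj]; last first.
  by rewrite !mxE kj mulr0.
rewrite addr0 big1 ?addr0 // => k /negPf kj; rewrite mxE big1 ?mul0r // => l _.
by rewrite !mxE kj andbF mulr0.
Qed.

Definition irreducible_rep n (tau : 'M[C]_m -> 'M[C]_n) : Prop :=
  forall U : {vspace 'cV[C]_n},
    (forall g v, g \in G -> v \in U -> tau g *m v \in U) -> U = 0%VS \/ U = fullv.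

Lemma intertwinesP X : intertwines X ->
  forall g, g \in G -> rho g *m X = X *m sigma g.
Proof.
by move=> iX g gG; rewrite -[in RHS](iX g gG) -!mulmxA unirep_mulV // mulmx1.
Qed.

Lemma Schur_lemma X : irreducible_rep rho -> irreducible_rep sigma ->
  intertwines X -> X != 0 -> exists2 S, X *m S = 1%:M & S *m X = 1%:M.
Proof.
move=> ir irs /intertwinesP iX X0.
pose f := linfun (mulmx X : 'cV[C]_e -> 'cV[C]_d).
have fE v : f v = X *m v by rewrite lfunE.
have col_ne0 n (Y : 'M[C]_(n, e)) : (forall v : 'cV[C]_e, Y *m v = 0) -> Y = 0.
  by move=> H; apply/matrixP => i j; have := H (delta_mx j 0);
     rewrite -colE => /matrixP/(_ i 0); rewrite !mxE.
have ker0 : lker f = 0%VS.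
  have [g v gG|//|kf] := irs (lker f).
    by rewrite !memv_ker !fE mulmxA -iX // -mulmxA => /eqP ->; rewrite mulmx0.
  case/eqP: X0; apply: col_ne0 => v; rewrite -fE; apply/eqP.
  by rewrite -memv_ker kf memvf.
have imf : limg f = fullv.
  have [g _ gG /memv_imgP[u _ ->]|im0|//] := ir (limg f).
    rewrite fE mulmxA iX // -mulmxA -fE memv_img ?memvf //.
  case/eqP: X0; apply: col_ne0 => v; rewrite -fE; apply/eqP.
  by rewrite -memv0 -im0 memv_img ?memvf.
pose S := \matrix_(i < e, j < d) ((f^-1)%VF (delta_mx j 0 : 'cV[C]_d)) i 0.
have XS : X *m S = 1%:M.
  apply/matrixP => i j; have : f ((f^-1)%VF (delta_mx j 0 : 'cV[C]_d)) = delta_mx j 0.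
    by rewrite limg_lfunVK ?imf ?memvf.
  rewrite fE => /matrixP/(_ i 0); rewrite !mxE andbT => <-.
  by apply: eq_bigr => k _; rewrite !mxE.
exists S => //; apply/eqP; rewrite -subr_eq0; apply/eqP; apply: col_ne0 => v.
apply/eqP; rewrite -memv0 -ker0 memv_ker fE mulmxA mulmxBr mulmxA XS mul1mx.
by rewrite mulmx1 subrr mul0mx.
Qed.
End Average.

Lemma Schur_scalar d (rho : 'M[C]_m -> 'M[C]_d) X : (0 < d)%N ->
  is_unirep rho -> irreducible_rep rho -> intertwines rho rho X ->
  exists a, X = a%:M.
Proof.
move=> d0 rr ir iX; have [a /eigenvalueP[v vX v0]] := eigenvalue_closed X d0.
exists a; apply/eqP; rewrite -subr_eq0; apply: contraT => Y0.
have iY : intertwines rho rho (X - a%:M).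
  move=> g gG; rewrite hom_actB iX //; congr (_ - _).
  rewrite /hom_act -scalemx1 -scalemxAr mulmx1 -scalemxAl.
  by rewrite (unitarymxP (rr.2 _ gG)).
have [S YS _] := Schur_lemma rr ir ir iY Y0.
by case/eqP: v0; rewrite -[v]mulmx1 -YS mulmxA mulmxBr vX mul_mx_scalar subrr mul0mx.
Qed.

Lemma character_independence d (rho : 'M[C]_m -> 'M[C]_d) N (e : nat -> nat)
  (sigma : forall n, 'M[C]_m -> 'M[C]_(e n)) (c : nat -> C) :
  (0 < d)%N -> is_unirep rho -> irreducible_rep rho ->
  (forall n, is_unirep (sigma n)) -> (forall n, irreducible_rep (sigma n)) ->
  (forall g, g \in G -> \tr (rho g) = \sum_(n < N) c n * \tr (sigma n g)) ->
  exists n, exists X : 'M[C]_(d, e n), exists S,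
   [/\ X *m S = 1%:M, S *m X = 1%:M & forall g, g \in G -> rho g *m X = X *m sigma n g].
Proof.
move=> d0 rr ir rs irs ch; apply: contrapT => noiso.
have zero n X : intertwines rho (sigma n) X -> X = 0.
  move=> iX; apply/eqP; apply: contra_notT noiso => X0.
  have [S XS SX] := Schur_lemma (rs n) ir (irs n) iX X0.
  by exists n, X, S; split=> //; apply: intertwinesP.
have [L0 AL0 good0] : exists2 L, affine L & averages_to_intertwiners rho rho L.
  have A1 : affine [:: (1, 1%:M)].
    split; last by rewrite big_seq1.
    by move=> p; rewrite inE => /eqP ->.
  have [L1 AL1 H] := exists_averages rr rr A1.
  by exists (conv L1 [:: (1, 1%:M)]) => //; apply: affine_conv.
have [L AL [good goods]] : exists2 L, affine L & averages_to_intertwiners rho rho L /\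
    forall n, (n < N)%N -> averages_to_intertwiners rho (sigma n) L.
  elim: N {ch} => [|N [L AL [g1 g2]]]; first by exists L0.
  have [L1 AL1 H] := exists_averages rr (rs N) AL.
  exists (conv L1 L); first exact: affine_conv.
  split; first exact: averages_conv.
  move=> n; rewrite ltnS leq_eqVlt => /predU1P[->//|/g2]; exact: averages_conv.
have one : \sum_(p <- L) p.1 * (\tr (rho p.2) * (\tr (rho p.2))^*) = 1.
  rewrite character_average //.
  have E i j : exists2 a, average rho rho L (delta_mx i j) = a%:M & a *+ d = (i == j)%:R.
    have [a Ea] := Schur_scalar d0 rr ir (good (delta_mx i j)).
    exists a => //; rewrite -mxtrace_scalar -Ea /average raddf_sum /= big_seq.
    have -> : (i == j)%:R = \sum_(p <- L | p \in L) p.1 * \tr (delta_mx i j : 'M[C]_d).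
      rewrite -big_seq -mulr_suml AL.2 mul1r /mxtrace (bigD1 i) //= big1.
        by rewrite mxE eqxx addr0.
      by move=> k /negPf ki; rewrite mxE ki.
    apply: eq_bigr => p /AL.1 pG; rewrite mxtraceZ /hom_act mxtrace_mulC mulmxA.
    by rewrite unirep_mulV // mul1mx.
  rewrite (eq_bigr (fun=> d%:R^-1)); last first.
    move=> i _; rewrite (bigD1 i) //= big1 => [|j ji]; last first.
      have [a -> _] := E i j; by rewrite mxE eq_sym (negPf ji).
    have [a -> ad] := E i i; rewrite mxE eqxx addr0 mulr1n; move: ad.
    rewrite eqxx => ad; apply: (mulIf (x := d%:R)); last first.
      by rewrite mulr_natr ad mulVf // pnatr_eq0 -lt0n.
    by rewrite pnatr_eq0 -lt0n.
  by rewrite sumr_const card_ord -[LHS]mulr_natr mulVf // pnatr_eq0 -lt0n.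
suff : (1 : C) = 0 by move/eqP; rewrite oner_eq0.
rewrite -one big_seq (eq_bigr (fun p => \sum_(n < N)
    (c n)^* * (p.1 * (\tr (rho p.2) * (\tr (sigma n p.2))^*)))).
  rewrite exchange_big big1 //= => n _; rewrite -mulr_sumr -big_seq.
  rewrite character_average big1 ?mulr0 // => i _.
  rewrite big1 // => j _.
  by rewrite (zero n (average rho (sigma n) L _)) ?mxE //; apply: goods.
move=> p /AL.1 pG; rewrite (congr1 Num.conj (ch _ pG)) rmorph_sum !mulr_sumr.
apply: eq_bigr => n _; rewrite rmorphM /= (mulrCA (\tr _)).
exact: mulrCA.
Qed.
End UnitaryRepresentations.

(** * Symmetric powers of the defining representation *)

Lemma det_mx22 (K : comNzRingType) (M : 'M[K]_2) :
  \det M = M 0 0 * M 1 1 - M 0 1 * M 1 0.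
Proof.
rewrite (expand_det_row _ 0) !big_ord_recl big_ord0 addr0 /cofactor !det_mx11 !mxE /=.
have -> : lift 0 0 = 1 :> 'I_2 by apply: val_inj.
have -> : lift 1 0 = 0 :> 'I_2 by apply: val_inj.
by rewrite expr0 expr1 mul1r mulN1r mulrN.
Qed.

Section HomogeneousEvaluation.
Local Open Scope sesquilinear_scope.
Variable K : comNzRingType.
Implicit Types (p : {poly K}) (u v a b : K).
Definition homeval n p u v := \sum_(k < n.+1) p`_k * (u ^+ k * v ^+ (n - k)).

Lemma homeval_mul_linear n p a b u v : (size p <= n.+1)%N ->
  homeval n.+1 (p * (a *: 'X + b%:P)) u v = (a * u + b * v) * homeval n p u v.
Proof.
move=> sp; rewrite /homeval mulrDl.
have coefE k : (p * (a *: 'X + b%:P))`_k = a * (p * 'X)`_k + b * p`_k.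
  by rewrite mulrDr coefD -scalerAr coefZ coefMC [b * _]mulrC.
under eq_bigr do rewrite coefE mulrDl.
rewrite big_split /=; congr (_ + _).
  rewrite big_ord_recl coefMX /= mulr0 mul0r add0r mulr_sumr.
  apply: eq_bigr => k _; rewrite coefMX /= /bump add1n /= subSS exprS.
  by rewrite -!mulrA; congr (_ * _); rewrite mulrCA.
rewrite big_ord_recr /= [p`__]nth_default // mulr0 mul0r addr0 mulr_sumr.
apply: eq_bigr => k _; rewrite subSn ?exprS; last by rewrite -ltnS.
by rewrite -!mulrA; congr (_ * _); rewrite [RHS]mulrCA; congr (_ * _); exact: mulrCA.
Qed.

Definition linpow a b c d j l : {poly K} :=
  (a *: 'X + b%:P) ^+ j * (c *: 'X + d%:P) ^+ l.

Lemma size_lin a b : (size (a *: 'X + b%:P)%R <= 2)%N.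
Proof.
rewrite (leq_trans (size_polyD _ _)) // geq_max (leq_trans (size_scale_leq _ _)) ?size_polyX //.
by rewrite (leq_trans (size_polyC_leq1 _)).
Qed.

Lemma linpowSr a b c d j l :
  linpow a b c d j l.+1 = linpow a b c d j l * (c *: 'X + d%:P).
Proof. by rewrite /linpow exprSr mulrA. Qed.

Lemma linpowSl a b c d j :
  linpow a b c d j.+1 0 = linpow a b c d j 0 * (a *: 'X + b%:P).
Proof. by rewrite /linpow expr0 !mulr1 exprSr. Qed.

Lemma size_linpow a b c d j l : (size (linpow a b c d j l) <= (j + l).+1)%N.
Proof.
have S p x y n : (size p <= n.+1)%N -> (size (p * (x *: 'X + y%:P))%R <= n.+2)%N.
  move=> sp; have := size_polyMleq p (x *: 'X + y%:P); have := size_lin x y.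
  set t := size (x *: 'X + y%:P); set r := size (p * _); lia.
elim: l => [|l IH]; last by rewrite linpowSr addnS; apply: S.
elim: j => [|j IH]; first by rewrite /linpow !expr0 mulr1 size_polyC_leq1.
by rewrite linpowSl; apply: S.
Qed.

Lemma homeval_linpow a b c d j l u v :
  homeval (j + l) (linpow a b c d j l) u v =
  (a * u + b * v) ^+ j * (c * u + d * v) ^+ l.
Proof.
elim: l => [|l IH]; last first.
  rewrite addnS linpowSr homeval_mul_linear ?size_linpow // IH exprSr.
  by rewrite mulrC mulrA.
elim: j => [|j IH]; last first.
  rewrite linpowSl addSn homeval_mul_linear ?size_linpow // IH.
  by rewrite !expr0 !mulr1 exprS.
rewrite /homeval /linpow !expr0 mulr1 big_ord_recl big_ord0.
by rewrite coef1 /= !expr0 !mulr1 addr0.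
Qed.
End HomogeneousEvaluation.

Section SymmetricPower.
Local Open Scope sesquilinear_scope.
Variables (C : numClosedFieldType) (n : nat).
Implicit Types (g h : 'M[C]_2) (x y : 'cV[C]_2).

Let w k : C := sqrtC ('C(n, k)%:R).

Let w_sqr k : w k * w k = 'C(n, k)%:R.
Proof. by rewrite -expr2 sqrtCK. Qed.

Let w_neq0 (k : 'I_n.+1) : w k != 0.
Proof. by rewrite sqrtC_eq0 pnatr_eq0 -lt0n bin_gt0 -ltnS. Qed.

Let w_conj k : (w k)^* = w k.
Proof. by rewrite geC0_conj // sqrtC_ge0 ler0n. Qed.

(* In the orthonormal basis of weighted monomials, the n-th power of the linear
   form with coefficients [x]. *)
Definition coherent x : 'cV[C]_n.+1 :=
  \col_k (w k * (x 0 0 ^+ k * x 1 0 ^+ (n - k))).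

Definition sympow g : 'M[C]_n.+1 := \matrix_(j, k)
  (w j / w k * (linpow (g 0 0) (g 0 1) (g 1 0) (g 1 1) j (n - j))`_k).

Lemma sympow_coherent g x : sympow g *m coherent x = coherent (g *m x).
Proof.
apply/colP => j; rewrite !mxE.
have -> : \sum_k g 0 k * x k 0 = g 0 0 * x 0 0 + g 0 1 * x 1 0.
  by rewrite !big_ord_recl big_ord0 addr0; congr (_ + g 0 _ * x _ 0); apply: val_inj.
have -> : \sum_k g 1 k * x k 0 = g 1 0 * x 0 0 + g 1 1 * x 1 0.
  by rewrite !big_ord_recl big_ord0 addr0; congr (_ + g 1 _ * x _ 0); apply: val_inj.
rewrite -homeval_linpow subnKC -1?ltnS // mulr_sumr; apply: eq_bigr => k _.
rewrite !mxE mulrACA; congr (_ * _); first by rewrite divfK.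
Qed.

Lemma coherentZ a x : coherent (a *: x) = a ^+ n *: coherent x.
Proof.
apply/colP => k; rewrite !mxE !exprMn mulrACA -exprD subnKC -1?ltnS //.
exact: mulrCA.
Qed.

Definition chart_point (i : nat) : 'cV[C]_2 := \col_k (if k == 0 then i%:R else 1).

Definition coherent_frame : 'M[C]_n.+1 := \matrix_(j, i) coherent (chart_point i) j 0.

Lemma coherent_frame_unit : coherent_frame \in unitmx.
Proof.
rewrite -row_free_unit; apply: inj_row_free => r rE.
pose p : {poly C} := \poly_(k < n.+1) (r 0 (inord k) * w k).
have p0 : p = 0.
  apply: (@roots_geq_poly_eq0 _ p [seq i%:R | i <- iota 0 n.+1]).
  - apply/allP => _ /mapP[i /[!mem_iota] /= iN ->]; rewrite rootE horner_poly.
    have := congr1 (fun M : 'rV[C]_n.+1 => M 0 (Ordinal iN)) rE; rewrite !mxE => {2}<-.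
    apply/eqP; apply: eq_bigr => k _; rewrite !mxE /= inord_val expr1n mulr1.
    by rewrite mulrA.
  - by rewrite map_inj_uniq ?iota_uniq // => i j /eqP; rewrite eqr_nat => /eqP.
  - by rewrite size_map size_iota size_poly.
apply/rowP => k; have := congr1 (fun q : {poly C} => q`_k) p0.
rewrite coef_poly coef0 ltn_ord inord_val => /eqP.
by rewrite mulf_eq0 (negPf (w_neq0 k)) orbF mxE => /eqP.
Qed.

Lemma eq_coherent m (A B : 'M[C]_(m, n.+1)) :
  (forall i, A *m coherent (chart_point i) = B *m coherent (chart_point i)) -> A = B.
Proof.
move=> AB; rewrite -[A](mulmxK coherent_frame_unit) -[B](mulmxK coherent_frame_unit).
congr (_ *m _); apply/matrixP => i j; have /matrixP/(_ i 0) := AB j.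
rewrite !mxE => E; under eq_bigr do rewrite mxE; rewrite E.
by apply: eq_bigr => k _; rewrite !mxE.
Qed.

Lemma sympowM g h : sympow (g *m h) = sympow g *m sympow h.
Proof.
by apply: eq_coherent => i; rewrite -mulmxA !sympow_coherent mulmxA.
Qed.

Lemma coherent_dot x y :
  (coherent y)^t* *m coherent x = ((y^t* *m x) 0 0 ^+ n)%:M.
Proof.
have -> : (y^t* *m x) 0 0 = (y 1 0)^* * x 1 0 + (y 0 0)^* * x 0 0.
  rewrite mxE !big_ord_recl big_ord0 addr0 !mxE addrC.
  by congr ((y _ 0)^* * x _ 0 + _); apply: val_inj.
apply/matrixP => i j; rewrite !ord1 [RHS]mxE mulr1n mxE exprDn.
apply: eq_bigr => k _; rewrite !mxE !rmorphM /= !rmorphXn /= w_conj.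
rewrite mulrACA w_sqr mulr_natl mulrACA -!exprMn; congr (_ *+ _).
exact: mulrC.
Qed.

Lemma sympow_unitary g : g \is unitarymx -> sympow g \is unitarymx.
Proof.
move=> gU; have gV : g^t* *m g = 1%:M by apply: mulmx1C; apply/unitarymxP.
rewrite -trmxC_unitary; apply/unitarymxP; rewrite trmxCK.
apply: eq_coherent => i; rewrite mul1mx.
suff : (coherent (chart_point i))^t* *m ((sympow g)^t* *m sympow g) = (coherent (chart_point i))^t*.
  by move=> /(congr1 (fun M => M^t*)); rewrite trmx_mul map_mxM !trmxCK trmx_mul map_mxM trmxCK.
apply: eq_coherent => k; rewrite mulmxA -!mulmxA mulmxA -map_mxM -trmx_mul.
rewrite !sympow_coherent !coherent_dot trmx_mul map_mxM.
by rewrite -!mulmxA (mulmxA (g^t*)) gV mul1mx.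
Qed.

Lemma sympow_diag (t t' : C) :
  sympow (\matrix_(i, j) (if i == j then if i == 0 then t else t' else 0)) =
  diag_mx (\row_j (t ^+ j * t' ^+ (n - j))).
Proof.
apply: eq_coherent => i; rewrite sympow_coherent; apply/colP => k.
rewrite mul_diag_mx !mxE !big_ord_recl !big_ord0 !mxE /= !mul0r addr0 add0r addr0.
rewrite !(mulr1, addr0, expr1n, exprMn) [RHS]mulrACA -!mulrA [LHS]mulrCA.
by congr (_ * (_ * _)); apply: mulrC.
Qed.

Definition su2 : {pred 'M[C]_2} := [pred g | (g \is unitarymx) && (\det g == 1)].

Lemma coherent_pole : coherent (delta_mx 0 0) = delta_mx ord_max 0.
Proof.
apply/colP => k; rewrite !mxE !eqxx /= expr1n mul1r andbT.
have [->|kn] := eqVneq k ord_max.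
  by rewrite subnn expr0 mulr1 /w binn sqrtC1.
rewrite expr0n subn_eq0 leqNgt ltn_neqAle -ltnS ltn_ord andbT.
by rewrite -(inj_eq val_inj) in kn; rewrite kn mulr0.
Qed.

Definition su2_of (a b : C) : 'M[C]_2 := \matrix_(i, j)
  (if j == 0 then if i == 0 then a else b else if i == 0 then - b^* else a^*).

Lemma su2_ofP a b : a * a^* + b * b^* = 1 -> su2_of a b \in su2.
Proof.
move=> ab; rewrite inE /=; apply/andP; split; last first.
  by rewrite det_mx22 !mxE /= mulNr opprK [b^* * _]mulrC ab.
rewrite -trmxC_unitary; apply/unitarymxP; rewrite trmxCK.
apply/matrixP => i j; rewrite mxE !big_ord_recl big_ord0 addr0 !mxE /=.
case: i => [[|[|//]] ?]; case: j => [[|[|//]] ?];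
   rewrite /= ?conjCK.
- by rewrite mulrC [b^* * b]mulrC.
- by rewrite mulrN [b^* * _]mulrC addNr.
- by rewrite rmorphN /= conjCK mulNr [a * b]mulrC addNr.
- by rewrite rmorphN /= conjCK mulrNN addrC.
Qed.

Lemma su2_of_column a b : su2_of a b *m delta_mx 0 0 = \col_i (if i == 0 then a else b).
Proof. by rewrite -colE; apply/colP => i; rewrite !mxE. Qed.

Lemma su2_of_diag (t : C) : su2_of t 0 =
  \matrix_(i, j) (if i == j then if i == 0 then t else t^* else 0).
Proof.
apply/matrixP => i j; rewrite !mxE conjC0 oppr0.
by case: i => [[|[|//]] ?]; case: j => [[|[|//]] ?].
Qed.

Lemma su2_unitary g : g \in su2 -> g \is unitarymx.
Proof. by case/andP. Qed.

Lemma su2_1 : 1%:M \in su2.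
Proof. by rewrite inE /= det1 eqxx andbT; apply/unitarymxP; rewrite trmx1 map_mx1 mulmx1. Qed.

Lemma su2_mul g h : g \in su2 -> h \in su2 -> g *m h \in su2.
Proof.
move=> /andP[gU /eqP dg] /andP[hU /eqP dh]; rewrite inE /= mul_unitarymx //=.
by rewrite det_mulmx dg dh mulr1.
Qed.

Lemma su2_adj g : g \in su2 -> g^t* \in su2.
Proof.
move=> /andP[gU /eqP dg]; rewrite inE /= trmxC_unitary gU /=.
by rewrite det_map_mx det_tr dg rmorph1.
Qed.

Lemma chart_point_su2 i : exists r a b,
  [/\ r != 0 :> C, a * a^* + b * b^* = 1 &
      chart_point i = r *: (su2_of a b *m delta_mx 0 0)].
Proof.
pose N : C := (i ^ 2).+1%:R; have N0 : 0 < N by rewrite ltr0n.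
have r0 : sqrtC N != 0 by rewrite sqrtC_eq0 gt_eqF.
exists (sqrtC N), (i%:R / sqrtC N), (sqrtC N)^-1; split => //.
  rewrite !rmorphM /= !fmorphV /= !rmorph_nat geC0_conj ?sqrtC_ge0 ?ltW //.
  rewrite mulrACA -invfM -expr2 sqrtCK -[X in _ + X]mul1r -mulrDl.
  by rewrite -natrM natr1 mulnn divff // gt_eqF.
rewrite su2_of_column; apply/colP => k; rewrite !mxE.
by case: ifP => _; [rewrite mulrC divfK|rewrite mulfV].
Qed.

Lemma sympow_unirep : is_unirep su2 sympow.
Proof.
split=> [g h _ _|g /andP[gU _]]; first exact: sympowM.
exact: sympow_unitary.
Qed.

Lemma sympow_irreducible (t : C) : t * t^* = 1 ->
  (forall k, (0 < k <= n)%N -> t ^+ (2 * k) != 1) -> irreducible_rep su2 sympow.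
Proof.
move=> t1 tk U Ustab.
have [allU|/existsNP[u /not_implyP[uU /eqP un]]] :=
  pselect (forall u : 'cV[C]_n.+1, u \in U -> u ord_max 0 = 0); last first.
  right; pose mu (j : 'I_n.+1) := t ^+ j * t^* ^+ (n - j).
  have proj (s : seq C) : (\col_j ((\prod_(a <- s) (mu j - a)) * u j 0)) \in U.
    elim: s => [|a s IH].
      have -> // : (\col_j ((\prod_(a <- [::]) (mu j - a)) * u j 0)) = u.
      by apply/colP => j; rewrite mxE big_nil mul1r.
    have := Ustab (su2_of t 0) _ _ IH.
    rewrite su2_ofP ?conjC0 ?mulr0 ?addr0 // => /(_ isT).
    rewrite su2_of_diag sympow_diag => IH1.
    have := memvB IH1 (memvZ a IH); set X := _ - _; set Y := \col__ _.
    suff -> : X = Y by []; apply/colP => j.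
    by rewrite /X /Y mul_diag_mx !mxE big_cons -[RHS]mulrA [RHS]mulrBl.
  have nU : delta_mx ord_max 0 \in U.
    have := proj [seq mu j | j <- enum 'I_n.+1 & j != ord_max].
    set v := \col__ _; set c := \prod_(j <- enum 'I_n.+1 | j != ord_max) (mu ord_max - mu j).
    have -> : v = (c * u ord_max 0) *: delta_mx ord_max 0.
      apply/colP => j; rewrite !mxE big_map big_filter andbT.
      have [->|jn] := eqVneq j ord_max; first by rewrite mulr1.
      rewrite mulr0 big_enum_cond (bigD1 j) //= subrr !mul0r //.
    move=> /(memvZ (c * u ord_max 0)^-1); rewrite scalerA mulVf ?scale1r //.
    rewrite mulf_neq0 // /c big_enum_cond; apply/prodf_neq0 => j jn.
    rewrite subr_eq0; apply/negP => /eqP /(congr1 ( *%R (t ^+ (n - j)))).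
    rewrite /mu /= subnn expr0 mulr1 -exprD mulrCA -exprMn t1 expr1n mulr1.
    have jn' : (j < n)%N by rewrite ltn_neqAle -ltnS ltn_ord andbT -(inj_eq val_inj) in jn *.
    have -> : (n - j + n = j + 2 * (n - j))%N by have := ltnW jn'; lia.
    rewrite exprD -[X in _ = X -> _]mulr1 => /mulfI.
    have tj : t ^+ j != 0 by rewrite expf_neq0 //; apply: contra_eq_neq t1 => ->; rewrite mul0r eq_sym oner_eq0.
    move=> /(_ tj)/eqP; apply/negP/tk; rewrite subn_gt0 jn' leq_subr //.
  have cU i : coherent (chart_point i) \in U.
    have [r [a [b [_ ab ->]]]] := chart_point_su2 i.
    rewrite coherentZ memvZ // -sympow_coherent coherent_pole.
    by apply: Ustab => //; apply: su2_ofP.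
  apply/eqP; rewrite eqEsubv subvf; apply/subvP => v _.
  rewrite -[v](mulKVmx coherent_frame_unit); set z := invmx _ *m v.
  have -> : coherent_frame *m z = \sum_i z i 0 *: coherent (chart_point i).
    apply/colP => j; rewrite mxE summxE; apply: eq_bigr => k _.
    by rewrite !mxE mulrC.
  by apply: memv_suml => k _; apply: memvZ.
left; apply/eqP; rewrite -subv0; apply/subvP => u uU; rewrite memv0.
suff H : coherent_frame^t* *m u = 0.
  have fu : coherent_frame^t* \in unitmx by rewrite map_unitmx unitmx_tr coherent_frame_unit.
  by rewrite -[u](mulKmx fu) H mulmx0.
have H i : (coherent (chart_point i))^t* *m u = 0.
  have [r [a [b [_ ab ->]]]] := chart_point_su2 i.
  have gS := su2_ofP ab.
  rewrite coherentZ -sympow_coherent coherent_pole linearZ /= map_mxZ -scalemxAl.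
  rewrite trmx_mul map_mxM -(unirepV su2_1 su2_adj su2_unitary sympow_unirep gS).
  rewrite -mulmxA; set y := _ *m u.
  have yU : y \in U by apply: Ustab => //; apply: su2_adj.
  apply/eqP; rewrite scaler_eq0; apply/orP; right; apply/eqP/matrixP => k l.
  rewrite !ord1 !mxE (bigD1 ord_max) //= allU // mulr0 big1 ?addr0 //.
  by move=> j jn; rewrite !mxE (negPf jn) conjC0 mul0r.
apply/colP => i; have /matrixP/(_ 0 0) := H i.
rewrite [RHS]mxE => E; rewrite [RHS]mxE -[RHS]E !mxE.
by apply: eq_bigr => k _; rewrite !mxE.
Qed.

Lemma trace_sympow_diag (t : C) :
  \tr (sympow (su2_of t 0)) = \sum_(j < n.+1) t ^+ j * t^* ^+ (n - j).
Proof.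
by rewrite su2_of_diag sympow_diag mxtrace_diag; apply: eq_bigr => j _; rewrite mxE.
Qed.
End SymmetricPower.

(** * Characters of the circle *)

Local Open Scope complex_scope.

Section ComplexModulus.
Variable R : realType.
Implicit Types z w : R[i].

Definition cmod z : R := Normc.normc z.

Lemma normcE z : `|z| = (cmod z)%:C. Proof. by []. Qed.
Lemma cmod_ge0 z : 0 <= cmod z. Proof. by case: z => a b; rewrite sqrtr_ge0. Qed.
Lemma cmod0 : cmod 0 = 0. Proof. exact: Normc.normc0. Qed.
Lemma cmod1 : cmod 1 = 1. Proof. exact: Normc.normc1. Qed.
Lemma cmodM z w : cmod (z * w) = cmod z * cmod w. Proof. exact: Normc.normcM. Qed.
Lemma cmodV z : cmod z^-1 = (cmod z)^-1. Proof. exact: Normc.normcV. Qed.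
Lemma cmodD z w : cmod (z + w) <= cmod z + cmod w. Proof. exact: le_normcD. Qed.
Lemma cmodN z : cmod (- z) = cmod z. Proof. exact: normcN. Qed.
Lemma cmodB z w : cmod (z - w) <= cmod z + cmod w.
Proof. by rewrite -(cmodN w) cmodD. Qed.
Lemma cmodX z n : cmod (z ^+ n) = cmod z ^+ n.
Proof. by elim: n => [|n IH]; rewrite ?expr0 ?cmod1 // !exprS cmodM IH. Qed.
Lemma cmod_real (x : R) : cmod x%:C = `|x|.
Proof. by rewrite /cmod /= expr0n addr0 sqrtr_sqr. Qed.
Lemma cmod_eq0 z : (cmod z == 0) = (z == 0).
Proof. by apply/eqP/eqP => [/Normc.eq0_normc//|->]; rewrite cmod0. Qed.
Lemma cmod_gt0 z : (0 < cmod z) = (z != 0).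
Proof. by rewrite lt0r cmod_ge0 andbT cmod_eq0. Qed.

Lemma Re_le_cmod z : `|complex.Re z| <= cmod z.
Proof. by rewrite -lecR -normcE normc_ge_Re. Qed.
Lemma Im_le_cmod z : `|complex.Im z| <= cmod z.
Proof.
case: z => a b; rewrite /cmod /= -sqrtr_sqr ler_sqrt ?addr_ge0 ?sqr_ge0 //.
by rewrite lerDr sqr_ge0.
Qed.
Lemma cmod_le_ReIm z : cmod z <= `|complex.Re z| + `|complex.Im z|.
Proof.
rewrite {1}(complexE z); apply: le_trans (cmodD _ _) _; rewrite cmodM !cmod_real.
by rewrite [cmod 'i]/cmod /= expr0n /= add0r expr1n sqrtr1 mul1r.
Qed.

Lemma cmod_sum (I : Type) (r : seq I) (P : pred I) (F : I -> R[i]) :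
  cmod (\sum_(i <- r | P i) F i) <= \sum_(i <- r | P i) cmod (F i).
Proof.
apply: (big_ind2 (fun x y => cmod x <= y)) => //; first by rewrite cmod0.
by move=> x1 x2 y1 y2 h1 h2; apply: le_trans (cmodD _ _) (lerD h1 h2).
Qed.

Lemma ReD z w : complex.Re (z + w) = complex.Re z + complex.Re w.
Proof. by case: z w => [? ?] [? ?]. Qed.
Lemma ImD z w : complex.Im (z + w) = complex.Im z + complex.Im w.
Proof. by case: z w => [? ?] [? ?]. Qed.
Lemma ReN z : complex.Re (- z) = - complex.Re z. Proof. by case: z. Qed.
Lemma ImN z : complex.Im (- z) = - complex.Im z. Proof. by case: z. Qed.
Lemma cReM z w : complex.Re (z * w) =
  complex.Re z * complex.Re w - complex.Im z * complex.Im w.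
Proof. by case: z w => [? ?] [? ?]. Qed.
Lemma cImM z w : complex.Im (z * w) =
  complex.Re z * complex.Im w + complex.Im z * complex.Re w.
Proof. by case: z w => [? ?] [? ?]. Qed.
Lemma Re_nat n : complex.Re (n%:R : R[i]) = n%:R.
Proof. by rewrite -(rmorph_nat (real_complex R)). Qed.
Lemma complex_eq z w : complex.Re z = complex.Re w -> complex.Im z = complex.Im w -> z = w.
Proof. by case: z w => [? ?] [? ?] /= -> ->. Qed.

Definition cis (t : R) : R[i] := cos t +i* sin t.

Lemma cisD a b : cis (a + b) = cis a * cis b.
Proof. by rewrite /cis cosD sinD; simpc; congr (_ +i* _); rewrite addrC. Qed.
Lemma cis0 : cis 0 = 1. Proof. by rewrite /cis cos0 sin0. Qed.
Lemma cisN a : cis (- a) = (cis a)^*%R.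
Proof. by rewrite /cis cosN sinN. Qed.
Lemma cis_norm a : cis a * (cis a)^*%R = 1.
Proof. by rewrite -cisN -cisD subrr cis0. Qed.
Lemma cis_neq0 a : cis a != 0.
Proof. by apply: contra_eq_neq (cis_norm a) => ->; rewrite mul0r eq_sym oner_eq0. Qed.
Lemma cmod_cis a : cmod (cis a) = 1.
Proof. by rewrite /cmod /= cos2Dsin2 sqrtr1. Qed.
Lemma cisMn a n : cis (a *+ n) = cis a ^+ n.
Proof. by elim: n => [|n IH]; rewrite ?cis0 // mulrS cisD IH exprS. Qed.
Lemma cis2pi : cis (pi *+ 2) = 1.
Proof. by rewrite /cis cos2pi sin2pi. Qed.
Lemma cis_inv a : (cis a)^-1 = cis (- a).
Proof. by apply: (mulfI (cis_neq0 a)); rewrite divff ?cis_neq0 // cisN cis_norm. Qed.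

Lemma cis_neq1 x : 0 < x < pi *+ 2 -> cis x != 1.
Proof.
move=> /andP[x0 x2]; apply/negP => /eqP/(congr1 (@complex.Re R)) /=.
have s0 : 0 < sin (x / 2) by apply: sin_gt0_pi; rewrite mulr2n in x2; lra.
have -> : x = (x / 2) *+ 2 by rewrite mulr2n; lra.
rewrite cos_mulr2n cos2sin2 mulr2n => H; have : 0 < sin (x / 2) ^+ 2 by rewrite exprn_gt0.
lra.
Qed.

Lemma cis_eq1 x : cis x = 1 -> exists k : int, x = k%:~R * (pi *+ 2).
Proof.
move=> x1; have p0 : 0 < pi *+ 2 :> R by rewrite mulrn_wgt0 ?pi_gt0.
exists (Num.floor (x / (pi *+ 2))); set k := Num.floor _.
have cisk (j : int) : cis (j%:~R * (pi *+ 2)) = 1.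
  have H n : cis (n%:R * (pi *+ 2)) = 1 by rewrite mulr_natl cisMn cis2pi expr1n.
  by case: j => n; rewrite ?NegzE ?mulrNz ?mulNr ?cisN pmulrn H ?rmorph1.
have y1 : cis (x - k%:~R * (pi *+ 2)) = 1 by rewrite cisD cisN cisk x1 rmorph1 mulr1.
apply/eqP; rewrite -subr_eq0; apply: contraT => yn0.
suff /cis_neq1 : 0 < x - k%:~R * (pi *+ 2) < pi *+ 2 by rewrite y1 eqxx.
have le1 : k%:~R <= x / (pi *+ 2) by apply: Num.Theory.floor_le_tmp.
have lt1 : x / (pi *+ 2) < k%:~R + 1 by rewrite -intrD1; apply: floorD1_gt.
rewrite lt_neqAle eq_sym yn0 /= subr_ge0 -ler_pdivlMr // le1 /=.
by rewrite ltrBlDl -{2}[pi *+ 2]mul1r -mulrDl -ltr_pdivrMr // lt1.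
Qed.

Lemma exists_arg z : z * z^*%R = 1 -> exists t, z = cis t.
Proof.
case: z => a b; rewrite -[X in _ * X]/(a -i* b); simpc => -[ab _].
have a1 : -1 <= a <= 1 by apply/andP; split; nra.
have [b0|b0] := leP 0 b.
  exists (acos a); rewrite /cis acosK ?in_itv // sin_acos //; congr (_ +i* _).
  by rewrite -ab -expr2 addrC addKr -expr2 sqrtr_sqr ger0_norm.
exists (- acos a); rewrite /cis cosN sinN acosK ?in_itv // sin_acos //; congr (_ +i* _).
by rewrite -ab -expr2 addrC addKr -expr2 sqrtr_sqr ltr0_norm // opprK.
Qed.
End ComplexModulus.
Arguments cmod : simpl never.

Section CircleCharacters.
Variable R : realType.

Definition tends_to1 (chi : R -> R[i]) := forall e : R, 0 < e ->
  exists2 d : R, 0 < d & forall a, `|a| < d -> cmod (chi a - 1) < e.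

Lemma tends_to1_cis (k : R) : tends_to1 (fun a => cis (k * a)).
Proof.
move=> e e0; have e2 : 0 < e / 2 by rewrite divr_gt0.
have ck : {for 0, continuous (fun a : R => k * a)}.
  by apply: continuousM; [exact: cvg_cst|exact: cvg_id].
have cc : (fun a : R => cos (k * a)) @ 0 --> cos (k * 0).
  by apply: (continuous_comp ck); exact: continuous_cos.
have cs : (fun a : R => sin (k * a)) @ 0 --> sin (k * 0).
  by apply: (continuous_comp ck); exact: continuous_sin.
rewrite !mulr0 cos0 in cc; rewrite !mulr0 sin0 in cs.
have /nbhs_ballP[d /= d0 H] : \forall a \near 0,
    `|1 - cos (k * a)| < e / 2 /\ `|0 - sin (k * a)| < e / 2.
  by near=> a; split; near: a; [move/cvgrPdist_lt: cc|move/cvgrPdist_lt: cs]; apply.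
exists d => // a ad; have [|h1 h2] := H a.
  by rewrite /ball /= sub0r normrN.
apply: (le_lt_trans (cmod_le_ReIm _)); rewrite ReD ImD /= oppr0 addr0.
by rewrite distrC in h1; rewrite sub0r normrN in h2; rewrite (splitr e) ltrD.
Unshelve. all: by end_near. Qed.

Lemma exists_half_pow_lt (x d : R) : 0 < d -> exists n, x / 2 ^+ n < d.
Proof.
move=> d0; exists (Num.bound (x / d)); rewrite ltr_pdivrMr ?exprn_gt0 // -ltr_pdivrMl //.
by rewrite mulrC; apply: upper_nthrootP.
Qed.

(* Near 0 the values have positive real part, so that halving determines the
   character on dyadic fractions, hence everywhere by continuity. *)
Lemma circle_character (chi : R -> R[i]) :
  (forall a b, chi (a + b) = chi a * chi b) -> (forall a, cmod (chi a) = 1) ->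
  chi (pi *+ 2) = 1 -> tends_to1 chi ->
  exists k : int, forall a, chi a = cis (k%:~R * a).
Proof.
move=> chiD chi1 chip cchi.
have chi0 : chi 0 = 1.
  have c0 : chi 0 != 0 by rewrite -cmod_eq0 chi1 oner_eq0.
  by apply: (mulfI c0); rewrite -chiD addr0 mulr1.
have chiMn a n : chi (a *+ n) = chi a ^+ n.
  by elim: n => [|n IH]; rewrite ?expr0 // mulrS chiD IH exprS.
have [d d0 Hd] := cchi 1 ltr01.
have Re_chi a : `|a| < d -> 0 < complex.Re (chi a).
  move=> /Hd H; have := le_lt_trans (Re_le_cmod _) H; rewrite ReD /= ltr_norml; lra.
have p0 : 0 < pi *+ 2 :> R by rewrite mulrn_wgt0 ?pi_gt0.
have [N hN] := exists_half_pow_lt (pi *+ 2) d0; set h := pi *+ 2 / 2 ^+ N in hN.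
have h0 : 0 < h by rewrite divr_gt0 ?exprn_gt0.
have hNE : h *+ (2 ^ N) = pi *+ 2.
  by rewrite -mulr_natr natrX divfK // expf_neq0 // pnatr_eq0.
pose t := asin (complex.Im (chi h)).
have Re0 : 0 < complex.Re (chi h) by apply: Re_chi; rewrite gtr0_norm.
have ReIm : complex.Re (chi h) ^+ 2 + complex.Im (chi h) ^+ 2 = 1.
  have := chi1 h; case: (chi h) => x y /=; rewrite /cmod /= => /(congr1 (fun u => u ^+ 2)).
  by rewrite sqr_sqrtr ?addr_ge0 ?sqr_ge0 // expr1n.
have Im1 : -1 <= complex.Im (chi h) <= 1 by apply/andP; split; nra.
have cost : cos t = complex.Re (chi h).
  by rewrite cos_asin // -ReIm addrK sqrtr_sqr gtr0_norm.
have chih : chi h = cis t.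
  by apply: complex_eq; rewrite /= ?cost ?asinK ?in_itv.
have ht : - (pi / 2) <= t <= pi / 2 by rewrite asin_geNpi2 // asin_lepi2.
have [k kh] : exists k : int, t = k%:~R * h.
  have [|k Hk] := @cis_eq1 R (t *+ (2 ^ N)).
    by rewrite cisMn -chih -chiMn hNE.
  exists k; have P : (2 ^ N)%:R != 0 :> R by rewrite pnatr_eq0 -lt0n expn_gt0.
  by apply: (mulIf P); rewrite -mulrA !mulr_natr hNE.
have half m : chi (h / 2 ^+ m) = cis (t / 2 ^+ m).
  elim: m => [|m IH]; first by rewrite expr0 !divr1.
  have P2 : 0 < 2 ^+ m.+1 :> R by rewrite exprn_gt0.
  have dbl (x : R) : x / 2 ^+ m = (x / 2 ^+ m.+1) *+ 2.
    by rewrite exprS mulr2n; field; rewrite expf_neq0 // pnatr_eq0.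
  have P1 : 1 <= 2 ^+ m :> R by rewrite exprn_ege1 // ler1n.
  have R1 : 0 < complex.Re (chi (h / 2 ^+ m.+1)).
    apply: Re_chi; rewrite gtr0_norm ?divr_gt0 //; apply: le_lt_trans hN.
    by rewrite ler_pdivrMr // ler_peMr ?ltW // exprS; lra.
  have R2 : 0 < complex.Re (cis (t / 2 ^+ m.+1)).
    have pp := pi_gt0 R.
    apply: cos_gt0_pihalf; rewrite ltr_pdivlMr // ltr_pdivrMr // exprS.
    by apply/andP; split; nra.
  move: IH; rewrite !dbl !chiMn !cisMn => /eqP; rewrite eqf_sqr => /orP[/eqP//|/eqP E].
  by move: R1; rewrite E ReN oppr_gt0 ltNge (ltW R2).
pose psi a := chi a * cis (- (k%:~R * a)).
have psiD a b : psi (a + b) = psi a * psi b.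
  by rewrite /psi chiD mulrDr opprD cisD mulrACA.
have psi_neq0 a : psi a != 0.
  by rewrite mulf_neq0 ?cis_neq0 // -cmod_eq0 chi1 oner_eq0.
have psi_mod a : cmod (psi a) = 1 by rewrite cmodM chi1 cmod_cis mulr1.
have psi0 : psi 0 = 1 by rewrite /psi chi0 mulr0 oppr0 cis0 mulr1.
have psih m : psi (h / 2 ^+ m) = 1.
  by rewrite /psi half kh !mulrA -cisD subrr cis0.
have psiN a : psi a = 1 -> psi (- a) = 1.
  by move=> pa; rewrite -[LHS]mulr1 -pa -psiD addNr psi0.
have psinat a n : psi a = 1 -> psi (a *+ n) = 1.
  by move=> pa; elim: n => [|n IH]; rewrite ?psi0 // mulrS psiD pa IH mulr1.
have psiint a (j : int) : psi a = 1 -> psi (a *~ j) = 1.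
  by move=> pa; case: j => n; rewrite ?NegzE ?mulrNz ?pmulrn; [|apply: psiN]; apply: psinat.
exists k => a; suff p1 : psi a = 1.
  by rewrite -[LHS]mulr1 -cis0 -(addNr (k%:~R * a)) cisD mulrA -/(psi a) p1 mul1r.
apply/eqP; rewrite -subr_eq0 -cmod_eq0; apply: contraT => e0.
have {}e0 : 0 < cmod (psi a - 1) by rewrite lt0r e0 cmod_ge0.
have [d1 d10 H1] := cchi _ (divr_gt0 e0 (ltr0Sn R 1)).
have [d2 d20 H2] := tends_to1_cis (- k%:~R) (divr_gt0 e0 (ltr0Sn R 1)).
have d12 : 0 < Num.min d1 d2 by rewrite lt_min d10.
have [m hm] := exists_half_pow_lt h d12; set u := h / 2 ^+ m in hm.
have u0 : 0 < u by rewrite divr_gt0 ?exprn_gt0.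
pose j := Num.floor (a / u); pose b := a - u *~ j.
have pb : psi b = psi a by rewrite psiD psiN ?mulr1 //; apply: psiint; apply: psih.
have ub : `|b| < u.
  have /andP[l1 l2] := floor_itv (a / u); rewrite -/j in l1 l2.
  have E1 : u *~ j <= a by rewrite -mulrzr mulrC -ler_pdivlMr.
  have E2 : a < u *~ j + u.
    by move: l2; rewrite ltr_pdivrMr // intrD mulrDl mul1r mulrzl.
  by rewrite ger0_norm /b ?subr_ge0 // ltrBlDl.
move: hm; rewrite lt_min => /andP[m1 m2].
have {}H1 := H1 b (lt_trans ub m1); have {}H2 := H2 b (lt_trans ub m2).
suff : cmod (psi a - 1) < cmod (psi a - 1) by rewrite ltxx.
rewrite {1}(_ : psi a - 1 = (chi b - 1) * cis (- k%:~R * b) + (cis (- k%:~R * b) - 1)).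
  apply: (le_lt_trans (cmodD _ _)); rewrite cmodM cmod_cis mulr1.
  by rewrite (splitr (cmod (psi a - 1))) ltrD.
by rewrite -pb /psi mulNr mulrBl mul1r addrA subrK.
Qed.
End CircleCharacters.

(** * The unitary dual of SU(2) *)

Section Torus.
Local Open Scope sesquilinear_scope.
Variable R : realType.
Notation C := R[i].

Definition torus (a : R) : 'M[C]_2 := su2_of (cis a) 0.

Lemma torusE a i j : torus a i j = if i == j then (if i == 0 then cis a else cis (- a)) else 0.
Proof. by rewrite /torus su2_of_diag mxE cisN. Qed.

Lemma torus_su2 a : torus a \in @SU2 R.
Proof. by apply: su2_ofP; rewrite conjC0 mulr0 addr0 cis_norm. Qed.

Lemma torusD a b : torus (a + b) = torus a *m torus b.
Proof.
apply/matrixP => i j; rewrite [RHS]mxE !big_ord_recl big_ord0 addr0 !torusE.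
case: i => [[|[|//]] ?]; case: j => [[|[|//]] ?] /=;
  by rewrite ?(mulr0, mul0r, addr0, add0r) ?opprD ?cisD.
Qed.

Lemma torus0 : torus 0 = 1%:M.
Proof.
apply/matrixP => i j; rewrite torusE oppr0 cis0 mxE.
by case: eqP => // _; rewrite if_same.
Qed.

Lemma torusN a : torus (- a) = (torus a)^t*.
Proof.
apply/matrixP => i j; rewrite [RHS]mxE [in RHS]mxE !torusE opprK [j == i]eq_sym.
case: eqP => [->|_]; last by rewrite rmorph0.
by case: ifP => _; rewrite cisN ?conjCK.
Qed.

Lemma torus2pi : torus (pi *+ 2) = 1%:M.
Proof. by rewrite -torus0; apply/matrixP => i j; rewrite !torusE cisN cis2pi oppr0 cis0 rmorph1. Qed.

Lemma cis_cvg0 (k : R) : (fun a => cis (k * a)) @ (0 : R) --> (1 : C).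
Proof.
apply/cvgrPdist_lt => e e0.
have [r Er] : exists r : R, e = r%:C by exists (complex.Re e); rewrite RRe_real // gtr0_real.
rewrite Er ltcR in e0 *; have [d d0 H] := tends_to1_cis k e0.
apply/nbhs_ballP; exists d => //= a; rewrite /ball /= sub0r normrN => /H h.
by rewrite distrC normcE ltcR.
Qed.

Lemma torus_cvg0 : torus @ (0 : R) --> (1%:M : 'M[C]_2).
Proof.
have c1 : (fun a => cis a) @ (0 : R) --> (1 : C).
  by have := cis_cvg0 1; under eq_fun do rewrite mul1r.
have c2 : (fun a => cis (- a)) @ (0 : R) --> (1 : C).
  by have := cis_cvg0 (- 1); under eq_fun do rewrite mulN1r.
have E i j : (fun a => torus a i j) @ (0 : R) --> (1%:M i j : C).
  rewrite mxE; under eq_fun do rewrite torusE.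
  case: eqP => _; last exact: cvg_cst.
  by case: (i == 0).
move=> A [P nP PA]; have : \forall a \near (0 : R), A (torus a); last by [].
near=> a; apply: PA => i j.
have [->|i0] := eqVneq i 0; [|have -> : i = 1 by case: i i0 => [[|[|//]] ?] //= _; apply: val_inj];
(have [->|j0] := eqVneq j 0; [|have -> : j = 1 by case: j j0 => [[|[|//]] ?] //= _; apply: val_inj]);
  near: a; exact: (E _ _ _ (nP _ _)).
Unshelve. all: by end_near. Qed.

Variables (d : nat) (rho : 'M[C]_2 -> 'M[C]_d).
Hypothesis rr : is_unirep (@SU2 R) rho.
Hypothesis rc : {within [set` @SU2 R], continuous rho}.

Let G1 : 1%:M \in @SU2 R := su2_1 _.
Let GV := @su2_adj C.
Let GU := @su2_unitary C.

Lemma rep_torus_cvg i j : (fun a => rho (torus a) i j) @ (0 : R) --> (1%:M i j : C).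
Proof.
have H := (subspace_continuousP _ _).1 rc _ G1.
rewrite /from_subspace (unirep1 G1 rr) in H.
have {}H : (fun a => rho (torus a)) @ (0 : R) --> (1%:M : 'M[C]_d).
  move=> A /H /=; rewrite /within /= => nA.
  have {}nA : \forall a \near (0 : R), torus a \in @SU2 R -> A (rho (torus a)).
    exact: torus_cvg0 nA.
  have : \forall a \near (0 : R), A (rho (torus a)); last by [].
  by apply: filterS nA => a; apply; exact: torus_su2.
move=> A nA; apply: (H [set M | A (M i j)]).
exists (fun k l => if (k == i) && (l == j) then A else setT).
  by move=> k l; case: ifP => [/andP[/eqP -> /eqP ->]//|_]; exact: filterT.
by move=> M /(_ i j); rewrite !eqxx.
Qed.

Lemma rep_torus_diagonal_characters : exists k : 'I_d -> int,
  forall a, \tr (rho (torus a)) = \sum_j cis ((k j)%:~R * a).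
Proof.
pose T a := rho (torus a).
have TD a b : T (a + b) = T a *m T b by rewrite /T torusD rr.1 // torus_su2.
have TN a : T (- a) = (T a)^t* by rewrite /T torusN (unirepV G1 GV GU rr) // torus_su2.
have T0 : T 0 = 1%:M by rewrite /T torus0 (unirep1 G1 rr).
have [s [sT Ts]] := exists_finite_span (fun X : 'M[C]_d => exists a, X = T a).
have [P Pu /allP Ptrig] : cotrigonalizable_in (@unitarymx C d d) s.
  apply: cotrigonalization => X Y /sT[a ->] /sT[b ->].
  by rewrite /comm_mx -!TD addrC.
pose D a := P *m T a *m P^t*.
have trigD a (i j : 'I_d) : (i < j)%N -> D a i j = 0.
  move=> ij; have : T a \in << s >>%VS by apply: Ts; exists a.
  rewrite /D; move: (T a) => X; elim: s Ptrig X {sT Ts} => [|v t IH] Pt X.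
    by rewrite span_nil memv0 => /eqP ->; rewrite mulmx0 mul0mx mxE.
  rewrite span_cons => /memv_addP[x /vlineP[c ->]] [y ys ->].
  rewrite mulmxDr mulmxDl mxE -scalemxAr -scalemxAl mxE.
  rewrite (IH _ y) ?addr0 //; last by move=> w wt; apply: Pt; rewrite inE wt orbT.
  have := Pt v (mem_head _ _); rewrite /= /similar_to /= conjymx // => /is_trig_mxP -> //.
  by rewrite mulr0.
have PP : P^t* *m P = 1%:M by apply: mulmx1C; apply/unitarymxP.
have DD a b : D (a + b) = D a *m D b.
  by rewrite /D TD !mulmxA -[_ *m P^t* *m P]mulmxA PP mulmx1.
pose chi i a := D a i i.
have chiD i a b : chi i (a + b) = chi i a * chi i b.
  rewrite /chi DD mxE (bigD1 i) //= big1 ?addr0 // => k ki.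
  have [lt|le] := ltnP i k; first by rewrite trigD // mul0r.
  by rewrite (trigD _ k i) ?mulr0 // ltn_neqAle le andbT.
have chi0 i : chi i 0 = 1.
  by rewrite /chi /D T0 mulmx1 (unitarymxP Pu) mxE eqxx.
have chiN i a : chi i (- a) = (chi i a)^*%R.
  have DN : D (- a) = (D a)^t* by rewrite /D TN !trmx_mul !map_mxM trmxCK mulmxA.
  by rewrite /chi DN mxE [in LHS]mxE.
have chi1 i a : cmod (chi i a) = 1.
  have := chiD i a (- a); rewrite subrr chi0 chiN -normCK => /esym/eqP.
  rewrite normcE -rmorphXn /= -(rmorph1 (real_complex R)) (inj_eq (@complexI _)).
  by rewrite sqrp_eq1 ?cmod_ge0 // => /eqP.
have chip i : chi i (pi *+ 2) = 1 by rewrite -(chi0 i) /chi /D /T torus2pi torus0.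
have chic i : tends_to1 (chi i).
  have H : chi i @ (0 : R) --> (1 : C).
    rewrite -(chi0 i) /chi /D T0 /T.
    under eq_fun do (rewrite mxE; under eq_bigr do rewrite mxE).
    rewrite mxE; under eq_bigr do rewrite mxE.
    apply: cvg_big => [|k _]; first exact: add_continuous.
    apply: cvgMr_tmp; apply: cvg_big => [|l _]; first exact: add_continuous.
    by apply: cvgMl_tmp; exact: rep_torus_cvg.
  move=> e e0; have /cvgrPdist_lt/(_ e%:C) := H; rewrite ltcR => /(_ e0).
  move=> /nbhs_ballP[dl /= d0 Hd]; exists dl => // a ad; rewrite -ltcR -normcE distrC.
  by apply: Hd; rewrite /ball /= sub0r normrN.
have [k Hk] := choice (fun i => circle_character (chiD i) (chi1 i) (chip i) (chic i)).
exists k => a; transitivity (\tr (D a)); last by apply: eq_bigr => j _; rewrite -Hk.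
by rewrite /D mxtrace_mulC mulmxA PP mul1mx.
Qed.
End Torus.

Section Classification.
Local Open Scope sesquilinear_scope.
Variable R : realType.
Notation C := R[i].

Definition weyl_sum (n : nat) (a : R) : C := \sum_(j < n.+1) cis a ^+ j * cis (- a) ^+ (n - j).

Lemma trace_sympow_torus n a : \tr (sympow n (torus a)) = weyl_sum n a.
Proof. by rewrite trace_sympow_diag -cisN. Qed.

Lemma weyl_sumSS n a :
  weyl_sum n.+2 a = weyl_sum n a + (cis (n.+2%:R * a) + cis (- (n.+2%:R * a))).
Proof.
rewrite /weyl_sum big_ord_recl big_ord_recr /= subn0 subnn !expr0 mul1r mulr1.
rewrite !mulr_natl -mulNrn !cisMn addrCA; congr (_ + _); last exact: addrC.
apply: eq_bigr => j _; rewrite /bump /= add1n subSS subSn -1?ltnS //.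
by rewrite !exprS mulrACA -cisD subrr cis0 mul1r.
Qed.

Definition weyl_comb (f : R -> C) : Prop :=
  exists N (c : nat -> C), forall a, f a = \sum_(n < N) c n * weyl_sum n a.

Lemma weyl_comb1 n : weyl_comb (weyl_sum n).
Proof.
exists n.+1, (fun j => (j == n)%:R) => a; rewrite big_ord_recr /= eqxx mul1r.
by rewrite big1 ?add0r // => j _; rewrite ltn_eqF // mul0r.
Qed.

Lemma weyl_combZ c f : weyl_comb f -> weyl_comb (fun a => c * f a).
Proof.
move=> [N [e H]]; exists N, (fun n => c * e n) => a; rewrite H mulr_sumr.
by apply: eq_bigr => n _; rewrite mulrA.
Qed.

Lemma weyl_combD f g : weyl_comb f -> weyl_comb g -> weyl_comb (fun a => f a + g a).
Proof.
have ext N (c : nat -> C) M a : (N <= M)%N -> \sum_(n < N) c n * weyl_sum n a =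
    \sum_(n < M) (if (n < N)%N then c n else 0) * weyl_sum n a.
  move=> NM; rewrite (big_ord_widen M (fun n => c n * weyl_sum n a)) // big_mkcond.
  by apply: eq_bigr => n _; case: ifP => // _; rewrite mul0r.
move=> [N [c Hf]] [M [e Hg]]; exists (maxn N M).
exists (fun n => (if (n < N)%N then c n else 0) + (if (n < M)%N then e n else 0)) => a.
rewrite Hf Hg (ext N c _ a (leq_maxl N M)) (ext M e _ a (leq_maxr N M)) -big_split.
by apply: eq_bigr => n _; rewrite mulrDl.
Qed.

Lemma weyl_comb_eq f g : f =1 g -> weyl_comb g -> weyl_comb f.
Proof. by move=> fg [N [c H]]; exists N, c => a; rewrite fg H. Qed.

Lemma weyl_comb_sum (I : Type) (r : seq I) (F : I -> R -> C) :
  (forall i, weyl_comb (F i)) -> weyl_comb (fun a => \sum_(i <- r) F i a).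
Proof.
move=> H; elim: r => [|i r IH].
  by exists 0%N, (fun=> 0) => a; rewrite big_nil big_ord0.
by apply: (weyl_comb_eq (fun a => big_cons _ _ _ _ _ _)); apply: weyl_combD.
Qed.

Lemma weyl_comb_cos (k : nat) : weyl_comb (fun a => cis (k%:R * a) + cis (- (k%:R * a))).
Proof.
case: k => [|[|k]].
- apply: (@weyl_comb_eq _ (fun a => 2%:R * weyl_sum 0 a)); last first.
    by apply: weyl_combZ; apply: weyl_comb1.
  move=> a; rewrite /weyl_sum big_ord1 subnn !expr0 mul0r oppr0 cis0.
  by rewrite !mulr1.
- apply: (weyl_comb_eq _ (weyl_comb1 1)) => a.
  rewrite /weyl_sum !big_ord_recl big_ord0 /= addr0 subn0 subnn !expr0 !expr1.
  by rewrite !mul1r mulr1 addrC.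
- apply: (@weyl_comb_eq _ (fun a => weyl_sum k.+2 a + (-1) * weyl_sum k a)).
    by move=> a; rewrite weyl_sumSS mulN1r [RHS]addrC addKr.
  by apply: weyl_combD; [|apply: weyl_combZ]; apply: weyl_comb1.
Qed.

Lemma weyl_comb_even_character (d : nat) (k : 'I_d -> int) (f : R -> C) :
  (forall a, f a = \sum_j cis ((k j)%:~R * a)) -> (forall a, f (- a) = f a) ->
  weyl_comb f.
Proof.
move=> Hf even.
apply: (@weyl_comb_eq _ (fun a => 2^-1 *
   \sum_j (cis (`|k j|%N%:R * a) + cis (- (`|k j|%N%:R * a))))).
  move=> a; apply: (@mulfI _ 2%:R); first by rewrite pnatr_eq0.
  rewrite mulrA divff ?pnatr_eq0 // mul1r mulr_natl mulr2n -{2}even !Hf -big_split.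
  apply: eq_bigr => j _ /=; rewrite mulrN.
  case: (k j) => n //=.
  by rewrite NegzE mulrNz mulNr opprK addrC.
by apply: weyl_combZ; apply: weyl_comb_sum => j; apply: weyl_comb_cos.
Qed.

Lemma exists_torus_conj (g : 'M[C]_2) : g \in @SU2 R ->
  exists a h, h \in @SU2 R /\ g = h^t* *m torus a *m h.
Proof.
move=> /andP[gU /eqP dg].
have gn : g \is normalmx.
  by apply/normalmxP; rewrite (unitarymxP gU); apply/esym/mulmx1C/unitarymxP.
have [P PU [e gE]] : exists2 P : 'M[C]_2, P \is unitarymx & exists e, g = P^t* *m diag_mx e *m P.
  exists (spectralmx g); first exact: spectral_unitarymx.
  by exists (spectral_diag g); move/orthomx_spectralP: gn; rewrite invmx_unitary ?spectral_unitarymx.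
have PP : P^t* *m P = 1%:M by apply: mulmx1C; apply/unitarymxP.
have EU : diag_mx e \is unitarymx.
  have -> : diag_mx e = P *m g *m P^t*.
    by rewrite gE !mulmxA (unitarymxP PU) mul1mx -mulmxA (unitarymxP PU) mulmx1.
  by apply: mul_unitarymx; [apply: mul_unitarymx|rewrite trmxC_unitary].
have e1 j : e 0 j * (e 0 j)^*%R = 1.
  have /unitarymxP/matrixP/(_ j j) := EU; rewrite !mxE (bigD1 j) //= !mxE eqxx big1.
    by rewrite mulr1n addr0.
  by move=> k /negPf kj; rewrite !mxE eq_sym kj mul0r.
have [a ea] := exists_arg (e1 0).
have de : e 0 0 * e 0 1 = 1.
  have := dg; rewrite gE !det_mulmx det_diag mulrAC -det_mulmx PP det1 mul1r.
  by rewrite !big_ord_recl big_ord0 mulr1 => <-; congr (_ * e 0 _); apply: val_inj.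
have eb : e 0 1 = cis (- a).
  by apply: (mulfI (cis_neq0 a)); rewrite -ea de ea -cisD subrr cis0.
have eT : diag_mx e = torus a.
  apply/matrixP => i j; rewrite torusE mxE; case: eqP => // _; rewrite mulr1n.
  by case: i => [[|[|//]] ip] /=; rewrite -1?ea -1?eb; congr (e 0 _); apply: val_inj.
have cU : \det P * (\det P)^*%R = 1.
  by rewrite -{2}det_tr -det_map_mx -det_mulmx (unitarymxP PU) det1.
have c0 : \det P != 0 by apply: contra_eq_neq cU => ->; rewrite mul0r eq_sym oner_eq0.
pose D : 'rV[C]_2 := \row_j (if j == 0 then (\det P)^*%R else 1).
have DD : (diag_mx D)^t* *m diag_mx D = 1%:M.
  rewrite tr_diag_mx map_diag_mx mulmx_diag -diag_const_mx; congr diag_mx.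
  apply/rowP => j; rewrite !mxE; case: ifP => _; last by rewrite rmorph1 mulr1.
  by rewrite /= conjCK.
exists a, (diag_mx D *m P); split.
  apply/andP; split; last first.
    apply/eqP; rewrite det_mulmx det_diag !big_ord_recl big_ord0 !mxE /= !mulr1 mulrC cU //.
  apply: mul_unitarymx; last exact: PU.
  by rewrite -trmxC_unitary; apply/unitarymxP; rewrite trmxCK.
rewrite gE eT trmx_mul map_mxM -!mulmxA; congr (_ *m _); rewrite !mulmxA.
rewrite -eT; congr (_ *m _); rewrite -mulmxA mulmx_diag.
rewrite tr_diag_mx map_diag_mx mulmx_diag; congr diag_mx.
apply/rowP => j; rewrite !mxE mulrCA; case: ifP => _; last by rewrite rmorph1 !mulr1.
by rewrite /= conjCK cU mulr1.
Qed.

Section OneRep.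
Variables (d : nat) (rho : 'M[C]_2 -> 'M[C]_d).
Hypothesis rr : is_unirep (@SU2 R) rho.
Let G1 : 1%:M \in @SU2 R := su2_1 _.
Let GM := @su2_mul C.
Let GV := @su2_adj C.
Let GU := @su2_unitary C.

Lemma trace_conj (h g : 'M[C]_2) : h \in @SU2 R -> g \in @SU2 R ->
  \tr (rho (h^t* *m g *m h)) = \tr (rho g).
Proof.
move=> hS gS; have hV : h^t* \in @SU2 R by exact: GV.
rewrite !rr.1 ?GM // (unirepV G1 GV GU rr) //.
by rewrite mxtrace_mulC mulmxA (unitarymxP (rr.2 _ hS)) mul1mx.
Qed.

Lemma trace_torusN a : \tr (rho (torus (- a))) = \tr (rho (torus a)).
Proof.
have wS : su2_of 0 1 \in @SU2 R by apply: su2_ofP; rewrite !mul0r add0r rmorph1 mulr1.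
rewrite -(trace_conj wS (torus_su2 (- a))); congr (\tr (rho _)).
have -> : su2_of 0 1 ^t* *m torus (- a) = torus a *m su2_of 0 1 ^t*.
  apply/matrixP => i j; rewrite [LHS]mxE [RHS]mxE !big_ord_recl !big_ord0 !torusE !mxE.
  rewrite opprK; case: i => [[|[|//]] ?]; case: j => [[|[|//]] ?] /=;
  rewrite ?(rmorph0, rmorph1, rmorphN, oppr0, mulr0, mul0r, addr0, add0r, mulr1, mul1r) //.
  all: try by rewrite mulrC.
rewrite -mulmxA; suff -> : su2_of 0 1 ^t* *m su2_of 0 1 = 1%:M :> 'M[C]_2 by rewrite mulmx1.
by apply: mulmx1C; apply/unitarymxP/GU.
Qed.
End OneRep.
End Classification.

Section UnitaryDual.
Local Open Scope sesquilinear_scope.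
Variable R : realType.
Notation C := R[i].

Lemma irreducible_sympow n : irreducible_rep (@SU2 R) (@sympow C n).
Proof.
apply: (@sympow_irreducible _ _ (cis (n.+1%:R)^-1)); first exact: cis_norm.
move=> k /andP[k0 kn]; rewrite -cisMn; apply: cis_neq1.
have n0 : 0 < n.+1%:R :> R by rewrite ltr0n.
rewrite -(mulr_natl _ (2 * k)); apply/andP; split.
  by rewrite divr_gt0 // ltr0n muln_gt0.
rewrite ltr_pdivrMr //; apply: (@lt_le_trans _ _ (2 * n.+1%:R)).
  by rewrite natrM ltr_pM2l // ltr_nat ltnS.
by rewrite ler_pM2r //; have := pi_ge2 R; rewrite mulr2n; lra.
Qed.

Lemma near_forall_seq (T : Type) (I : eqType) (s : seq I) (F : set_system T)
  (FF : Filter F) (P : I -> T -> Prop) :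
  (forall i, i \in s -> \forall x \near F, P i x) ->
  \forall x \near F, forall i, i \in s -> P i x.
Proof.
elim: s => [_|i s IH H]; first by apply: filterE.
have h1 := H i (mem_head _ _).
have h2 : \forall x \near F, forall j, j \in s -> P j x.
  by apply: IH => j js; apply: H; rewrite inE js orbT.
by apply: filterS2 h1 h2 => x Pi Ps j; rewrite inE => /predU1P[->|/Ps].
Qed.

Lemma continuous_mx (T : topologicalType) m n (f : T -> 'M[C]_(m, n)) :
  (forall i j, continuous (fun x => f x i j)) -> continuous f.
Proof.
move=> fc x A [P nP PA].
have : \forall y \near x, A (f y); last by [].
have H : \forall y \near x, forall ij : 'I_m * 'I_n, ij \in enum {: 'I_m * 'I_n} -> P ij.1 ij.2 (f y ij.1 ij.2).
  by apply: near_forall_seq => -[i j] _; exact: (fc i j x _ (nP i j)).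
by apply: filterS H => y Hy; apply: PA => i j; apply: (Hy (i, j)); rewrite mem_enum.
Qed.

Section ContinuousCoefficients.
Variable T : topologicalType.

Lemma continuous_coef_linear (a b : T -> C) l : continuous a -> continuous b ->
  continuous (fun x => ((a x *: 'X + (b x)%:P) : {poly C})`_l).
Proof.
move=> ca cb.
have -> : (fun x => ((a x *: 'X + (b x)%:P) : {poly C})`_l) =
    (fun x => a x * (l == 1%N)%:R + (if l == 0%N then b x else 0)).
  by apply/funext => x; rewrite coefD coefZ coefX coefC.
move=> x; apply: cvgD; first by apply: cvgMr_tmp; exact: ca.
by case: (l == 0%N); [exact: cb|exact: cvg_cst].
Qed.

Lemma continuous_coefM (p q : T -> {poly C}) l :
  (forall i, continuous (fun x => (p x)`_i)) ->
  (forall i, continuous (fun x => (q x)`_i)) -> continuous (fun x => (p x * q x)`_l).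
Proof.
move=> cp cq.
have -> : (fun x => (p x * q x)`_l) = (fun x => \sum_(i < l.+1) (p x)`_i * (q x)`_(l - i)).
  by apply/funext => x; rewrite coefM.
move=> x; apply: cvg_big => [|i _]; first exact: add_continuous.
by apply: cvgM; [exact: cp|exact: cq].
Qed.

Lemma continuous_coefX (p : T -> {poly C}) m l :
  (forall i, continuous (fun x => (p x)`_i)) -> continuous (fun x => (p x ^+ m)`_l).
Proof.
move=> cp; elim: m l => [|m IH] l.
  have -> : (fun x => (p x ^+ 0)`_l) = cst (1%:P : {poly C})`_l by apply/funext.
  by move=> x; exact: cvg_cst.
have -> : (fun x => (p x ^+ m.+1)`_l) = (fun x => (p x * p x ^+ m)`_l).
  by apply/funext => x; rewrite exprS.
by apply: (@continuous_coefM p (fun x => p x ^+ m)) => i; [exact: cp|exact: IH].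
Qed.

Lemma continuous_coef_linpow (a b c d : T -> C) j k l :
  continuous a -> continuous b -> continuous c -> continuous d ->
  forall r : C, continuous (fun x => r * (linpow (a x) (b x) (c x) (d x) j k)`_l).
Proof.
move=> ca cb cc cd r x; apply: cvgMl_tmp.
rewrite /linpow.
apply: (@continuous_coefM (fun x => (a x *: 'X + (b x)%:P) ^+ j) (fun x => (c x *: 'X + (d x)%:P) ^+ k)) => i.
  by apply: (@continuous_coefX (fun x => a x *: 'X + (b x)%:P)) => h; exact: continuous_coef_linear.
by apply: (@continuous_coefX (fun x => c x *: 'X + (d x)%:P)) => h; exact: continuous_coef_linear.
Qed.
End ContinuousCoefficients.

Lemma continuous_sympow n : continuous (@sympow C n : 'M[C]_2 -> 'M[C]_n.+1).
Proof.
apply: continuous_mx => j k.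
under eq_fun do rewrite mxE.
by apply: continuous_coef_linpow; exact: coord_continuous.
Qed.

Lemma sympow_irrep_irreducible n (U : {vspace 'cV[C]_n.+1}) :
  (forall g v, g \in @SU2 R -> v \in U -> sympow n g *m v \in U) ->
  U = 0%VS \/ U = fullv.
Proof. exact: irreducible_sympow. Qed.

Definition sympow_irrep n : irrep R :=
  @Irrep R n.+1 (@sympow C n) (ltn0Sn n) (sympow_unirep C n).1 (sympow_unirep C n).2
    (continuous_subspaceT (@continuous_sympow n)) (@sympow_irrep_irreducible n).

Lemma irrep_unirep (rho : irrep R) : is_unirep (@SU2 R) rho.
Proof. by split; [exact: irrep_mul|exact: irrep_unitary]. Qed.

Lemma mulmx1_leq m n (X : 'M[C]_(m, n)) (S : 'M[C]_(n, m)) : X *m S = 1%:M -> (m <= n)%N.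
Proof.
move=> XS; have := mxrankM_maxl X S; rewrite XS mxrank1 => /leq_trans; apply.
exact: rank_leq_col.
Qed.

Lemma irrep_is_sympow (rho : irrep R) : exists n,
  irrep_deg rho = n.+1 /\
  exists (X : 'M[C]_(irrep_deg rho, n.+1)) (S : 'M[C]_(n.+1, irrep_deg rho)),
    [/\ X *m S = 1%:M, S *m X = 1%:M & forall g, g \in @SU2 R -> rho g *m X = X *m sympow n g].
Proof.
have rr := irrep_unirep rho.
have [k Hk] := rep_torus_diagonal_characters rr (@irrep_continuous R rho).
have [N [c Hc]] := weyl_comb_even_character Hk (trace_torusN rr).
have Hg g : g \in @SU2 R -> \tr (rho g) = \sum_(n < N) c n * \tr (sympow n g).
  move=> gS; have [a [h [hS ->]]] := exists_torus_conj gS.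
  rewrite (trace_conj rr hS (torus_su2 a)) Hc; apply: eq_bigr => n _.
  congr (_ * _); rewrite -trace_sympow_torus; apply/esym.
  exact: (trace_conj (sympow_unirep C n) hS (torus_su2 a)).
have [n [X [S [XS SX H]]]] := character_independence (su2_1 _) (@su2_mul _) (@su2_adj _) (@su2_unitary _)
  (irrep_deg_gt0 rho) rr (@irrep_irreducible R rho) (sympow_unirep C) irreducible_sympow Hg.
exists n; split; last by exists X, S.
by apply/eqP; rewrite eqn_leq (mulmx1_leq XS) (mulmx1_leq SX).
Qed.

Lemma trace_irrep (rho : irrep R) g : g \in @SU2 R ->
  \tr (rho g) = \tr (sympow (irrep_deg rho).-1 g).
Proof.
move=> gS; have [n [dn [X [S [XS SX H]]]]] := irrep_is_sympow rho.
have -> : (irrep_deg rho).-1 = n by rewrite dn.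
by rewrite -[rho g]mulmx1 -XS mulmxA H // mxtrace_mulC mulmxA SX mul1mx.
Qed.

Lemma irrep_iso_deg (rho sigma : irrep R) :
  irrep_deg rho = irrep_deg sigma -> irrep_iso rho sigma.
Proof.
have [n [dn [X [S [XS SX H]]]]] := irrep_is_sympow rho.
have [m [dm [Y [T [YT TY K]]]]] := irrep_is_sympow sigma.
rewrite dn dm => -[nm]; subst m.
exists (Y *m S), (X *m T); split => [||g gS].
- by rewrite mulmxA -(mulmxA Y) SX mulmx1.
- by rewrite mulmxA -(mulmxA X) TY mulmx1.
rewrite mulmxA K //; rewrite -!mulmxA; congr (_ *m _).
by rewrite -[LHS]mulmx1 -XS -!mulmxA (mulmxA (rho g)) H // !mulmxA SX mul1mx.
Qed.

Definition class_deg (c : SU2hat R) : nat := irrep_deg (repr c : irrep R).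

Lemma class_deg_gt0 c : (0 < class_deg c)%N.
Proof. exact: irrep_deg_gt0. Qed.

Lemma class_deg_inj : injective class_deg.
Proof.
move=> c1 c2 E; rewrite -[c1]generic_quotient.reprK -[c2]generic_quotient.reprK; apply/eqP.
by rewrite generic_quotient.eqquotE; apply/asboolP; apply: irrep_iso_deg.
Qed.

Lemma irrep_iso_eq_deg (rho sigma : irrep R) :
  irrep_iso rho sigma -> irrep_deg rho = irrep_deg sigma.
Proof.
move=> [T [S [TS ST _]]]; by apply/eqP; rewrite eqn_leq (mulmx1_leq ST) (mulmx1_leq TS).
Qed.

Lemma class_deg_surj n : (0 < n)%N -> exists c, class_deg c = n.
Proof.
case: n => // n _; exists (generic_quotient.pi (SU2hat R) (sympow_irrep n)).
rewrite /class_deg; case: (generic_quotient.piP (SU2hat R) (sympow_irrep n)) => rho.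
by move=> /generic_quotient.eqquotP/asboolP/irrep_iso_eq_deg <-.
Qed.
End UnitaryDual.

(** * Absolutely convergent complex series *)

Section ComplexSeries.
Variable R : realType.
Notation C := R[i].
Implicit Types (t u : nat -> C) (l : C).

Definition csums t l : Prop := forall e : R, 0 < e ->
  exists N, forall n, (N <= n)%N -> cmod (l - \sum_(k < n) t k) < e.

Definition bounded_sums (b : nat -> R) : Prop := exists M, forall n, \sum_(k < n) b k <= M.

Definition asum t : Prop := bounded_sums (fun n => cmod (t n)).

Lemma bounded_sums_dom (b : nat -> R) (c : nat -> R) (K : R) : 0 <= K ->
  (forall n, c n <= K * b n) -> bounded_sums b -> bounded_sums c.
Proof.
move=> K0 cb [M HM]; exists (K * M) => n.
apply: (@le_trans _ _ (\sum_(k < n) K * b k)); first exact: ler_sum.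
by rewrite -mulr_sumr ler_wpM2l.
Qed.

Lemma csums_uniq t l l' : csums t l -> csums t l' -> l = l'.
Proof.
move=> h h'; apply/eqP; rewrite -subr_eq0 -cmod_eq0; apply: contraT => n0.
have {}n0 : 0 < cmod (l - l') / 2 by rewrite divr_gt0 // lt0r n0 cmod_ge0.
have [N HN] := h _ n0; have [N' HN'] := h' _ n0.
have {}HN := HN _ (leq_maxl N N'); have {}HN' := HN' _ (leq_maxr N N').
have : cmod (l - l') < cmod (l - l').
  rewrite {1}(_ : l - l' = (l - \sum_(k < maxn N N') t k) - (l' - \sum_(k < maxn N N') t k)).
    by apply: (le_lt_trans (cmodB _ _)); rewrite (splitr (cmod (l - l'))) ltrD.
  by rewrite opprB addrA subrK.
by rewrite ltxx.
Qed.

Lemma csumsD t u l l' : csums t l -> csums u l' -> csums (fun n => t n + u n) (l + l').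
Proof.
move=> h h' e e0; have e2 : 0 < e / 2 by rewrite divr_gt0.
have [N HN] := h _ e2; have [N' HN'] := h' _ e2.
exists (maxn N N') => n; rewrite geq_max => /andP[n1 n2].
rewrite big_split opprD addrACA; apply: (le_lt_trans (cmodD _ _)).
by rewrite (splitr e) ltrD ?HN ?HN'.
Qed.

Lemma csumsZ a t l : csums t l -> csums (fun n => a * t n) (a * l).
Proof.
move=> h e e0; have a0 : 0 < cmod a + 1 by rewrite ltr_wpDl ?cmod_ge0.
have [N HN] := h _ (divr_gt0 e0 a0); exists N => n /HN H.
rewrite -mulr_sumr -mulrBr cmodM.
apply: (@le_lt_trans _ _ ((cmod a + 1) * cmod (l - \sum_(k < n) t k))).
  by rewrite ler_wpM2r ?cmod_ge0 // lerDl.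
by rewrite mulrC -ltr_pdivlMr.
Qed.

Lemma csums_eq t u l : (forall n, t n = u n) -> csums t l -> csums u l.
Proof.
move=> tu h e /h [N H]; exists N => n /H; congr (cmod (_ - _) < _).
by apply: eq_bigr.
Qed.

Lemma csums_le t l M : csums t l -> (forall n, \sum_(k < n) cmod (t k) <= M) -> cmod l <= M.
Proof.
move=> h HM; apply/ler_addgt0Pr => e /h [N /(_ _ (leqnn N)) H].
rewrite -[l](subrK (\sum_(k < N) t k)) addrC; apply: (le_trans (cmodD _ _)).
by rewrite lerD // ?(ltW H) // (le_trans (cmod_sum _ _ _)).
Qed.

Lemma csums_telescope (a : nat -> C) :
  (forall e : R, 0 < e -> exists N, forall n, (N <= n)%N -> cmod (a n) < e) ->
  csums (fun n => a n.+1 - a n) (- a 0%N).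
Proof.
move=> h e /h [N H]; exists N => n /H.
rewrite -(big_mkord xpredT (fun k => a k.+1 - a k)) telescope_sumr //.
by rewrite opprB addrA [- _ + _]addrC subrr add0r cmodN.
Qed.

Lemma real_abs_series (x : nat -> R) : bounded_sums (fun n => `|x n|) ->
  exists y : R, forall e : R, 0 < e -> exists N, forall n, (N <= n)%N -> `|y - \sum_(k < n) x k| < e.
Proof.
move=> [M HM].
have c1 : cvgn [normed series x].
  apply: nondecreasing_is_cvgn; first by apply: nondecreasing_series => *; exact: normr_ge0.
  by exists M => _ [n _ <-] /=; rewrite /series /= big_mkord.
have /cvg_ex[l /cvgrPdist_lt H] := normed_cvg c1.
exists l => e e0; have [N _ HN] := H e e0; exists N => n Nn.
by have := HN n Nn; rewrite /= /series /= big_mkord.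
Qed.

Lemma asum_csums t : asum t -> exists l, csums t l.
Proof.
move=> ta.
have Ret : bounded_sums (fun n => `|complex.Re (t n)|).
  by apply: (bounded_sums_dom ler01 _ ta) => n; rewrite mul1r Re_le_cmod.
have Imt : bounded_sums (fun n => `|complex.Im (t n)|).
  by apply: (bounded_sums_dom ler01 _ ta) => n; rewrite mul1r Im_le_cmod.
have [x Hx] := real_abs_series Ret; have [y Hy] := real_abs_series Imt.
exists (x +i* y) => e e0; have e2 : 0 < e / 2 by rewrite divr_gt0.
have [N HN] := Hx _ e2; have [N' HN'] := Hy _ e2.
exists (maxn N N') => n; rewrite geq_max => /andP[n1 n2].
apply: (le_lt_trans (cmod_le_ReIm _)); rewrite ReD ImD ReN ImN.
have -> : complex.Re (\sum_(k < n) t k) = \sum_(k < n) complex.Re (t k).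
  by apply: (big_morph (@complex.Re R) (@ReD R)); exact: erefl.
have -> : complex.Im (\sum_(k < n) t k) = \sum_(k < n) complex.Im (t k).
  by apply: (big_morph (@complex.Im R) (@ImD R)); exact: erefl.
by rewrite (splitr e) ltrD ?HN ?HN'.
Qed.

Definition csum t : C := xget 0 [set l | csums t l].

Lemma csumP t : asum t -> csums t (csum t).
Proof. by move=> /asum_csums[l tl]; exact: (@xgetI C 0 [set l | csums t l] l tl). Qed.

Lemma csumE t l : csums t l -> csum t = l.
Proof. move=> tl; apply: (csums_uniq _ tl); exact: (@xgetI C 0 [set l | csums t l] l tl). Qed.

Lemma eq_csum t u : (forall n, t n = u n) -> csum t = csum u.
Proof. by move=> /funext ->. Qed.

Lemma asum_dom t (b : nat -> R) (K : R) : 0 <= K -> bounded_sums b ->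
  (forall n, cmod (t n) <= K * b n) -> asum t.
Proof. by move=> K0 bb tb; apply: bounded_sums_dom K0 tb bb. Qed.

Lemma asumD t u : asum t -> asum u -> asum (fun n => t n + u n).
Proof.
move=> [M H] [M' H']; exists (M + M') => n.
apply: (@le_trans _ _ (\sum_(k < n) (cmod (t k) + cmod (u k)))).
  by apply: ler_sum => k _; apply: cmodD.
by rewrite big_split lerD.
Qed.

Lemma asumZ a t : asum t -> asum (fun n => a * t n).
Proof.
by move=> ta; apply: (asum_dom (cmod_ge0 a) ta) => n; rewrite cmodM.
Qed.

Lemma csumD t u : asum t -> asum u -> csum (fun n => t n + u n) = csum t + csum u.
Proof. by move=> /csumP ht /csumP hu; apply: csumE; apply: csumsD. Qed.

Lemma csumZ a t : asum t -> csum (fun n => a * t n) = a * csum t.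
Proof. by move=> /csumP ht; apply: csumE; apply: csumsZ. Qed.

Lemma csum0 : csum (fun=> 0) = 0.
Proof. by apply: csumE => e e0; exists 0%N => n _; rewrite big1 // subr0 cmod0. Qed.

Lemma csum_le t (b : nat -> R) (K M : R) : 0 <= K -> asum t ->
  (forall n, cmod (t n) <= K * b n) -> (forall n, \sum_(k < n) b k <= M) ->
  cmod (csum t) <= K * M.
Proof.
move=> K0 /csumP h tb HM; apply: csums_le h _ => n.
apply: (@le_trans _ _ (\sum_(k < n) K * b k)); first exact: ler_sum.
by rewrite -mulr_sumr ler_wpM2l.
Qed.

Lemma bounded_sums_tail (b : nat -> R) e : (forall n, 0 <= b n) -> bounded_sums b -> 0 < e ->
  exists N, forall n, (N <= n)%N -> \sum_(N <= k < n) b k < e.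
Proof.
move=> b0 bb e0; have e2 : 0 < e / 2 by rewrite divr_gt0.
have [|l Hl] := @real_abs_series b.
  by apply: (bounded_sums_dom ler01 _ bb) => n; rewrite mul1r ger0_norm.
have [N HN] := Hl _ e2; exists N => n Nn.
have h1 := HN _ (leqnn N); have h2 := HN _ Nn.
move: h1 h2; rewrite -!(big_mkord xpredT b) (big_cat_nat (leq0n N) Nn) /=.
set x := \sum_(0 <= i < N) b i; set y := \sum_(N <= i < n) b i.
by rewrite !ltr_norml; lra.
Qed.
End ComplexSeries.

Section ComplexExponential.
Variable R : realType.
Notation C := R[i].
Implicit Types (z s : C) (x y : R).

Lemma cexpD z s : cexp (z + s) = cexp z * cexp s.
Proof.
rewrite /cexp ReD ImD expRD cosD sinD; apply: complex_eq; rewrite ?cReM ?cImM /=; ring.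
Qed.
Lemma cexp0 : cexp (0 : C) = 1.
Proof. by rewrite /cexp /= expR0 cos0 sin0 !mul1r. Qed.
Lemma cmod_cexp z : cmod (cexp z) = expR (complex.Re z).
Proof.
have -> : cexp z = (expR (complex.Re z))%:C * cis (complex.Im z).
  by apply: complex_eq; rewrite ?cReM ?cImM /= ?mul0r ?subr0 ?addr0.
by rewrite cmodM cmod_cis mulr1 cmod_real ger0_norm // expR_ge0.
Qed.
Lemma cexp_neq0 z : cexp z != 0.
Proof. by rewrite -cmod_eq0 cmod_cexp expR_eq0. Qed.
Lemma cexpN z : cexp (- z) = (cexp z)^-1.
Proof.
by apply: (mulfI (cexp_neq0 z)); rewrite -cexpD subrr cexp0 mulfV ?cexp_neq0.
Qed.
Lemma cexp_real x : cexp x%:C = (expR x)%:C.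
Proof. by rewrite /cexp /= cos0 sin0 mulr1 mulr0. Qed.

(* x ^ (- s) for x > 0 *)
Definition cpow x s : C := cexp (- s * (ln x)%:C).

Lemma cmod_cpow x s : cmod (cpow x s) = expR (- complex.Re s * ln x).
Proof. by rewrite cmod_cexp cReM ReN ImN /= mulr0 subr0. Qed.
Lemma cpowD x s z : cpow x (s + z) = cpow x s * cpow x z.
Proof. by rewrite /cpow opprD mulrDl cexpD. Qed.
Lemma cpow0 x : cpow x 0 = 1.
Proof. by rewrite /cpow oppr0 mul0r cexp0. Qed.
Lemma cpow_nat x n : 0 < x -> cpow x n%:R = (x ^- n)%:C.
Proof.
move=> x0; elim: n => [|n IH]; first by rewrite cpow0 expr0 invr1.
rewrite -natr1 cpowD IH exprS invfM mulrC rmorphM; congr (_ * _).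
rewrite /cpow mulN1r -rmorphN cexp_real expRN lnK ?posrE //.
Qed.
Lemma cpow_mul x y s : 0 < x -> 0 < y -> cpow (x * y) s = cpow x s * cpow y s.
Proof. by move=> x0 y0; rewrite /cpow lnM ?posrE // rmorphD mulrDr cexpD. Qed.
Lemma cpow1 s : cpow 1 s = 1.
Proof. by rewrite /cpow ln1 mulr0 cexp0. Qed.

Definition pnat (p : R) (n : nat) : R := expR (- p * ln n.+1%:R).

Lemma pnat_ge0 p n : 0 <= pnat p n. Proof. exact: expR_ge0. Qed.

Lemma bounded_sums_pnat p : 1 < p -> bounded_sums (pnat p).
Proof.
move=> p1; have q0 : 0 < p - 1 by rewrite subr_gt0.
pose f n := expR (- (p - 1) * ln n.+1%:R).
have key n : pnat p n.+1 <= (p - 1)^-1 * (f n - f n.+1).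
  rewrite ler_pdivlMl //.
  have n1 : 0 < n.+1%:R :> R by rewrite ltr0n.
  have n2 : 0 < n.+2%:R :> R by rewrite ltr0n.
  have hl : n.+2%:R^-1 <= ln n.+2%:R - ln n.+1%:R :> R.
    have h : -1 < - (n.+2%:R^-1) :> R.
      by rewrite ltrN2 invf_lt1 // ltr1n.
    have := le_ln1Dx h; rewrite (_ : 1 - n.+2%:R^-1 = n.+1%:R / n.+2%:R); last first.
      have E2 : n.+2%:R = n.+1%:R + 1 :> R by rewrite natr1.
      by rewrite E2; field; rewrite nat1r natr1 pnatr_eq0.
    by rewrite ln_div ?posrE // => h2; rewrite -lerN2 opprB.
  have -> : pnat p n.+1 = f n.+1 * n.+2%:R^-1.
    have -> : n.+2%:R^-1 = expR (- ln n.+2%:R) :> R by rewrite expRN lnK ?posrE.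
    by rewrite /pnat /f -expRD; congr expR; ring.
  have -> : f n = f n.+1 * expR ((p - 1) * (ln n.+2%:R - ln n.+1%:R)).
    by rewrite /f -expRD; congr expR; ring.
  rewrite -{3}[f n.+1]mulr1 -mulrBr mulrCA ler_pM2l ?expR_gt0 //.
  rewrite lerBrDl; apply: le_trans (expR_ge1Dx _); rewrite lerD2l.
  by rewrite ler_pM2l.
exists (1 + (p - 1)^-1 * f 0%N) => n.
have H m : \sum_(k < m.+1) pnat p k <= 1 + (p - 1)^-1 * (f 0%N - f m).
  elim: m => [|m IH].
    by rewrite big_ord1 /pnat ln1 mulr0 expR0 subrr mulr0 addr0.
  rewrite big_ord_recr /=; apply: (le_trans (lerD IH (key m))).
  by rewrite -addrA -mulrDr addrA subrK.
case: n => [|n].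
  rewrite big_ord0 addr_ge0 // mulr_ge0 ?expR_ge0 // invr_ge0 ltW //.
apply: (le_trans (H n)); rewrite lerD2l ler_wpM2l ?invr_ge0 ?(ltW q0) //.
by rewrite lerBlDr lerDl expR_ge0.
Qed.
End ComplexExponential.

(** * Families differentiable with uniform remainder *)

Section RealVariable.
Variable R : realType.
Notation C := R[i].
Implicit Types (f g : R -> C) (x : R) (c d : C).

Definition cder f x d : Prop :=
  is_derive x 1 (fun u => complex.Re (f u)) (complex.Re d) /\
  is_derive x 1 (fun u => complex.Im (f u)) (complex.Im d).

Lemma cder_eq f x d d' : d = d' -> cder f x d -> cder f x d'.
Proof. by move=> ->. Qed.

Lemma cder_cst c x : cder (fun=> c) x 0.
Proof. by split; apply: is_derive_cst. Qed.

Lemma cderD f g x d e : cder f x d -> cder g x e -> cder (fun u => f u + g u) x (d + e).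
Proof.
move=> [fr fi] [gr gi]; split; rewrite ?ReD ?ImD.
  by rewrite (_ : (fun u => _) = (fun u => complex.Re (f u)) + (fun u => complex.Re (g u)));
    [exact: is_deriveD|apply/funext => u; rewrite ReD].
by rewrite (_ : (fun u => _) = (fun u => complex.Im (f u)) + (fun u => complex.Im (g u)));
    [exact: is_deriveD|apply/funext => u; rewrite ImD].
Qed.

Lemma cderZ c f x d : cder f x d -> cder (fun u => c * f u) x (c * d).
Proof.
case: c => a b [fr fi]; split.
  rewrite (_ : (fun u => _) = a \*: (fun u => complex.Re (f u)) - b \*: (fun u => complex.Im (f u))); last first.
    by apply/funext => u; rewrite cReM.
  by rewrite cReM; apply: is_deriveB.
rewrite (_ : (fun u => _) = a \*: (fun u => complex.Im (f u)) + b \*: (fun u => complex.Re (f u))); last first.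
  by apply/funext => u; rewrite cImM.
by rewrite cImM; apply: is_deriveD.
Qed.

Lemma cderN f x d : cder f x d -> cder (fun u => - f u) x (- d).
Proof.
move=> /(cderZ (-1)); rewrite mulN1r; congr (cder _ x _).
by apply/funext => u; rewrite mulN1r.
Qed.

Lemma cderMr (r : R -> R) (dr : R) f x d : is_derive x 1 r dr -> cder f x d ->
  cder (fun u => (r u)%:C * f u) x (dr%:C * f x + (r x)%:C * d).
Proof.
move=> hr [fr fi]; split.
  rewrite (_ : (fun u => _) = r * (fun u => complex.Re (f u))); last first.
    by apply/funext => u; rewrite cReM /= mul0r subr0.
  rewrite ReD !cReM /= !mul0r !subr0; apply: is_derive_eq.
  by rewrite addrC mulrC; congr (_ + _).
rewrite (_ : (fun u => _) = r * (fun u => complex.Im (f u))); last first.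
  by apply/funext => u; rewrite cImM /= mul0r addr0.
rewrite ImD !cImM /= !mul0r !addr0; apply: is_derive_eq.
by rewrite addrC mulrC; congr (_ + _).
Qed.

Lemma cder_cexp c (r : R -> R) (dr x : R) : is_derive x 1 r dr ->
  cder (fun u => cexp (c * (r u)%:C)) x (c * dr%:C * cexp (c * (r x)%:C)).
Proof.
case: c => a b hr.
have E u : cexp ((a +i* b) * (r u)%:C) = (expR (a * r u) * cos (b * r u)) +i* (expR (a * r u) * sin (b * r u)).
  by rewrite /cexp cReM cImM /= !mulr0 subr0 add0r.
have d1 : is_derive x 1 (fun u => a * r u) (a * dr) by apply: is_deriveZ.
have d2 : is_derive x 1 (fun u => b * r u) (b * dr) by apply: is_deriveZ.
have de : is_derive x 1 (fun u => expR (a * r u)) (a * dr * expR (a * r x)).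
  apply: is_derive_eq (is_derive1_comp (is_derive_expR _) d1) _.
  by rewrite /= mulrC.
have dc : is_derive x 1 (fun u => cos (b * r u)) (- (b * dr * sin (b * r x))).
  apply: is_derive_eq (is_derive1_comp (is_derive_cos _) d2) _.
  by rewrite /= mulNr mulrC.
have ds : is_derive x 1 (fun u => sin (b * r u)) (b * dr * cos (b * r x)).
  apply: is_derive_eq (is_derive1_comp (is_derive_sin _) d2) _.
  by rewrite /= mulrC.
split; under eq_fun do rewrite E /=.
  rewrite (_ : (fun u => _) = (fun u => expR (a * r u)) * (fun u => cos (b * r u))) //.
  apply: is_derive_eq; rewrite E !(cReM, cImM) /= -![_ *: _]/(_ * _); ring.
rewrite (_ : (fun u => _) = (fun u => expR (a * r u)) * (fun u => sin (b * r u))) //.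
apply: is_derive_eq; rewrite E !(cReM, cImM) /= -![_ *: _]/(_ * _); ring.
Qed.

Lemma real_mean_value (f : R -> R) (df : R -> R) (u M : R) :
  (forall x, `|x| <= `|u| -> is_derive x 1 f (df x)) ->
  (forall x, `|x| <= `|u| -> `|df x| <= M) -> `|f u - f 0| <= M * `|u|.
Proof.
move=> hd hM.
have key (a b : R) : a <= b -> (forall x, x \in `[a, b] -> `|x| <= `|u|) -> `|f b - f a| <= M * (b - a).
  move=> ab H; have [||c cab ->] := @MVT_segment R f df a b ab.
  - by move=> x xab; apply: hd; apply: H; apply: subset_itv_oo_cc.
  - apply: derivable_within_continuous => x xab.
    by have [] := hd x (H x xab).
  by rewrite normrM [X in _ * X]ger0_norm ?subr_ge0 // ler_wpM2r ?subr_ge0 // hM // H.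
have [u0|u0] := leP 0 u.
  have := key 0 u u0; rewrite subr0 ger0_norm //; apply => x; rewrite in_itv /= => /andP[x0 xu].
  by rewrite ger0_norm.
have := key u 0 (ltW u0); rewrite sub0r distrC ltr0_norm //; apply => x; rewrite in_itv /= => /andP[x0 xu].
by rewrite ler0_norm // lerN2.
Qed.

Lemma complex_mean_value f (df : R -> C) (u M : R) :
  (forall x, `|x| <= `|u| -> cder f x (df x)) ->
  (forall x, `|x| <= `|u| -> cmod (df x) <= M) -> cmod (f u - f 0) <= 2 * M * `|u|.
Proof.
move=> hd hM; apply: (le_trans (cmod_le_ReIm _)).
rewrite ReD ImD ReN ImN -mulrA mulrDl !mul1r; apply: lerD.
  apply: (@real_mean_value (fun x => complex.Re (f x)) (fun x => complex.Re (df x))) => x xu; first exact: (hd x xu).1.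
  exact: le_trans (Re_le_cmod _) (hM x xu).
apply: (@real_mean_value (fun x => complex.Im (f x)) (fun x => complex.Im (df x))) => x xu; first exact: (hd x xu).2.
exact: le_trans (Im_le_cmod _) (hM x xu).
Qed.
End RealVariable.

Section UniformDifferentiability.
Variable R : realType.
Notation C := R[i].

(* The functions [f i], for [i] in [D], are differentiable at [s] with derivative
   [f' i], with values, derivatives and second-order Taylor remainders
   controlled by a common multiple of [b i]. *)
Definition udiff (I : Type) (D : I -> Prop) (b : I -> R) (f f' : I -> C -> C) (s : C) : Prop :=
  exists K d : R, [/\ 0 <= K, 0 < d, d <= 1 & forall i, D i ->
    [/\ cmod (f i s) <= K * b i, cmod (f' i s) <= K * b i &
        forall h, cmod h <= d -> cmod (f i (s + h) - f i s - f' i s * h) <= K * b i * cmod h ^+ 2]].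

Variables (I : Type) (D : I -> Prop).
Implicit Types (b : I -> R) (f g : I -> C -> C).

Lemma udiff_eq b f f' g g' s :
  (forall i z, D i -> f i z = g i z) -> (forall i, D i -> f' i s = g' i s) ->
  udiff D b f f' s -> udiff D b g g' s.
Proof.
move=> fg fg' [K [d [K0 d0 d1 H]]]; exists K, d; split => // i Di.
by have [h1 h2 h3] := H i Di; split=> [||h /h3]; rewrite -?fg // -?fg' //.
Qed.

Lemma udiff_dom b c f f' s (k : R) : 0 <= k -> (forall i, D i -> b i <= k * c i) ->
  udiff D b f f' s -> udiff D c f f' s.
Proof.
move=> k0 bc [K [d [K0 d0 d1 H]]]; exists (K * k), d; split => //.
  exact: mulr_ge0.
move=> i Di; have [h1 h2 h3] := H i Di.
have L : K * b i <= K * k * c i by rewrite -mulrA ler_wpM2l // bc.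
split; [exact: le_trans h1 L|exact: le_trans h2 L|].
by move=> h /h3 h4; apply: (le_trans h4); rewrite ler_wpM2r // exprn_ge0 // cmod_ge0.
Qed.

Lemma udiffD b f f' g g' s : udiff D b f f' s -> udiff D b g g' s ->
  udiff D b (fun i z => f i z + g i z) (fun i z => f' i z + g' i z) s.
Proof.
move=> [K [d [K0 d0 d1 H]]] [K' [d' [K0' d0' d1' H']]].
exists (K + K'), (Num.min d d'); split; rewrite ?addr_ge0 ?lt_min ?d0 ?d0' ?ge_min ?d1 //.
move=> i Di; have [h1 h2 h3] := H i Di; have [h1' h2' h3'] := H' i Di; split.
- by rewrite mulrDl; apply: (le_trans (cmodD _ _)); apply: lerD.
- by rewrite mulrDl; apply: (le_trans (cmodD _ _)); apply: lerD.
move=> h; rewrite le_min => /andP[/h3 l1 /h3' l2].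
have -> : f i (s + h) + g i (s + h) - (f i s + g i s) - (f' i s + g' i s) * h =
   (f i (s + h) - f i s - f' i s * h) + (g i (s + h) - g i s - g' i s * h) by ring.
by rewrite !mulrDl; apply: (le_trans (cmodD _ _)); apply: lerD.
Qed.

Lemma udiffM b c f f' g g' s :
  udiff D b f f' s -> udiff D c g g' s ->
  udiff D (fun i => b i * c i) (fun i z => f i z * g i z)
    (fun i z => f' i z * g i z + f i z * g' i z) s.
Proof.
move=> [K [d [K0 d0 d1 H]]] [K' [d' [K0' d0' d1' H']]].
exists (6 * (K * K')), (Num.min d d'); split.
- by rewrite !mulr_ge0.
- by rewrite lt_min d0.
- by rewrite ge_min d1.
move=> i Di; have [h1 h2 h3] := H i Di; have [h1' h2' h3'] := H' i Di.
set x := K * b i in h1 h2 h3; set y := K' * c i in h1' h2' h3'.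
have -> : 6 * (K * K') * (b i * c i) = 6 * (x * y) by rewrite /x /y; ring.
have x0 : 0 <= x := le_trans (cmod_ge0 _) h1.
have y0 : 0 <= y := le_trans (cmod_ge0 _) h1'.
have xy0 : 0 <= x * y by exact: mulr_ge0.
have pm (z w : C) : cmod z <= x -> cmod w <= y -> cmod (z * w) <= x * y.
  by move=> zx wy; rewrite cmodM ler_pM ?cmod_ge0.
split.
- by apply: (le_trans (pm _ _ h1 h1')); lra.
- apply: (le_trans (cmodD _ _)); have := pm _ _ h2 h1'; have := pm _ _ h1 h2'; lra.
move=> h; rewrite le_min => /andP[hd hd'].
have {h3}l1 := h3 h hd; have {h3'}l2 := h3' h hd'.
set t := cmod h in hd hd' l1 l2 *; have t0 : 0 <= t := cmod_ge0 h.
have t1 : t <= 1 := le_trans hd d1.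
have tt : t ^+ 2 <= t by rewrite expr2 ler_piMr.
set A := f i (s + h) - f i s - f' i s * h in l1.
set B := g i (s + h) - g i s - g' i s * h in l2.
have -> : f i (s + h) * g i (s + h) - f i s * g i s - (f' i s * g i s + f i s * g' i s) * h =
  A * (g i s + g' i s * h + B) + (f' i s * h) * (g' i s * h + B) + f i s * B by rewrite /A /B; ring.
have e1 : cmod (g' i s * h) <= y * t by rewrite cmodM ler_wpM2r.
have e2 : cmod (f' i s * h) <= x * t by rewrite cmodM ler_wpM2r.
have yt : y * t ^+ 2 <= y * t by rewrite ler_wpM2l.
have yt1 : y * t <= y by rewrite ler_piMr.
have e3 : cmod (g' i s * h + B) <= 2 * (y * t).
  by apply: (le_trans (cmodD _ _)); lra.
have e4 : cmod (g i s + g' i s * h + B) <= 3 * y.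
  by rewrite -addrA; apply: (le_trans (cmodD _ _)); lra.
have f1 : cmod (A * (g i s + g' i s * h + B)) <= (x * t ^+ 2) * (3 * y).
  by rewrite cmodM ler_pM ?cmod_ge0.
have f2 : cmod (f' i s * h * (g' i s * h + B)) <= (x * t) * (2 * (y * t)).
  by rewrite cmodM ler_pM ?cmod_ge0.
have f3 : cmod (f i s * B) <= x * (y * t ^+ 2) by rewrite cmodM ler_pM ?cmod_ge0.
apply: (le_trans (cmodD _ _)); apply: (le_trans (lerD (cmodD _ _) (lexx _))).
apply: (le_trans (lerD (lerD f1 f2) f3)).
by rewrite le_eqVlt; apply/orP; left; apply/eqP; ring.
Qed.

Lemma udiff_cst (c : I -> C) b s (K : R) : 0 <= K -> (forall i, D i -> cmod (c i) <= K * b i) ->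
  udiff D b (fun i _ => c i) (fun _ _ => 0) s.
Proof.
move=> K0 H; exists K, 1; split => // i /H h; split=> //.
  by rewrite cmod0 (le_trans (cmod_ge0 _) h).
move=> z _; rewrite mul0r subr0 subrr cmod0 mulr_ge0 ?exprn_ge0 ?cmod_ge0 //.
exact: le_trans (cmod_ge0 _) h.
Qed.

Lemma udiff_id s : udiff D (fun=> 1) (fun _ z => z) (fun _ _ => 1) s.
Proof.
exists (cmod s + 1), 1; split; rewrite ?addr_ge0 ?cmod_ge0 // => i _; rewrite !mulr1; split.
- by rewrite lerDl.
- by rewrite cmod1 lerDr cmod_ge0.
- move=> h _; rewrite mul1r (_ : s + h - s - h = 0) ?cmod0; last by ring.
  by rewrite mulr_ge0 ?exprn_ge0 ?cmod_ge0 // addr_ge0 ?cmod_ge0.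
Qed.

Lemma udiff_shift b f f' s a : udiff D b f f' (s + a) ->
  udiff D b (fun i z => f i (z + a)) (fun i z => f' i (z + a)) s.
Proof.
move=> [K [d [K0 d0 d1 H]]]; exists K, d; split => // i Di.
have [h1 h2 h3] := H i Di; split => // h /h3.
by rewrite (_ : s + a + h = s + h + a) //; ring.
Qed.

Lemma udiffZ b f f' s (c : C) : udiff D b f f' s ->
  udiff D b (fun i z => c * f i z) (fun i z => c * f' i z) s.
Proof.
move=> H; have hc : udiff D (fun=> 1) (fun _ _ => c) (fun _ _ => 0) s.
  by apply: (udiff_cst _ (cmod_ge0 c)) => i _; rewrite mulr1.
have h1 : udiff D b (fun i z => c * f i z) (fun i z => 0 * f i z + c * f' i z) s.
  by apply: (udiff_dom ler01 _ (udiffM hc H)) => i _; rewrite !mul1r.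
by apply: (udiff_eq _ _ h1) => // i _; rewrite mul0r add0r.
Qed.
End UniformDifferentiability.

Lemma udiff_reindex (R : realType) (I J : Type) (D : I -> Prop) (E : J -> Prop) (phi : J -> I)
    (b : I -> R) f f' s :
  (forall j, E j -> D (phi j)) -> udiff D b f f' s ->
  udiff E (fun j => b (phi j)) (fun j => f (phi j)) (fun j => f' (phi j)) s.
Proof.
by move=> ED [K [d [K0 d0 d1 H]]]; exists K, d; split => // j /ED; apply: H.
Qed.

Section Holomorphic.
Variable R : realType.
Notation C := R[i].
Implicit Types (f g : C -> C) (s : C).

Definition hol f s : Prop :=
  exists f' : C -> C, udiff (fun _ : unit => True) (fun=> 1) (fun=> f) (fun=> f') s.

Lemma holP f s : hol f s <-> exists (l : C) (K d : R), [/\ 0 <= K, 0 < d &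
   forall h, cmod h <= d -> cmod (f (s + h) - f s - l * h) <= K * cmod h ^+ 2].
Proof.
split=> [[f' [K [d [K0 d0 d1 H]]]]|[l [K [d [K0 d0 H]]]]].
  by exists (f' s), K, d; split => // h hd; have [_ _] := H tt I; rewrite mulr1; apply.
exists (fun=> l), (K + cmod (f s) + cmod l), (Num.min d 1).
have c0 := cmod_ge0 (f s); have c1 := cmod_ge0 l.
split; rewrite ?addr_ge0 ?lt_min ?d0 ?ltr01 ?ge_min ?lexx ?orbT //.
move=> _ _; rewrite !mulr1; split; [lra|lra|move=> h].
rewrite le_min => /andP[/H h1 _]; apply: (le_trans h1).
by rewrite ler_wpM2r ?exprn_ge0 ?cmod_ge0 //; lra.
Qed.

Lemma hol_near f g s : (exists2 d : R, 0 < d & forall h, cmod h <= d -> f (s + h) = g (s + h)) ->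
  hol f s -> hol g s.
Proof.
move=> [e e0 fg] /holP[l [K [d [K0 d0 H]]]]; apply/holP; exists l, K, (Num.min d e); split => //.
  by rewrite lt_min d0.
move=> h; rewrite le_min => /andP[hd he]; rewrite -fg // -[g s](_ : f s = g s) ?H //.
by have := fg 0; rewrite addr0 cmod0; apply; exact: ltW.
Qed.

Lemma holD f g s : hol f s -> hol g s -> hol (fun z => f z + g z) s.
Proof. by move=> [f' Hf] [g' Hg]; eexists; exact: udiffD Hf Hg. Qed.

Lemma holM f g s : hol f s -> hol g s -> hol (fun z => f z * g z) s.
Proof.
move=> [f' Hf] [g' Hg]; exists (fun z => f' z * g z + f z * g' z).
by apply: (udiff_dom ler01 _ (udiffM Hf Hg)) => // i _; rewrite mulr1.
Qed.

Lemma hol_cst c s : hol (fun=> c) s.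
Proof.
exists (fun=> 0); apply: (udiff_cst _ (cmod_ge0 c)).
by move=> i _; rewrite mulr1.
Qed.

Lemma hol_id s : hol id s.
Proof. by exists (fun=> 1); exact: udiff_id. Qed.

Lemma hol_shift f a s : hol f (s + a) -> hol (fun z => f (z + a)) s.
Proof. by move=> [f' H]; exists (fun z => f' (z + a)); exact: (@udiff_shift _ _ _ _ (fun=> f) (fun=> f') s a H). Qed.

Lemma hol_sum (J : Type) (r : seq J) (F : J -> C -> C) s :
  (forall j, hol (F j) s) -> hol (fun z => \sum_(j <- r) F j z) s.
Proof.
move=> H; elim: r => [|j r IH].
  by under eq_fun do rewrite big_nil; exact: hol_cst.
by under eq_fun do rewrite big_cons; exact: holD.
Qed.

Lemma hol_csum (b : nat -> R) (f f' : nat -> C -> C) s : bounded_sums b -> (forall n, 0 <= b n) ->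
  udiff (fun=> True) b f f' s -> hol (fun z => csum (fun n => f n z)) s.
Proof.
move=> [M HM] b0 [K [d [K0 d0 d1 H]]]; apply/holP.
have bb : bounded_sums b by exists M.
exists (csum (fun n => f' n s)), (K * M), d; split => //.
  by rewrite mulr_ge0 //; have := HM 0%N; rewrite big_ord0.
move=> h hd.
have a0 : asum (fun n => f n s) by apply: (asum_dom K0 bb) => n; have [] := H n I.
have a1 : asum (fun n => f' n s) by apply: (asum_dom K0 bb) => n; have [] := H n I.
have a2 : asum (fun n => f n (s + h) - f n s - f' n s * h).
  apply: (asum_dom _ bb (K := K * cmod h ^+ 2)); first by rewrite mulr_ge0 ?exprn_ge0 ?cmod_ge0.
  by move=> n; have [_ _ /(_ h hd)] := H n I; rewrite mulrAC.
have E : csum (fun n => f n (s + h)) = csum (fun n => f n (s + h) - f n s - f' n s * h)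
     + (csum (fun n => f n s) + h * csum (fun n => f' n s)).
  rewrite -csumZ // -csumD //; last exact: asumZ.
  rewrite -csumD //; last by apply: asumD => //; exact: asumZ.
  by apply: eq_csum => n; ring.
rewrite E (_ : _ - _ - _ = csum (fun n => f n (s + h) - f n s - f' n s * h)); last by ring.
rewrite -mulrA [M * _]mulrC mulrA; apply: (csum_le _ a2 _ HM).
  by rewrite mulr_ge0 ?exprn_ge0 ?cmod_ge0.
by move=> n; have [_ _ /(_ h hd)] := H n I; rewrite mulrAC.
Qed.

Lemma hol_derivable f s : hol f s -> derivable f s 1.
Proof.
move=> /holP[l [K [d [K0 d0 H]]]]; apply/cvg_ex; exists l.
apply/cvgrPdist_lt => e e0.
have [r Er] : exists r : R, e = r%:C by exists (complex.Re e); rewrite RRe_real // gtr0_real.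
rewrite Er ltcR in e0 *.
have K1 : 0 < K + 1 by rewrite ltr_wpDl.
pose m := Num.min d (r / (K + 1)); have m0 : 0 < m by rewrite lt_min d0 divr_gt0.
apply/nbhs_ballP; exists m%:C; first by rewrite /= ltcR.
move=> h; rewrite /ball /= sub0r normrN normcE ltcR lt_min => /andP[hd hr] h0.
rewrite normcE ltcR -[h *: 1]/(h * 1) mulr1 [h + s]addrC -[_ *: _]/(_ * _).
have ch : 0 < cmod h by rewrite cmod_gt0.
rewrite -(ltr_pM2l ch) -cmodM mulrBr mulrA divff // mul1r.
rewrite -cmodN opprB [h * l]mulrC.
apply: (le_lt_trans (H h (ltW hd))); rewrite expr2 mulrCA ltr_pM2l //.
rewrite ltr_pdivlMr // in hr; apply: le_lt_trans hr; rewrite mulrC ler_wpM2l ?(ltW ch) //.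
by rewrite lerDl.
Qed.

Lemma hol_continuous f s : hol f s -> {for s, continuous f}.
Proof.
by move=> /hol_derivable /derivable1_diffP /differentiable_continuous.
Qed.
End Holomorphic.

Section ExponentialFamilies.
Variable R : realType.
Notation C := R[i].
Implicit Types (s z h w : C).

Lemma cder_id w x : cder (fun t : R => w * t%:C) x w.
Proof.
have h : is_derive x 1 (fun t : R => t) 1 by apply: is_derive_id.
have := cderMr h (cder_cst w x); rewrite mulr0 addr0 mul1r; congr (cder _ x _).
by apply/funext => t; rewrite mulrC.
Qed.

Lemma cder_cexp_id w (x : R) : cder (fun t : R => cexp (w * t%:C)) x (w * cexp (w * x%:C)).
Proof.
have h : is_derive x 1 (fun t : R => t) 1 by apply: is_derive_id.
by have := cder_cexp w h; rewrite mulr1.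
Qed.

Lemma cexp_taylor1 w (t : R) : `|t| <= 1 ->
  cmod (cexp (w * t%:C) - 1) <= 2 * (cmod w * expR (cmod w)) * `|t|.
Proof.
move=> t1.
have := @complex_mean_value R (fun t : R => cexp (w * t%:C)) (fun x => w * cexp (w * x%:C)) t (cmod w * expR (cmod w)).
rewrite mulr0 cexp0; apply.
  by move=> x _; apply: cder_cexp_id.
move=> x xt; rewrite cmodM cmod_cexp ler_wpM2l ?cmod_ge0 // ler_expR.
apply: (le_trans (ler_norm _)); apply: (le_trans (Re_le_cmod _)).
by rewrite cmodM cmod_real ler_piMr ?cmod_ge0 // (le_trans xt).
Qed.

Lemma cexp_taylor2 w : cmod (cexp w - 1 - w) <= 4 * cmod w ^+ 2 * expR (cmod w).
Proof.
have := @complex_mean_value R (fun t : R => cexp (w * t%:C) - 1 - w * t%:C)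
  (fun x => w * cexp (w * x%:C) - 0 - w) 1 (2 * (cmod w * expR (cmod w)) * cmod w).
rewrite normr1 !mulr1 mulr0 cexp0 !subrr subr0 => H; apply: le_trans (H _ _) _.
- move=> x _; apply: cderD; last by apply: cderN; apply: cder_id.
  by apply: cderD; [apply: cder_cexp_id|apply: cderN; apply: cder_cst].
- move=> x x1; rewrite subr0 -{3}[w]mulr1 -mulrBr cmodM mulrC ler_wpM2r ?cmod_ge0 //.
  apply: (le_trans (cexp_taylor1 w x1)); rewrite ler_piMr // mulr_ge0 // mulr_ge0 ?cmod_ge0 ?expR_ge0 //.
- by rewrite le_eqVlt; apply/orP; left; apply/eqP; ring.
Qed.

Lemma udiff_cexp (I : Type) (D : I -> Prop) (l : I -> R) s (d : R) : 0 < d -> d <= 1 ->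
  udiff D (fun i => expR (complex.Re s * l i) * (1 + l i ^+ 2) * expR (d * `|l i|))
    (fun i z => cexp (z * (l i)%:C)) (fun i z => (l i)%:C * cexp (z * (l i)%:C)) s.
Proof.
move=> d0 d1; exists 4, d; split => // i _.
have c1 : cmod (cexp (s * (l i)%:C)) = expR (complex.Re s * l i).
  by rewrite cmod_cexp cReM /= mulr0 subr0.
set X := expR (complex.Re s * l i) in c1 *; set E := expR (d * `|l i|).
have X0 : 0 <= X := expR_ge0 _.
have E1 : 1 <= E by rewrite -expR0 ler_expR mulr_ge0 // ltW.
have l0 : `|l i| <= 1 + l i ^+ 2.
  rewrite -real_normK ?num_real //; have := sqr_ge0 (`|l i| - 2^-1); rewrite sqrrB; lra.
have l1 : 0 <= 1 + l i ^+ 2 by rewrite addr_ge0 ?sqr_ge0.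
have ll : 1 <= 1 + l i ^+ 2 by rewrite lerDl sqr_ge0.
have XE : X * (1 + l i ^+ 2) <= 4 * (X * (1 + l i ^+ 2) * E).
  have h : X * (1 + l i ^+ 2) <= X * (1 + l i ^+ 2) * E by rewrite ler_peMr // mulr_ge0.
  apply: (le_trans h); rewrite ler_peMl ?mulr_ge0 ?expR_ge0 //; lra.
split.
- by rewrite c1; apply: le_trans XE; rewrite ler_peMr.
- by rewrite cmodM c1 cmod_real mulrC; apply: le_trans XE; rewrite ler_wpM2l.
move=> h hd.
have -> : cexp ((s + h) * (l i)%:C) - cexp (s * (l i)%:C) - (l i)%:C * cexp (s * (l i)%:C) * h =
   cexp (s * (l i)%:C) * (cexp (h * (l i)%:C) - 1 - h * (l i)%:C).
  by rewrite mulrDl cexpD; ring.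
rewrite cmodM c1.
have t2 := cexp_taylor2 (h * (l i)%:C); rewrite cmodM cmod_real in t2.
have e2 : expR (cmod h * `|l i|) <= E by rewrite ler_expR ler_wpM2r.
have t3 : cmod (cexp (h * (l i)%:C) - 1 - h * (l i)%:C) <= 4 * cmod h ^+ 2 * (1 + l i ^+ 2) * E.
  apply: (le_trans t2); rewrite exprMn real_normK ?num_real //.
  have H0 : 0 <= cmod h ^+ 2 by apply: sqr_ge0.
  have L0 : 0 <= l i ^+ 2 by apply: sqr_ge0.
  have m1 : 4 * (cmod h ^+ 2 * l i ^+ 2) <= 4 * cmod h ^+ 2 * (1 + l i ^+ 2).
    rewrite [leLHS]mulrA; apply: ler_wpM2l; first exact: mulr_ge0.
    by rewrite lerDr.
  by apply: ler_pM => //; apply: mulr_ge0 => //; apply: mulr_ge0.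
apply: (le_trans (ler_wpM2l X0 t3)).
by rewrite le_eqVlt; apply/orP; left; apply/eqP; ring.
Qed.

Lemma udiff_cexp_bounded (I : Type) (D : I -> Prop) (l : I -> R) s :
  (forall i, D i -> `|l i| <= 1) ->
  udiff D (fun=> 1) (fun i z => cexp (z * (l i)%:C)) (fun i z => (l i)%:C * cexp (z * (l i)%:C)) s.
Proof.
move=> hl; apply: (udiff_dom _ _ (udiff_cexp D l s ltr01 (lexx _))
  (k := expR `|complex.Re s| * 2 * expR 1)).
  by rewrite !mulr_ge0 ?expR_ge0.
move=> i /hl li; rewrite mulr1; apply: ler_pM; rewrite ?mulr_ge0 ?addr_ge0 ?sqr_ge0 ?expR_ge0 //.
  apply: ler_pM; rewrite ?addr_ge0 ?sqr_ge0 ?expR_ge0 //.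
    rewrite ler_expR; apply: (le_trans (ler_norm _)); rewrite normrM ler_piMr //.
  rewrite -real_normK ?num_real //; have : `|l i| ^+ 2 <= 1 by rewrite exprn_ile1.
  lra.
by rewrite ler_expR mul1r.
Qed.

Definition dcpow (x : R) s : C := - (ln x)%:C * cpow x s.

Lemma udiff_cpow_nat s (e : R) : 0 < e ->
  udiff (fun=> True) (pnat (complex.Re s - e)) (fun n => cpow n.+1%:R) (fun n => dcpow n.+1%:R) s.
Proof.
move=> e0; pose d := Num.min 1 (e / 2); have e2 : 0 < e / 2 by rewrite divr_gt0.
have d0 : 0 < d by rewrite lt_min ltr01.
have d1 : d <= 1 by rewrite ge_min lexx.
have de : d <= e / 2 by rewrite ge_min lexx orbT.
have h := udiff_cexp (fun _ : nat => True) (fun n => - ln n.+1%:R) s d0 d1.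
have {}h : udiff (fun=> True) (pnat (complex.Re s - e)) (fun n z => cexp (z * (- ln n.+1%:R)%:C))
    (fun n z => (- ln n.+1%:R)%:C * cexp (z * (- ln n.+1%:R)%:C)) s.
  apply: (udiff_dom (k := 1 + 2 / (e / 2) ^+ 2) _ _ h).
    by rewrite addr_ge0 // divr_ge0 // exprn_ge0 // ltW.
  move=> n _; set L := ln n.+1%:R; have L0 : 0 <= L by apply: ln_ge0; rewrite ler1n.
  have -> : pnat (complex.Re s - e) n = expR (complex.Re s * - L) * expR (e / 2 * L) * expR (e / 2 * L).
    by rewrite /pnat -/L -!expRD; congr expR; field.
  rewrite normrN (ger0_norm L0) sqrrN !mulrA.
  apply: ler_pM; rewrite ?mulr_ge0 ?addr_ge0 ?sqr_ge0 ?expR_ge0 //; last first.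
    by rewrite ler_expR ler_wpM2r.
  rewrite mulrAC [leRHS]mulrC ler_wpM2l ?expR_ge0 //.
  have x0 : 0 <= e / 2 * L by rewrite mulr_ge0 // ltW.
  have h1 := expR_ge1Dxn 1 x0.
  have h2 : 0 <= (e / 2 * L) ^+ 2 by apply: sqr_ge0.
  rewrite mulrDl mul1r; apply: lerD.
    by apply: le_trans (expR_ge1Dx _); rewrite lerDl.
  rewrite mulrAC ler_pdivlMr ?exprn_gt0 // -exprMn [L * _]mulrC.
  rewrite /= (_ : 2`!%:R = 2) // in h1; lra.
have E z (x : R) : cexp (z * (- x)%:C) = cexp (- z * x%:C) by rewrite rmorphN mulrN mulNr.
by apply: (udiff_eq _ _ h) => n *; rewrite E // rmorphN.
Qed.

(* The coefficient of [u ^ j] in [(1 + u) ^ (- s)]; this recursion is the one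
   produced by differentiation with respect to [u]. *)
Fixpoint nbinom (j : nat) s : C :=
  if j is j'.+1 then - s / j%:R * nbinom j' (s + 1) else 1.

Fixpoint dnbinom (j : nat) s : C :=
  if j is j'.+1 then - (nbinom j' (s + 1) + s * dnbinom j' (s + 1)) / j%:R else 0.

Definition brem (J : nat) (u : R) s : C :=
  cpow (1 + u) s - \sum_(j < J) nbinom j s * (u ^+ j)%:C.

Definition dbrem (J : nat) (u : R) s : C :=
  dcpow (1 + u) s - \sum_(j < J) dnbinom j s * (u ^+ j)%:C.

Lemma is_derive_pow n (x : R) : is_derive x 1 (fun u : R => u ^+ n) (n%:R * x ^+ n.-1).
Proof.
elim: n => [|n IH].
  rewrite mul0r (_ : (fun u : R => _) = cst 1); first exact: is_derive_cst.
  by apply/funext => u; rewrite expr0.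
rewrite (_ : (fun u : R => _) = (fun u : R => u) * (fun u => u ^+ n)); last first.
  by apply/funext => u; rewrite exprS.
apply: is_derive_eq (is_deriveM (is_derive_id _ _) IH) _.
rewrite -![_ *: _]/(_ * _) mulr1 /= -natr1 mulrDl mul1r; congr (_ + _).
by case: n {IH} => [|n]; rewrite ?mul0r ?mulr0 // mulrCA -exprS.
Qed.

Lemma cder_sum_pow (c : nat -> C) n x :
  cder (fun u => \sum_(j < n.+1) c j * (u ^+ j)%:C) x
       (\sum_(j < n) c j.+1 * j.+1%:R * (x ^+ j)%:C).
Proof.
elim: n => [|n IH].
  under eq_fun do rewrite big_ord1 expr0 mulr1; rewrite big_ord0; exact: cder_cst.
under eq_fun do rewrite big_ord_recr /=.
rewrite big_ord_recr /=; apply: cderD => //.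
have := cderMr (is_derive_pow n.+1 x) (cder_cst (c n.+1) x); rewrite mulr0 addr0.
move=> h; rewrite (_ : (fun u => c n.+1 * (u ^+ n.+1)%:C) = (fun u => (u ^+ n.+1)%:C * c n.+1)).
  by apply: cder_eq h; rewrite rmorphM rmorph_nat; ring.
by apply/funext => u; rewrite mulrC.
Qed.

Lemma cpow_one (x : R) : 0 < x -> cpow x 1 = (x^-1)%:C.
Proof. by move=> x0; have := cpow_nat 1 x0; rewrite expr1. Qed.

Lemma cder_cpow_1D s (x : R) : -1 < x ->
  cder (fun u => cpow (1 + u) s) x (- s * cpow (1 + x) (s + 1)).
Proof.
move=> x1; have x0 : 0 < 1 + x by rewrite -ltrBlDl sub0r.
have d1 : is_derive x 1 (fun u : R => 1 + u) 1.
  by apply: is_derive_eq (is_deriveD (is_derive_cst _ _ _) (is_derive_id _ _)) _; rewrite add0r.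
have dl : is_derive x 1 (fun u : R => ln (1 + u)) (1 + x)^-1.
  by apply: is_derive_eq (is_derive1_comp (is_derive1_ln x0) d1) _; rewrite mulr1.
apply: cder_eq (cder_cexp (- s) dl); rewrite cpowD cpow_one // /cpow; ring.
Qed.

Lemma cder_dcpow_1D s (x : R) : -1 < x ->
  cder (fun u => dcpow (1 + u) s) x (- (cpow (1 + x) (s + 1) + s * dcpow (1 + x) (s + 1))).
Proof.
move=> x1; have x0 : 0 < 1 + x by rewrite -ltrBlDl sub0r.
have d1 : is_derive x 1 (fun u : R => 1 + u) 1.
  by apply: is_derive_eq (is_deriveD (is_derive_cst _ _ _) (is_derive_id _ _)) _; rewrite add0r.
have dl : is_derive x 1 (fun u : R => ln (1 + u)) (1 + x)^-1.
  by apply: is_derive_eq (is_derive1_comp (is_derive1_ln x0) d1) _; rewrite mulr1.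
have h := cderN (cderMr dl (cder_cpow_1D s x1)).
rewrite /dcpow; under eq_fun do rewrite mulNr.
apply: cder_eq h; rewrite cpowD cpow_one //; ring.
Qed.

Lemma nbinomS j s : nbinom j.+1 s * j.+1%:R = - s * nbinom j (s + 1).
Proof. by rewrite /= mulrAC divfK // pnatr_eq0. Qed.

Lemma dnbinomS j s : dnbinom j.+1 s * j.+1%:R = - (nbinom j (s + 1) + s * dnbinom j (s + 1)).
Proof. by rewrite /= divfK // pnatr_eq0. Qed.

Lemma cder_brem J s (x : R) : -1 < x ->
  cder (fun u => brem J.+1 u s) x (- s * brem J x (s + 1)).
Proof.
move=> x1; apply: cder_eq (cderD (cder_cpow_1D s x1) (cderN (cder_sum_pow (fun j => nbinom j s) J x))).
rewrite /brem mulrBr mulr_sumr; congr (_ - _); apply: eq_bigr => j _.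
by rewrite nbinomS mulrA.
Qed.

Lemma cder_dbrem J s (x : R) : -1 < x ->
  cder (fun u => dbrem J.+1 u s) x (- (brem J x (s + 1) + s * dbrem J x (s + 1))).
Proof.
move=> x1; apply: cder_eq (cderD (cder_dcpow_1D s x1) (cderN (cder_sum_pow (fun j => dnbinom j s) J x))).
rewrite (eq_bigr (fun j : 'I_J => - (nbinom j (s + 1) * (x ^+ j)%:C + s * (dnbinom j (s + 1) * (x ^+ j)%:C)))); last first.
  by move=> j _; rewrite dnbinomS; ring.
rewrite sumrN big_split /= -mulr_sumr /brem /dbrem. ring.
Qed.

Lemma brem0 J s : brem J.+1 0 s = 0.
Proof.
rewrite /brem addr0 cpow1 big_ord_recl expr0 mulr1 big1 ?addr0 ?subrr // => j _.
by rewrite expr0n mulr0.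
Qed.

Lemma dbrem0 J s : dbrem J.+1 0 s = 0.
Proof.
rewrite /dbrem addr0 /dcpow ln1 oppr0 mul0r big_ord_recl mul0r big1 ?addr0 ?subrr // => j _.
by rewrite expr0n mulr0.
Qed.

Definition half_ball (u : R) : Prop := `|u| <= 2^-1.

Lemma half_ball_gtN1 u : half_ball u -> -1 < u.
Proof. by rewrite /half_ball ler_norml => /andP[h _]; lra. Qed.

Lemma udiff_brem J s : udiff half_ball (fun u => `|u| ^+ J) (brem J) (dbrem J) s.
Proof.
elim: J s => [|J IH] s.
  have h : udiff half_ball (fun=> 1) (fun u z => cexp (z * (- ln (1 + u))%:C))
      (fun u z => (- ln (1 + u))%:C * cexp (z * (- ln (1 + u))%:C)) s.
    apply: udiff_cexp_bounded => u hu; rewrite normrN.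
    have u1 := half_ball_gtN1 hu; have u2 : 0 < 1 + u by lra.
    move: hu; rewrite /half_ball ler_norml => /andP[l1 l2].
    have h1 := le_ln1Dx u1.
    have h2 : ln (1 + u)^-1 <= 1.
      have -> : (1 + u)^-1 = 1 + - (u / (1 + u)) by field; rewrite gt_eqF.
      have h3 : - (u / (1 + u)) <= 1 by rewrite -mulNr ler_pdivrMr //; lra.
      apply: le_trans h3; apply: le_ln1Dx; rewrite ltrN2 ltr_pdivrMr //; lra.
    by rewrite lnV ?posrE // in h2; rewrite ler_norml; apply/andP; split; lra.
  have E z (x : R) : cexp (z * (- x)%:C) = cexp (- z * x%:C) by rewrite rmorphN mulrN mulNr.
  apply: (udiff_eq _ _ h) => u *.
    by rewrite /brem big_ord0 subr0 E.
  by rewrite /dbrem big_ord0 subr0 E /dcpow rmorphN.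
have [K [d [K0 d0 d1 H]]] := udiffM (udiff_id half_ball s) (udiff_shift (IH (s + 1))).
exists (2 * K), d; split; rewrite ?mulr_ge0 // => u hu.
have dom x : `|x| <= `|u| -> half_ball x /\ K * (1 * `|x| ^+ J) <= K * `|u| ^+ J.
  move=> xu; split; first exact: le_trans xu hu.
  by rewrite mul1r ler_wpM2l // lerXn2r ?nnegrE.
have E : 2 * K * `|u| ^+ J.+1 = 2 * (K * `|u| ^+ J) * `|u| by rewrite exprSr; ring.
split.
- rewrite -[brem _ _ _]subr0 -(brem0 J s) E.
  apply: (@complex_mean_value _ (fun u => brem J.+1 u s) (fun x => - s * brem J x (s + 1))) => x /dom[xh xK].
    exact: cder_brem (half_ball_gtN1 xh).
  by rewrite mulNr cmodN; have [h _ _] := H x xh; apply: le_trans xK.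
- rewrite -[dbrem _ _ _]subr0 -(dbrem0 J s) E.
  apply: (@complex_mean_value _ (fun u => dbrem J.+1 u s) (fun x => - (brem J x (s + 1) + s * dbrem J x (s + 1)))) => x /dom[xh xK].
    exact: cder_dbrem (half_ball_gtN1 xh).
  by rewrite cmodN; have [_ h _] := H x xh; rewrite mul1r in h; apply: le_trans xK.
move=> h hd; rewrite E.
pose e x := brem J.+1 x (s + h) - brem J.+1 x s - h * dbrem J.+1 x s.
have -> : brem J.+1 u (s + h) - brem J.+1 u s - dbrem J.+1 u s * h = e u - e 0.
  by rewrite /e !brem0 dbrem0; ring.
have -> : 2 * (K * `|u| ^+ J) * `|u| * cmod h ^+ 2 = 2 * (K * `|u| ^+ J * cmod h ^+ 2) * `|u| by ring.
apply: (@complex_mean_value _ e (fun x => - (s + h) * brem J x (s + h + 1) - - s * brem J x (s + 1)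
   - h * - (brem J x (s + 1) + s * dbrem J x (s + 1)))) => x /dom[xh xK].
  have x1 := half_ball_gtN1 xh.
  apply: cderD; last by apply: cderN; apply: cderZ; exact: cder_dbrem.
  by apply: cderD; [exact: cder_brem|apply: cderN; exact: cder_brem].
have [_ _ /(_ h hd) h3] := H x xh.
rewrite -cmodN; apply: le_trans (le_trans _ h3) _; last first.
  by rewrite ler_wpM2r ?exprn_ge0 ?cmod_ge0.
by rewrite le_eqVlt; apply/orP; left; apply/eqP; congr cmod; ring.
Qed.
End ExponentialFamilies.

(** * Continuation of the periodic zeta functions *)

Section RecursiveContinuation.
Variable R : realType.
Notation C := R[i].
Variables (U : C -> C) (a T : nat -> C -> C).
Hypothesis UT1 : forall s, 1 < complex.Re s -> U s = T 1 s.
Hypothesis TS : forall J s, 1 - J.+1%:R < complex.Re s ->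
  T J.+1 s = T J.+2 s + a J.+1 s * U (s + J.+1%:R).
Hypothesis a_hol : forall j s, hol (a j) s.
Hypothesis T_hol : forall J s, 1 - J.+1%:R < complex.Re s -> hol (T J.+1) s.

Fixpoint stage (k : nat) (s : C) : C :=
  if k is k'.+1 then T k'.+1 s + \sum_(j < k') a j.+1 s * stage k' (s + j.+1%:R) else U s.

Lemma stageE k s : stage k.+1 s = T k.+1 s + \sum_(j < k) a j.+1 s * stage k (s + j.+1%:R).
Proof. by []. Qed.

Let Re_shift (s : C) j : complex.Re (s + j%:R) = complex.Re s + j%:R.
Proof. by rewrite ReD Re_nat. Qed.

Let UTk k s : 1 < complex.Re s ->
  U s = T k.+1 s + \sum_(j < k) a j.+1 s * U (s + j.+1%:R).
Proof.
move=> s1; elim: k => [|k IH]; first by rewrite big_ord0 addr0 UT1.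
rewrite big_ord_recr /= IH TS; last first.
  by apply: lt_trans s1; rewrite gtrBl ltr0n.
by rewrite -addrA; congr (_ + _); rewrite addrC.
Qed.

Lemma stage_half_plane k s : 1 < complex.Re s -> stage k s = U s.
Proof.
elim: k s => // k IH s s1; rewrite [RHS](UTk k) //=; congr (_ + _).
apply: eq_bigr => j _; rewrite IH // Re_shift.
by rewrite (lt_le_trans s1) // lerDl.
Qed.

Lemma stageS k s : 1 - k%:R < complex.Re s -> stage k.+1 s = stage k s.
Proof.
elim: k s => [|k IH] s sk.
  by rewrite subr0 in sk; rewrite stage_half_plane.
rewrite stageE [RHS]stageE (TS sk) big_ord_recr (@stage_half_plane k.+1 (s + k.+1%:R)); last first.
  by rewrite Re_shift -ltrBlDr.
rewrite -addrA; congr (_ + _); rewrite addrC; congr (_ + _).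
apply: eq_bigr => j _; congr (_ * _); apply: IH.
rewrite Re_shift -[j.+1]add1n natrD; rewrite -[k.+1]add1n natrD in sk.
by have : 0 <= j%:R :> R := ler0n _ _; lra.
Qed.

Lemma stage_le k l s : (k <= l)%N -> 1 - k%:R < complex.Re s -> stage l s = stage k s.
Proof.
move=> /subnKC <-; elim: (l - k)%N => [|m IH] sk; first by rewrite addn0.
rewrite addnS stageS ?IH //; apply: le_lt_trans sk.
by rewrite lerD2l lerN2 ler_nat leq_addr.
Qed.

Lemma hol_stage k s : 1 - k%:R < complex.Re s -> hol (stage k) s.
Proof.
elim: k s => [|k IH] s sk.
  rewrite subr0 in sk; apply: (@hol_near _ (T 1)); last by apply: T_hol; rewrite subrr (lt_trans ltr01).
  exists ((complex.Re s - 1) / 2); first by rewrite divr_gt0 // subr_gt0.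
  move=> h hs /=; rewrite UT1 // ReD.
  have := Re_le_cmod h; rewrite ler_norml => /andP[h1 h2].
  by move: hs h1 sk; set c := cmod h; lra.
apply: holD; first exact: T_hol.
apply: hol_sum => j; apply: holM; first exact: a_hol.
apply: hol_shift; apply: IH.
rewrite Re_shift -[j.+1]add1n natrD; rewrite -[k.+1]add1n natrD in sk.
by have : 0 <= j%:R :> R := ler0n _ _; lra.
Qed.

Lemma recursive_continuation : exists V : C -> C,
  [/\ forall s, hol V s, forall s, 1 < complex.Re s -> V s = U s &
    forall J s, 1 - J.+1%:R < complex.Re s ->
      V s = T J.+1 s + \sum_(j < J) a j.+1 s * V (s + j.+1%:R)].
Proof.
pose K (s : C) := Num.bound `|1 - complex.Re s|.
have KP s : 1 - (K s)%:R < complex.Re s.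
  rewrite ltrBlDr -ltrBlDl; apply: le_lt_trans (ler_norm _) (archi_boundP (normr_ge0 _)).
pose V s := stage (K s) s.
have VE k s : 1 - k%:R < complex.Re s -> V s = stage k s.
  by move=> sk; rewrite /V -(@stage_le (K s) (maxn (K s) k)) ?leq_maxl // (@stage_le k) ?leq_maxr.
exists V; split.
- move=> s; have sK := KP s; apply: (@hol_near _ (stage (K s))); last exact: hol_stage.
  exists ((complex.Re s - (1 - (K s)%:R)) / 2); first by rewrite divr_gt0 // subr_gt0.
  move=> h hs; rewrite (VE (K s)) // ReD.
  have := Re_le_cmod h; rewrite ler_norml => /andP[h1 h2].
  by move: hs h1 sK; set c := cmod h; lra.
- by move=> s s1; rewrite (VE 0%N) //= subr0.
move=> J s sJ; rewrite (VE J.+1) //=; congr (_ + _); apply: eq_bigr => j _.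
rewrite (VE J) // Re_shift.
rewrite -[j.+1]add1n natrD; rewrite -[J.+1]add1n natrD in sJ.
by have : 0 <= j%:R :> R := ler0n _ _; lra.
Qed.
End RecursiveContinuation.

Section PeriodicZeta.
Variable R : realType.
Notation C := R[i].
Variable w : C.
Hypothesis w1 : cmod w = 1.

Let w0 : w != 0.
Proof. by rewrite -cmod_eq0 w1 oner_eq0. Qed.

Let wX n : cmod (w ^+ n) = 1.
Proof. by rewrite cmodX w1 expr1n. Qed.

(* [pz_term s n] is [z ^ n.+1 / n.+1 ^ s] for [z = w ^ 2]: the square root makes
   [w ^ (2 * x)] meaningful at half-integers [x]. *)
Definition pz_term (s : C) (n : nat) : C := w ^+ (2 * n.+1) * cpow n.+1%:R s.

Definition pzeta (s : C) : C := csum (pz_term s).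

Definition mid (n : nat) : R := (2 * n.+1%:R)^-1.

(* For [J = 0] this is the difference of [w ^ (2 * x) * x ^ (- s)] between
   [x = n.+1 + 1/2] and [x = n.+1 - 1/2], which telescopes; for larger [J] the
   first [J] terms of the binomial expansions at [n.+1] are removed. *)
Definition pz_rem_term (J : nat) (s : C) (n : nat) : C :=
  w ^+ (2 * n.+1) * (cpow n.+1%:R s * (w * brem J (mid n) s + - w^-1 * brem J (- mid n) s)).

Definition pz_rem (J : nat) (s : C) : C := csum (pz_rem_term J s).

Definition jump (j : nat) : C := w - (-1) ^+ j * w^-1.

Lemma mid_gt0 n : 0 < mid n. Proof. by rewrite invr_gt0 mulr_gt0 // ltr0n. Qed.

Lemma half_ball_mid n : half_ball (mid n) /\ half_ball (- mid n).
Proof.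
rewrite /half_ball normrN; suff : `|mid n| <= 2^-1 by [].
rewrite gtr0_norm ?mid_gt0 // /mid invfM ler_piMr // invf_le1 ?ltr0n //.
by rewrite ler1n.
Qed.

Lemma udiff_pz_term s (e : R) : 0 < e -> exists f',
  udiff (fun=> True) (pnat (complex.Re s - e)) (fun n z => pz_term z n) f' s.
Proof.
move=> e0.
have hc : udiff (fun _ : nat => True) (fun=> 1) (fun n (_ : C) => w ^+ (2 * n.+1)) (fun _ _ => 0) s.
  by apply: (udiff_cst _ ler01) => n _; rewrite wX mulr1.
eexists; apply: (udiff_dom ler01 _ (udiffM hc (udiff_cpow_nat s e0))) => n _.
by rewrite mul1r.
Qed.

Lemma udiff_pz_rem J s (e : R) : 0 < e -> exists f',
  udiff (fun=> True) (pnat (complex.Re s + J%:R - e)) (fun n z => pz_rem_term J z n) f' s.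
Proof.
move=> e0.
have hc : udiff (fun _ : nat => True) (fun=> 1) (fun n (_ : C) => w ^+ (2 * n.+1)) (fun _ _ => 0) s.
  by apply: (udiff_cst _ ler01) => n _; rewrite wX mulr1.
have h1 := udiff_reindex (E := fun=> True) (fun n _ => (half_ball_mid n).1) (udiff_brem J s).
have h2 := udiff_reindex (E := fun=> True) (fun n _ => (half_ball_mid n).2) (udiff_brem J s).
have {}h2 : udiff (fun=> True) (fun n => `|mid n| ^+ J) (fun n => brem J (- mid n)) (fun n => dbrem J (- mid n)) s.
  by apply: (udiff_dom ler01 _ h2) => n _; rewrite mul1r normrN.
have h3 := udiffM (udiff_cpow_nat s e0) (udiffD (udiffZ w h1) (udiffZ (- w^-1) h2)).
eexists; apply: (udiff_dom ler01 _ (udiffM hc h3)) => n _; rewrite !mul1r.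
rewrite gtr0_norm ?mid_gt0 //.
have n0 : 0 < n.+1%:R :> R by rewrite ltr0n.
have -> : pnat (complex.Re s + J%:R - e) n = pnat (complex.Re s - e) n * n.+1%:R ^- J.
  have -> : n.+1%:R ^- J = expR (- (J%:R * ln n.+1%:R)) :> R.
    by rewrite expRN expRM_natl lnK ?posrE.
  by rewrite /pnat -expRD; congr expR; ring.
rewrite ler_wpM2l ?pnat_ge0 // -exprVn; apply: lerXn2r.
- by rewrite nnegrE ltW ?mid_gt0.
- by rewrite nnegrE invr_ge0 ler0n.
by rewrite /mid invfM ler_piMl ?invr_ge0 ?ler0n // invf_le1 // ler1n.
Qed.

Lemma pz_term_bounds s : 1 < complex.Re s -> asum (pz_term s) /\ hol pzeta s.
Proof.
move=> s1; have e0 : 0 < (complex.Re s - 1) / 2 by rewrite divr_gt0 // subr_gt0.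
have [f' H] := udiff_pz_term s e0.
have b : bounded_sums (pnat (complex.Re s - (complex.Re s - 1) / 2)).
  by apply: bounded_sums_pnat; lra.
split; last by apply: (hol_csum b _ H) => n; apply: pnat_ge0.
have [K [d [K0 _ _ HH]]] := H.
by apply: (asum_dom K0 b) => n; have [] := HH n I.
Qed.

Lemma pz_rem_bounds J s : 1 - J%:R < complex.Re s -> asum (pz_rem_term J s) /\ hol (pz_rem J) s.
Proof.
move=> sJ; have e0 : 0 < (complex.Re s + J%:R - 1) / 2 by rewrite divr_gt0 //; lra.
have [f' H] := udiff_pz_rem J s e0.
have b : bounded_sums (pnat (complex.Re s + J%:R - (complex.Re s + J%:R - 1) / 2)).
  by apply: bounded_sums_pnat; lra.
split; last by apply: (hol_csum b _ H) => n; apply: pnat_ge0.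
have [K [d [K0 _ _ HH]]] := H.
by apply: (asum_dom K0 b) => n; have [] := HH n I.
Qed.

Lemma pz_rem_termS J s n : pz_rem_term J s n =
  pz_rem_term J.+1 s n + 2 ^- J * nbinom J s * jump J * pz_term (s + J%:R) n.
Proof.
have n0 : 0 < n.+1%:R :> R by rewrite ltr0n.
have bS u : brem J u s = brem J.+1 u s + nbinom J s * (u ^+ J)%:C.
  by rewrite /brem big_ord_recr /=; ring.
have E : (mid n ^+ J)%:C = 2 ^- J * (n.+1%:R ^- J)%:C :> C.
  by rewrite /mid exprVn exprMn invfM rmorphM !fmorphV !rmorphXn /= !rmorph_nat.
have E2 : ((- mid n) ^+ J)%:C = (-1) ^+ J * (mid n ^+ J)%:C.
  by rewrite (exprNn (mid n)) rmorphM rmorph_sign.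
rewrite /pz_rem_term /pz_term !bS cpowD cpow_nat // E2 E /jump.
ring.
Qed.

Lemma pz_remS J s : 1 - J%:R < complex.Re s ->
  pz_rem J s = pz_rem J.+1 s + 2 ^- J * nbinom J s * jump J * pzeta (s + J%:R).
Proof.
move=> s1; rewrite /pz_rem (eq_csum (pz_rem_termS J s)).
have h1 : asum (pz_rem_term J.+1 s).
  by apply: (pz_rem_bounds _).1; rewrite -[J.+1]add1n natrD; lra.
have h2 : asum (pz_term (s + J%:R)).
  by apply: (pz_term_bounds _).1; rewrite ReD Re_nat; lra.
by rewrite csumD ?csumZ //; apply: asumZ.
Qed.

Lemma pz_rem_jump0 J s : jump J = 0 -> pz_rem J s = pz_rem J.+1 s.
Proof.
move=> j0; apply: eq_csum => n; rewrite pz_rem_termS j0.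
by rewrite mulr0 mul0r addr0.
Qed.

Lemma pz_rem0 s : 0 < complex.Re s -> pz_rem 0 s = - (w * cpow 2^-1 s).
Proof.
move=> s0; pose b n : C := w ^+ (2 * n).+1 * cpow (n%:R + 2^-1) s.
have H : csums (fun n => b n.+1 - b n) (- b 0%N).
  apply: csums_telescope => e e0.
  exists (Num.bound (expR (- ln e / complex.Re s))) => n nN.
  rewrite cmodM wX mul1r cmod_cpow.
  have h1 : expR (- ln e / complex.Re s) < n%:R + 2^-1.
    apply: (lt_le_trans (archi_boundP (expR_ge0 _))).
    by apply: (@le_trans _ _ n%:R); rewrite ?ler_nat // lerDl invr_ge0.
  rewrite -[e]lnK ?posrE // ltr_expR.
  have h2 : 0 < n%:R + 2^-1 :> R by apply: lt_trans h1; exact: expR_gt0.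
  have : - ln e / complex.Re s < ln (n%:R + 2^-1).
    by rewrite -[X in X < _]expRK ltr_ln ?posrE ?expR_gt0.
  by rewrite ltr_pdivrMr // mulNr mulrC ltrNl.
have -> : - (w * cpow 2^-1 s) = - b 0%N by rewrite /b muln0 expr1 add0r.
apply: csumE; apply: csums_eq H => n.
have n0 : 0 < n.+1%:R :> R by rewrite ltr0n.
have m0 := mid_gt0 n; have [_ hm] := half_ball_mid n.
have m1 : 0 < 1 + - mid n by have := half_ball_gtN1 hm; lra.
have m2 : 0 < 1 + mid n by lra.
have e1 : n.+1%:R + 2^-1 = n.+1%:R * (1 + mid n) :> R.
  by rewrite /mid; field; rewrite ?nat1r ?natr1 pnatr_eq0.
have e2 : n%:R + 2^-1 = n.+1%:R * (1 + - mid n) :> R.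
  by rewrite /mid -natr1; field; rewrite ?nat1r ?natr1 pnatr_eq0.
rewrite /b e1 e2 !cpow_mul // /pz_rem_term /brem !big_ord0 !subr0.
rewrite (_ : (2 * n.+1).+1 = 2 * n + 3)%N; last by lia.
rewrite (_ : 2 * n.+1 = 2 * n + 2)%N; last by lia.
rewrite -[(2 * n).+1]addn1 !exprD; set X := w ^+ (2 * n); field.
exact: w0.
Qed.
End PeriodicZeta.

Section SpecialValues.
Variable R : realType.
Notation C := R[i].
Implicit Types (s w : C).

Lemma hol_cpow (x : R) s : hol (cpow x) s.
Proof.
exists (fun z => (- ln x)%:C * cexp (z * (- ln x)%:C)).
have h := udiff_cexp (fun _ : unit => True) (fun=> - ln x) s ltr01 (lexx _).
pose k := expR (complex.Re s * - ln x) * (1 + (- ln x) ^+ 2) * expR (1 * `|- ln x|).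
have k0 : 0 <= k by rewrite !mulr_ge0 ?expR_ge0 // addr_ge0 ?sqr_ge0.
have {}h := udiff_dom (c := fun=> 1) k0 _ h.
apply: (udiff_eq _ _ (h _)) => // [_ z _|i _]; last by rewrite mulr1.
by rewrite /cpow rmorphN mulrN mulNr.
Qed.

Lemma hol_nbinom j s : hol (nbinom j) s.
Proof.
elim: j s => [|j IH] s; first exact: hol_cst.
apply: holM; last by apply: hol_shift; exact: IH.
rewrite (_ : (fun z => - z / _) = (fun z => z * (- j.+1%:R^-1))).
  by apply: holM; [exact: hol_id|exact: hol_cst].
by apply/funext => z; rewrite mulNr mulrN.
Qed.

Lemma nbinomSr j s : nbinom j.+1 s = nbinom j s * (- (s + j%:R)) / j.+1%:R.
Proof.
elim: j s => [|j IH] s; first by rewrite /= addr0 mul1r mulr1.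
rewrite [LHS]/= -/(nbinom j.+1 (s + 1)) IH [nbinom j.+1 s]/= -[j.+1%:R in RHS]natr1.
rewrite -[j.+1]addn1 natrD; field.
by rewrite !natr1 nat1r !pnatr_eq0.
Qed.

Lemma nbinom_0 j : nbinom j.+1 (0 : C) = 0.
Proof. by rewrite /= oppr0 mul0r mul0r. Qed.

Lemma nbinom_oppS j k : nbinom j.+1 (- k.+1%:R : C) = k.+1%:R / j.+1%:R * nbinom j (- k%:R).
Proof.
rewrite /= opprK; congr (_ * nbinom j _).
by rewrite -natr1 opprD addrNK.
Qed.

Lemma nbinom_gt k j : (k < j)%N -> nbinom j (- k%:R : C) = 0.
Proof.
elim: k j => [|k IH] [|j] // kj; first by rewrite oppr0 nbinom_0.
by rewrite nbinom_oppS IH // mulr0.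
Qed.

Lemma nbinom_diag k : nbinom k (- k%:R : C) = 1.
Proof.
by elim: k => // k IH; rewrite nbinom_oppS IH mulr1 divff // pnatr_eq0.
Qed.

Lemma nbinom_subdiag k : nbinom k (- k.+1%:R : C) = k.+1%:R.
Proof.
elim: k => // k IH; rewrite nbinom_oppS IH divfK // pnatr_eq0 //.
Qed.

Lemma brem_opp_nat k J (u : R) : (k < J)%N -> half_ball u -> brem J u (- k%:R) = 0.
Proof.
elim: k J u => [|k IH] [|J] u // kJ hu.
  rewrite oppr0 /brem cpow0 big_ord_recl expr0 mulr1 big1 ?addr0 ?subrr // => j _.
  by rewrite lift0 nbinom_0 mul0r.
apply/eqP; rewrite -cmod_eq0 eq_le cmod_ge0 andbT -[brem _ _ _]subr0 -(brem0 J (- k.+1%:R)).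
rewrite -[leRHS](_ : 2 * 0 * `|u| = 0); last by rewrite mulr0 mul0r.
have dom x : `|x| <= `|u| -> half_ball x by move=> xu; exact: le_trans xu hu.
apply: (@complex_mean_value _ (fun u => brem J.+1 u (- k.+1%:R)) (fun x => - - k.+1%:R * brem J x (- k.+1%:R + 1))) => x /dom xh.
  by apply: cder_brem; exact: half_ball_gtN1.
rewrite (_ : - k.+1%:R + 1 = - k%:R); last by rewrite -natr1 opprD addrNK.
by rewrite IH // mulr0 cmod0.
Qed.

Lemma pz_rem_opp_nat w k J : (k < J)%N -> pz_rem w J (- k%:R) = 0.
Proof.
move=> kJ; rewrite -[RHS](csum0 R); apply: eq_csum => n.
have [h1 h2] := half_ball_mid R n.
by rewrite /pz_rem_term !brem_opp_nat // !mulr0 addr0 !mulr0.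
Qed.

Lemma cpow_half_opp_nat k : cpow (2^-1 : R) (- k%:R) = 2 ^- k.
Proof.
have h : cpow (2^-1 : R) k%:R * cpow (2^-1) (- k%:R) = 1 by rewrite -cpowD subrr cpow0.
have e : cpow (2^-1 : R) k%:R = 2 ^+ k.
  by rewrite cpow_nat ?invr_gt0 // exprVn invrK rmorphXn rmorph_nat.
have n0 : 2 ^+ k != 0 :> C by rewrite expf_neq0 // pnatr_eq0.
by apply: (mulfI n0); rewrite divff // -e.
Qed.
End SpecialValues.

Arguments nbinom : simpl never.

Section NontrivialCharacter.
Variable R : realType.
Notation C := R[i].
Variable w : C.
Hypothesis w1 : cmod w = 1.
Hypothesis w2 : w ^+ 2 != 1.

Let w0 : w != 0.
Proof. by rewrite -cmod_eq0 w1 oner_eq0. Qed.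

Lemma jump0_neq0 : jump w 0 != 0.
Proof.
rewrite /jump expr0 mul1r subr_eq0; apply: contra w2 => /eqP E.
by rewrite expr2 {1}E mulVf.
Qed.

Lemma pzeta_entire : exists V : C -> C,
  [/\ forall s, hol V s, forall s, 1 < complex.Re s -> V s = pzeta w s &
    forall k, jump w 0 * V (- k%:R) = - (w * 2 ^- k) -
      \sum_(j < k) 2 ^- j.+1 * nbinom j.+1 (- k%:R) * jump w j.+1 * V (- (k - j.+1)%:R)].
Proof.
pose a (j : nat) (s : C) : C := - (2 ^- j * jump w j / jump w 0) * nbinom j s.
pose T (J : nat) (s : C) : C := - (jump w 0)^-1 * (w * cpow 2^-1 s + pz_rem w J s).
have j0 := jump0_neq0.
have UT1 s : 1 < complex.Re s -> pzeta w s = T 1 s.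
  move=> s1; rewrite /T; have s0 : 0 < complex.Re s by apply: lt_trans s1.
  have h := pz_rem0 w1 s0; rewrite (pz_remS w1) ?subr0 // in h.
  rewrite -(addr0 s) in h; rewrite !addr0 /= expr0 invr1 !mul1r in h.
  have -> : pz_rem w 1 s = - (w * cpow 2^-1 s) - jump w 0 * pzeta w s by rewrite -h; ring.
  by field.
have TS J s : 1 - J.+1%:R < complex.Re s ->
    T J.+1 s = T J.+2 s + a J.+1 s * pzeta w (s + J.+1%:R).
  by move=> sJ; rewrite /T /a (pz_remS w1 (J := J.+1)) //; move: (2 ^- J.+1) => p; field.
have ah j s : hol (a j) s by apply: holM; [exact: hol_cst|exact: hol_nbinom].
have Th J s : 1 - J.+1%:R < complex.Re s -> hol (T J.+1) s.
  move=> sJ; apply: holM; first exact: hol_cst.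
  apply: holD; last exact: (pz_rem_bounds w1 sJ).2.
  by apply: holM; [exact: hol_cst|exact: hol_cpow].
have [V [Vh VU VR]] := recursive_continuation UT1 TS ah Th.
exists V; split => // k.
rewrite (VR k.+1); last first.
  rewrite ReN Re_nat -!natr1; lra.
rewrite /T pz_rem_opp_nat // cpow_half_opp_nat addr0 big_ord_recr /=.
rewrite /a nbinom_gt // mulr0 mul0r addr0 mulrDr; congr (_ + _).
  by rewrite mulrA mulrN mulfV // mulN1r.
rewrite mulr_sumr -sumrN; apply: eq_bigr => j _.
have -> : - k%:R + j.+1%:R = - (k - j.+1)%:R :> C by rewrite natrB // opprB addrC.
by move: (2 ^- j.+1) => p; field.
Qed.
End NontrivialCharacter.

Lemma pzeta_entire_pair (R : realType) (w : R[i]) : cmod w = 1 -> w ^+ 2 != 1 ->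
  exists V V' : R[i] -> R[i],
  [/\ forall s, hol V s, forall s, hol V' s,
      forall s, 1 < complex.Re s -> V s = pzeta w s,
      forall s, 1 < complex.Re s -> V' s = pzeta w^-1 s &
    forall k, V (- k%:R) + (-1) ^+ k * V' (- k%:R) = - (k == 0)%:R].
Proof.
move=> w1 w2; have w0 : w != 0 by rewrite -cmod_eq0 w1 oner_eq0.
have v1 : cmod w^-1 = 1 by rewrite cmodV w1 invr1.
have v2 : w^-1 ^+ 2 != 1 by rewrite exprVn invr_eq1.
have [V [Vh VU VR]] := pzeta_entire w1 w2.
have [V' [Vh' VU' VR']] := pzeta_entire v1 v2.
exists V, V'; split => // k.
have j0 := jump0_neq0 w1 w2.
have jV j : jump w^-1 j = - (-1) ^+ j * jump w j.
  rewrite /jump invrK mulrBr mulrA !mulNr -expr2 -exprM muln2 -mul2n exprM sqrrN expr1n expr1n.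
  by rewrite mul1r opprK addrC.
elim/ltn_ind: k => k IH.
have sgn i : (i < k)%N -> (-1) ^+ (k - i.+1) = (-1) ^+ k * (-1) ^+ i.+1 :> R[i].
  move=> ik; have [e ->] : exists e, (k = e + i.+1)%N by exists (k - i.+1)%N; rewrite subnK.
  by rewrite addnK exprD -mulrA -exprD addnn -mul2n exprM sqrrN !expr1n mulr1.
apply: (mulfI j0); rewrite mulrDr VR.
have -> : jump w 0 * ((-1) ^+ k * V' (- k%:R)) = - (-1) ^+ k * (jump w^-1 0 * V' (- k%:R)).
  by rewrite jV expr0; ring.
rewrite VR'.
have -> : - (w * 2 ^- k) - \sum_(j < k) 2 ^- j.+1 * nbinom j.+1 (- k%:R) * jump w j.+1 * V (- (k - j.+1)%:R)
  + - (-1) ^+ k * (- (w^-1 * 2 ^- k) - \sum_(j < k) 2 ^- j.+1 * nbinom j.+1 (- k%:R) * jump w^-1 j.+1 * V' (- (k - j.+1)%:R))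
  = - (2 ^- k * jump w k) - \sum_(j < k) 2 ^- j.+1 * nbinom j.+1 (- k%:R) * jump w j.+1 *
     (V (- (k - j.+1)%:R) + (-1) ^+ (k - j.+1) * V' (- (k - j.+1)%:R)).
  rewrite [in RHS](eq_bigr (fun j : 'I_k => 2 ^- j.+1 * nbinom j.+1 (- k%:R) * jump w j.+1 * V (- (k - j.+1)%:R)
     + - (-1) ^+ k * (2 ^- j.+1 * nbinom j.+1 (- k%:R) * jump w^-1 j.+1 * V' (- (k - j.+1)%:R)))).
    by rewrite big_split -mulr_sumr /jump /=; ring.
  move=> j _; rewrite jV.
  rewrite (sgn j); first by ring.
  exact: ltn_ord.
case: k IH sgn => [|k] IH _.
  by rewrite big_ord0 subr0 expr0 invr1 mul1r mulrN mulr1.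
rewrite oppr0 mulr0 big_ord_recr /= big1 ?add0r; last first.
  move=> j _; rewrite IH; last by rewrite subSS ltnS leq_subr.
  by rewrite subn_eq0 ltnNge ltn_ord oppr0 mulr0.
by rewrite subnn IH // nbinom_diag eqxx mulr1 mulrN1 opprK addNr.
Qed.

Section TrivialCharacter.
Variable R : realType.
Notation C := R[i].

Let one1 : cmod (1 : C) = 1 := cmod1 R.

Let jump1 j : jump (1 : C) j = (odd j)%:R *+ 2.
Proof.
rewrite /jump invr1 mulr1 -signr_odd; case: (odd j); last by rewrite subrr mul0rn.
by rewrite expr1 opprK mulr2n.
Qed.

Lemma zeta_entire : exists V : C -> C,
  [/\ forall s, hol V s, forall s, 1 < complex.Re s -> V s = (s - 1) * pzeta 1 s,
      V 1 = 1, V 0 = 2^-1 & forall k, (0 < k)%N -> ~~ odd k -> V (- k%:R) = 0].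
Proof.
pose a (j : nat) (s : C) : C := - (2 ^- j.+1 * jump 1 j.+1 / j.+1%:R) * nbinom j (s - 1).
pose T (J : nat) (s : C) : C := cpow 2^-1 (s - 1) + pz_rem 1 J.+1 (s - 1).
have R1 (s : C) : complex.Re (s - 1) = complex.Re s - 1 by rewrite ReD ReN.
have UT1 s : 1 < complex.Re s -> (s - 1) * pzeta 1 s = T 1 s.
  move=> s1; have s0 : 0 < complex.Re (s - 1) by rewrite R1 subr_gt0.
  have h := pz_rem0 one1 s0; rewrite pz_rem_jump0 ?jump1 ?mul0rn // in h.
  rewrite (pz_remS one1 (J := 1)) ?subrr // jump1 subrK nbinomSr mul1r in h.
  have -> : T 1 s = - - cpow 2^-1 (s - 1) + pz_rem 1 2 (s - 1) by rewrite /T opprK.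
  by rewrite -h /= -[nbinom 0 _]/(1 : C) expr1 divr1 mul1r addr0; field.
have TS J s : 1 - J.+1%:R < complex.Re s ->
    T J.+1 s = T J.+2 s + a J.+1 s * ((s + J.+1%:R - 1) * pzeta 1 (s + J.+1%:R)).
  move=> sJ; rewrite /T /a (pz_remS one1 (J := J.+2)); last first.
    by rewrite R1 -[J.+2]addn1 natrD; lra.
  rewrite nbinomSr (_ : s - 1 + J.+2%:R = s + J.+1%:R); last by rewrite -[J.+2]addn1 natrD; ring.
  rewrite -(addrA (cpow _ _)); congr (_ + (_ + _)).
  move: (2 ^- J.+2) (nbinom _ _) (jump _ _) => p q r; field.
  by rewrite -natrD pnatr_eq0.
have ah j s : hol (a j) s.
  by apply: holM; [exact: hol_cst|apply: hol_shift; exact: hol_nbinom].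
have Th J s : 1 - J.+1%:R < complex.Re s -> hol (T J.+1) s.
  move=> sJ; apply: holD; apply: hol_shift; first exact: hol_cpow.
  by apply: (pz_rem_bounds one1 _).2; rewrite R1 -[J.+2]addn1 natrD; lra.
have [V [Vh VU VR]] := recursive_continuation UT1 TS ah Th.
have V1 : V 1 = 1.
  have z0 := pz_rem_opp_nat (1 : C) (isT : (0 < 2)%N); rewrite oppr0 in z0.
  by rewrite (VR 0%N) ?subrr // big_ord0 addr0 /T subrr cpow0 z0 addr0.
have V0 : V 0 = 2^-1.
  rewrite (VR 1%N) /=; last by rewrite -[2]/(1 + 1); lra.
  rewrite big_ord1 /a jump1 /= mul0rn mulr0 mul0r oppr0 !mul0r addr0 /T sub0r.
  by rewrite (cpow_half_opp_nat R 1) (pz_rem_opp_nat 1 (k := 1)) // addr0 expr1.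
exists V; split => // k; elim/ltn_ind: k => k IH k0 ek.
rewrite (VR k.+1); last by rewrite ReN Re_nat -!natr1; lra.
have km : - k%:R - 1 = - k.+1%:R :> C by rewrite -natr1 opprD.
rewrite /T km cpow_half_opp_nat pz_rem_opp_nat // addr0 big_ord_recr /=.
rewrite /a km jump1 /= ek mul0rn mulr0 mul0r oppr0 !mul0r addr0.
case: k IH k0 ek km => // k IH _ ek km.
rewrite big_ord_recr /= big1 ?add0r => [|j _].
  rewrite addNr V0 jump1 /= ek nbinom_subdiag -[true%:R *+ 2]/(2%:R : C).
  by rewrite !mulNr divfK ?pnatr_eq0 // mulfK ?pnatr_eq0 // subrr.
rewrite jump1 /=; case oj: (odd j); last by rewrite /= ?mul0rn ?mulr0 ?mul0r ?oppr0 ?mul0r.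
have -> : - k.+1%:R + j.+1%:R = - (k - j)%:R :> C.
  by rewrite natrB ?(ltnW (ltn_ord j)) // -!natr1; ring.
rewrite IH ?mulr0 //; first by rewrite ltnS leq_subr.
  by rewrite subn_gt0.
by rewrite oddB ?(ltnW (ltn_ord j)) // oj; move: ek; rewrite /= negbK => ->.
Qed.
End TrivialCharacter.

(** * The Witten zeta function *)

Section UnconditionalSum.
Variable R : realType.
Notation C := R[i].

Definition acsums (t : nat -> C) (l : C) : Prop := asum t /\ csums t l.

Lemma acsumsD t u l l' : acsums t l -> acsums u l' -> acsums (fun n => t n + u n) (l + l').
Proof. by move=> [h1 h2] [h1' h2']; split; [exact: asumD|exact: csumsD]. Qed.

Lemma acsumsZ a t l : acsums t l -> acsums (fun n => a * t n) (a * l).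
Proof. by move=> [h1 h2]; split; [exact: asumZ|exact: csumsZ]. Qed.

Lemma acsums_eq t u l : (forall n, t n = u n) -> acsums t l -> acsums u l.
Proof. by move=> /funext ->. Qed.

Lemma sum_uniq_le (b : nat -> R) (s : seq nat) (m n : nat) : (forall k, 0 <= b k) -> uniq s ->
  (forall k, k \in s -> (k < n)%N) -> \sum_(k <- s | (m <= k)%N) b k <= \sum_(m <= k < n) b k.
Proof.
move=> b0 us sn; rewrite -big_filter.
rewrite (perm_big [seq k <- index_iota m n | k \in s]) /=; last first.
  apply: uniq_perm; rewrite ?filter_uniq ?iota_uniq // => k.
  rewrite !mem_filter mem_index_iota andbC; case ks: (k \in s) => //=.
  by rewrite sn // andbT.
by rewrite big_filter big_mkcond; apply: ler_sum => k _; case: ifP.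
Qed.

Lemma sum_uniq_lt (t : nat -> C) (s : seq nat) (m : nat) : uniq s ->
  (forall k, (k < m)%N -> k \in s) -> \sum_(k <- s | (k < m)%N) t k = \sum_(k < m) t k.
Proof.
move=> us ms; rewrite -big_filter -(big_mkord xpredT t).
apply: perm_big; apply: uniq_perm; rewrite ?filter_uniq ?iota_uniq // => k.
by rewrite mem_filter mem_index_iota /=; case km: (k < m)%N => //=; exact: ms.
Qed.

Lemma acsums_partial_sum (I : choiceType) (deg : I -> nat) (t : nat -> C) l :
  injective deg -> (forall i, (0 < deg i)%N) -> (forall n, (0 < n)%N -> exists i, deg i = n) ->
  acsums t l -> partial_sum (fun i => t (deg i).-1) @ totally --> l.
Proof.
move=> dinj d0 dsurj [ta tl]; have FT := @totally_filter I; apply/cvgrPdist_lt => e e0.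
have [r Er] : exists r : R, e = r%:C by exists (complex.Re e); rewrite RRe_real // gtr0_real.
rewrite Er ltcR in e0 *; have r2 : 0 < r / 2 by rewrite divr_gt0.
have [N0 H0] := tl _ r2.
have [N1 H1] := bounded_sums_tail (fun n => cmod_ge0 (t n)) ta r2.
pose M := maxn N0 N1.
have [c Hc] := choice (fun n => dsurj n.+1 (ltn0Sn n)).
exists [fset c (nat_of_ord k) | k in 'I_M]%fset => // B /= AB.
rewrite normcE ltcR /partial_sum -(big_seq_fsetE _ _ xpredT (fun i => t (deg i).-1)) /=.
pose s := [seq (deg i).-1 | i <- B].
have us : uniq s.
  rewrite map_inj_in_uniq ?fset_uniq // => i j _ _ E; apply: dinj.
  by rewrite -(prednK (d0 i)) -(prednK (d0 j)) E.
have ms k : (k < M)%N -> k \in s.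
  move=> kM; apply/mapP; exists (c k); last by rewrite Hc.
  by apply: (fsubsetP AB); apply/imfsetP; exists (Ordinal kM).
pose n := (\max_(k <- s) k).+1.
have sn k : k \in s -> (k < n)%N by move=> ks; rewrite ltnS; apply: leq_bigmax_seq.
have -> : \sum_(i <- B) t (deg i).-1 = \sum_(k <- s) t k by rewrite big_map.
rewrite (bigID (fun k => (k < M)%N)) /= sum_uniq_lt // opprD addrA.
apply: (le_lt_trans (cmodB _ _)); rewrite (splitr r); apply: ltrD; first by rewrite H0 ?leq_maxl.
apply: (le_lt_trans (cmod_sum _ _ _)).
rewrite (eq_bigl (fun k => (M <= k)%N)); last by move=> k; rewrite -leqNgt.
apply: (le_lt_trans (@sum_uniq_le (fun k => cmod (t k)) s M (maxn n M) _ us _)) => [k|k /sn|]; first exact: cmod_ge0.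
  by rewrite leq_max => ->.
apply: le_lt_trans (H1 (maxn n M) _); last by rewrite leq_max leq_maxr orbT.
rewrite [leRHS](big_cat_nat (n := M)) /= ?leq_maxr //.
by rewrite lerDr sumr_ge0 // => k _; exact: cmod_ge0.
Qed.
End UnconditionalSum.

Section Meromorphy.
Variable R : realType.
Notation C := R[i].

Lemma hol_inv (p s : C) : s != p -> hol (fun z => (z - p)^-1) s.
Proof.
move=> sp; have x0 : s - p != 0 by rewrite subr_eq0.
set x := s - p in x0; have cx : 0 < cmod x by rewrite cmod_gt0.
apply/holP; exists (- (x ^- 2)), (2 / cmod x ^+ 3), (cmod x / 2); split.
- by rewrite divr_ge0 // exprn_ge0 // ltW.
- by rewrite divr_gt0.
move=> h hx; have lo : cmod x / 2 <= cmod (x + h).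
  have := cmodB (x + h) h; rewrite addrK; set u := cmod (x + h); move: hx; set v := cmod h; lra.
have xh0 : x + h != 0 by rewrite -cmod_gt0 (lt_le_trans _ lo) // divr_gt0.
have -> : (s + h - p)^-1 - (s - p)^-1 - - (x ^- 2) * h = h ^+ 2 * (x ^- 2 * (x + h)^-1).
  by rewrite (_ : s + h - p = x + h) /x; [field; rewrite -/x x0 xh0|ring].
rewrite !cmodM !cmodV !cmodX mulrC ler_wpM2r ?mulr_ge0 ?cmod_ge0 //.
have -> : 2 / cmod x ^+ 3 = cmod x ^- 2 * (cmod x / 2)^-1 by field; rewrite gt_eqF.
rewrite ler_wpM2l ?invr_ge0 ?exprn_ge0 ?cmod_ge0 //.
by rewrite lef_pV2 ?posrE ?cmod_gt0 // divr_gt0.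
Qed.

Variables (E H : C -> C) (r q : C).
Hypothesis Eh : forall s, hol E s.
Hypothesis Hh : forall s, hol H s.
Hypothesis H1 : H 1 != 0.

Definition simple_polar (s : C) : C := E s + r * (H (s + q) * (s - (1 - q))^-1).

Lemma hol_simple_polar s : s != 1 - q -> hol simple_polar s.
Proof.
move=> sq; apply: holD => //; apply: holM; first exact: hol_cst.
by apply: holM; [exact: hol_shift|exact: hol_inv].
Qed.

Lemma meromorphic_simple_polar : meromorphic simple_polar.
Proof.
move=> p; split.
  have ne : \forall z \near p^', z != 1 - q.
    have [->|pq] := eqVneq p (1 - q); first exact: nbhs_dnbhs_neq.
    apply: nbhs_dnbhs; apply/nbhs_ballP; exists `|p - (1 - q)|; first by rewrite /= normr_gt0 subr_eq0.
    by move=> z; rewrite /ball /=; apply: contraTneq => ->; rewrite ltxx.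
  by apply: filterS ne => z zq; apply: hol_derivable; exact: hol_simple_polar.
have [r0|r0] := eqVneq r 0.
  left; apply: hol_derivable; apply: (hol_near _ (Eh p)).
  by exists 1 => // h _; rewrite /simple_polar r0 mul0r addr0.
have [pq|pq] := eqVneq p (1 - q); last by left; apply: hol_derivable; exact: hol_simple_polar.
right; exists 1%N, (r * H 1); split => //; first exact: mulf_neq0.
pose G z := (z - p) * E z + r * H (z + q).
have Gh : hol G p.
  apply: holD; first by apply: holM => //; apply: holD; [exact: hol_id|exact: hol_cst].
  by apply: holM; [exact: hol_cst|exact: hol_shift].
have Gp : G p = r * H 1 by rewrite /G subrr mul0r add0r pq subrK.
have cG : G z @[z --> p^'] --> r * H 1.
  by rewrite -Gp; apply: cvg_trans (hol_continuous Gh); apply: cvg_app; exact: cvg_within.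
apply: cvg_trans cG; apply: near_eq_cvg.
have np : \forall z \near p^', z != p by exact: nbhs_dnbhs_neq.
apply: filterS np => z zp; have zp0 : z - p != 0 by rewrite subr_eq0.
rewrite /G /simple_polar -pq expr1 mulrDr; congr (_ + _).
by rewrite mulrCA; congr (_ * _); rewrite mulrCA mulfV // mulr1.
Qed.
End Meromorphy.

Section WeylZeta.
Variable R : realType.
Notation C := R[i].

Lemma entire_meromorphic (E : C -> C) : (forall s, hol E s) -> meromorphic E.
Proof.
move=> Eh p; split; last by left; exact: hol_derivable.
by apply: filterE => z; exact: hol_derivable.
Qed.

Lemma acsums_pzeta (w s : C) : cmod w = 1 -> 1 < complex.Re s ->
  acsums (pz_term w s) (pzeta w s).
Proof. by move=> w1 s1; have [h _] := pz_term_bounds w1 s1; split=> //; exact: csumP. Qed.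

Lemma symmetric_pzeta (H : C -> C) (w : C) :
  (forall s, 1 < complex.Re s -> H s = (s - 1) * pzeta 1 s) ->
  H 0 = 2^-1 -> (forall k, (0 < k)%N -> ~~ odd k -> H (- k%:R) = 0) -> cmod w = 1 ->
  exists (E : C -> C) (r : C), [/\ forall s, hol E s,
    forall s, 1 < complex.Re s -> E s + r * (H s * (s - 1)^-1) = pzeta w s + pzeta w^-1 s &
    forall k, ~~ odd k ->
      E (- k%:R) + r * (H (- k%:R) * (- k%:R - 1)^-1) = - (k == 0)%:R].
Proof.
move=> HE H0 Hk w1; have [w2|w2] := eqVneq (w ^+ 2) 1; last first.
  have [V [V' [Vh Vh' VE VE' Vk]]] := pzeta_entire_pair w1 w2.
  exists (fun s => V s + V' s), 0; split => [s|s s1|k ek].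
  - exact: holD.
  - by rewrite mul0r addr0 VE // VE'.
  by rewrite mul0r addr0 -Vk -signr_odd (negbTE ek) mul1r.
have pz1 (v : C) s : v ^+ 2 = 1 -> pzeta v s = pzeta 1 s.
  by move=> v2; apply: eq_csum => n; rewrite /pz_term !exprM v2 !expr1n.
exists (fun=> 0), 2; split => [s|s s1|k ek].
- exact: hol_cst.
- have s10 : s - 1 != 0.
    by rewrite subr_eq0; apply: contraTneq s1 => ->; rewrite ltxx.
  rewrite HE // pz1 // (pz1 w^-1) ?exprVn ?w2 ?invr1 // add0r.
  by rewrite mulrAC mulfV // mul1r mulr_natl mulr2n.
rewrite add0r; case: k ek => [|k] ek; last by rewrite Hk // mul0r mulr0 oppr0.
by rewrite oppr0 H0 sub0r invrN1 mulrA mulfV ?pnatr_eq0 // mulrN1.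
Qed.

Definition weyl_zeta_term (a1 a2 : R) (s : C) (n : nat) : C :=
  weyl_sum n a1 * weyl_sum n a2 * cpow n.+1%:R (s + 2).

Definition weyl_zeta (a1 a2 : R) (Z : C -> C) : Prop :=
  [/\ meromorphic Z,
      forall s, 1 < complex.Re s -> acsums (weyl_zeta_term a1 a2 s) (Z s) &
      forall m, (0 < m)%N -> ~~ odd m -> derivable Z (- m%:R) 1 /\ Z (- m%:R) = 0].

Lemma weyl_zetaC a1 a2 Z : weyl_zeta a1 a2 Z -> weyl_zeta a2 a1 Z.
Proof.
move=> [h1 h2 h3]; split => // s /h2; apply: acsums_eq => n.
by rewrite /weyl_zeta_term (mulrC (weyl_sum n a1)).
Qed.

Lemma weyl_sum_central n (a : R) : cis a ^+ 2 = 1 -> weyl_sum n a = n.+1%:R * (cis a * cis a ^+ n.+1).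
Proof.
move=> a2; have aV : cis (- a) = cis a.
  by apply: (mulfI (cis_neq0 a)); rewrite -cisD subrr cis0 -expr2.
have -> : cis a * cis a ^+ n.+1 = cis a ^+ n by rewrite -exprS -addn2 exprD a2 mulr1.
rewrite /weyl_sum aV (eq_bigr (fun=> cis a ^+ n)) => [|j _]; last first.
  by rewrite -exprD subnKC // -ltnS.
by rewrite sumr_const card_ord mulr_natl.
Qed.

Lemma weyl_sum_noncentral n (a : R) : cis a ^+ 2 != 1 ->
  weyl_sum n a = (cis a - (cis a)^-1)^-1 * (cis a ^+ n.+1 - (cis a)^-1 ^+ n.+1).
Proof.
move=> a2; have d0 : cis a - (cis a)^-1 != 0.
  apply: contra_neq a2 => /subr0_eq E.
  by rewrite expr2 {2}E mulfV // cis_neq0.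
apply: (mulfI d0); rewrite mulrA mulfV // mul1r.
rewrite -opprB mulNr -(opprB ((cis a)^-1 ^+ _)) subrXX -/(weyl_sum n a); congr (- (_ * _)).
by rewrite /weyl_sum; apply: eq_bigr => j _; rewrite -cis_inv mulrC.
Qed.

Lemma cpow_succ n (s : C) k : cpow n.+1%:R (s + k%:R) = n.+1%:R ^- k * cpow n.+1%:R s :> C.
Proof. by rewrite cpowD cpow_nat ?ltr0n // rmorphV ?unitfE ?expf_neq0 ?pnatr_eq0 // rmorphXn rmorph_nat mulrC. Qed.

Lemma shift_opp (m k : nat) : (k <= m)%N -> - m%:R + k%:R = - (m - k)%:R :> C.
Proof. by move=> km; rewrite natrB // opprB addrC. Qed.

Variables a1 a2 : R.
Let l1 := cis a1.
Let l2 := cis a2.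
Let p := cis (a1 / 2) * cis (a2 / 2).
Let q := cis (a1 / 2) * (cis (a2 / 2))^-1.

Let half (a : R) : cis (a / 2) ^+ 2 = cis a.
Proof. by rewrite -cisMn -[X in cis X]mulr_natr divfK ?pnatr_eq0. Qed.

Let p1 : cmod p = 1. Proof. by rewrite cmodM !cmod_cis mulr1. Qed.
Let q1 : cmod q = 1. Proof. by rewrite cmodM cmodV !cmod_cis invr1 mulr1. Qed.
Let V1 (w : C) : cmod w = 1 -> cmod w^-1 = 1. Proof. by move=> h; rewrite cmodV h invr1. Qed.

Let pX n : p ^+ (2 * n) = l1 ^+ n * l2 ^+ n.
Proof. by rewrite exprM /p (exprMn 2) !half exprMn. Qed.
Let qX n : q ^+ (2 * n) = l1 ^+ n * l2^-1 ^+ n.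
Proof. by rewrite exprM /q (exprMn 2) (exprVn _ 2) !half exprMn. Qed.
Let pVX n : p^-1 ^+ (2 * n) = l1^-1 ^+ n * l2^-1 ^+ n.
Proof. by rewrite exprVn pX invfM !exprVn. Qed.
Let qVX n : q^-1 ^+ (2 * n) = l1^-1 ^+ n * l2 ^+ n.
Proof. by rewrite exprVn qX invfM !exprVn invrK. Qed.

Let ReDn (s : C) n : 1 < complex.Re s -> 1 < complex.Re (s + n%:R).
Proof. by move=> s1; rewrite ReD Re_nat (lt_le_trans s1) // lerDl. Qed.

Let sqr1V (x : C) : x ^+ 2 = 1 -> x^-1 = x.
Proof. by move=> x2; apply: (mulfI (_ : x != 0)); rewrite ?mulfV -?expr2 // -sqrf_eq0 x2 oner_eq0. Qed.

Lemma weyl_zeta_central2 : l1 ^+ 2 = 1 -> l2 ^+ 2 = 1 -> exists Z, weyl_zeta a1 a2 Z.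
Proof.
move=> e1 e2; have [H [Hh HE H1 H0 Hk]] := zeta_entire R.
have [E [r [Eh EE Ek]]] := symmetric_pzeta HE H0 Hk p1.
have H1' : H 1 != 0 by rewrite H1 oner_neq0.
pose K := l1 * l2 / 2.
have Z0 s : simple_polar (fun s => K * E s) H (K * r) 0 s = K * (E s + r * (H s * (s - 1)^-1)).
  by rewrite /simple_polar addr0 subr0 mulrDr -(mulrA K r).
have Eh' s : hol (fun s => K * E s) s by apply: holM => //; exact: hol_cst.
exists (simple_polar (fun s => K * E s) H (K * r) 0); split.
- exact: meromorphic_simple_polar.
- move=> s s1; rewrite Z0 EE //.
  have -> : pzeta p^-1 s = pzeta p s.
    by apply: eq_csum => n; rewrite /pz_term pX pVX !sqr1V.
  rewrite -mulr2n -mulr_natl /K mulrA divfK ?pnatr_eq0 //.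
  apply: acsums_eq (acsumsZ _ (acsums_pzeta p1 s1)) => n.
  rewrite /weyl_zeta_term !weyl_sum_central // cpow_succ /pz_term pX.
  have : n.+1%:R != 0 :> C by rewrite pnatr_eq0.
  rewrite -/l1 -/l2; move: (l1 ^+ n.+1) (l2 ^+ n.+1) (cpow n.+1%:R s) => x y z.
  by move: n.+1%:R => N N0; field.

- move=> m m0 em; split; last by rewrite Z0 Ek // eqn0Ngt m0 oppr0 mulr0.
  apply: hol_derivable; apply: hol_simple_polar => //; rewrite subr0.
  by rewrite eq_sym -subr_eq0 opprK nat1r pnatr_eq0.
Qed.

Lemma weyl_zeta_mixed : l1 ^+ 2 = 1 -> l2 ^+ 2 != 1 -> exists Z, weyl_zeta a1 a2 Z.
Proof.
move=> e1 e2; have p2 : p ^+ 2 != 1.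
  rewrite -[2%N]/(2 * 1)%N pX !expr1; apply: contra_neq e2 => E.
  by rewrite -[l2 ^+ 2]mul1r -e1 -exprMn E expr1n.
have [V [V' [Vh Vh' VE VE' Vk]]] := pzeta_entire_pair p1 p2.
pose K := l1 / (l2 - l2^-1).
pose Z s := K * (V (s + 1%:R) + -1 * V' (s + 1%:R)).
have Zh s : hol Z s.
  apply: holM; first exact: hol_cst.
  apply: holD; first exact: hol_shift.
  by apply: holM; [exact: hol_cst|exact: hol_shift].
exists Z; split; first exact: entire_meromorphic.
- move=> s s1; have s2 := ReDn 1 s1; rewrite /Z VE // VE' //.
  apply: acsums_eq (acsumsZ _ (acsumsD (acsums_pzeta p1 s2) (acsumsZ _ (acsums_pzeta (V1 p1) s2)))) => n.
  rewrite /weyl_zeta_term weyl_sum_central // weyl_sum_noncentral // /pz_term !cpow_succ pX pVX.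
  rewrite (sqr1V e1) /K -/l1 -/l2.
  have : n.+1%:R != 0 :> C by rewrite pnatr_eq0.
  move: (l2 - l2^-1) (l2^-1 ^+ _) (l2 ^+ _) (l1 ^+ _) (cpow _ _) => d x y z t.
  by move: n.+1%:R d^-1 => N d' N0; field.
move=> m m0 em; split; first exact: hol_derivable.
rewrite /Z shift_opp //; have := Vk (m - 1)%N.
rewrite -signr_odd oddB // (negbTE em) expr1.
by case: m m0 em => [|[|m]] // _ _; rewrite mulN1r => ->; rewrite oppr0 mulr0.
Qed.

Lemma weyl_zeta_noncentral2 : l1 ^+ 2 != 1 -> l2 ^+ 2 != 1 -> exists Z, weyl_zeta a1 a2 Z.
Proof.
move=> e1 e2; have [H [Hh HE H1 H0 Hk]] := zeta_entire R.
have [E [r [Eh EE Ek]]] := symmetric_pzeta HE H0 Hk p1.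
have [F [t [Fh FE Fk]]] := symmetric_pzeta HE H0 Hk q1.
have H1' : H 1 != 0 by rewrite H1 oner_neq0.
pose K := (l1 - l1^-1)^-1 * (l2 - l2^-1)^-1.
pose D s := K * (E (s + 2) + -1 * F (s + 2)).
have Dh s : hol D s.
  apply: holM; first exact: hol_cst.
  apply: holD; first exact: hol_shift.
  by apply: holM; [exact: hol_cst|exact: hol_shift].
pose Z := simple_polar D H (K * (r - t)) 2.
have Z2 s : Z s = K * ((E (s + 2) + r * (H (s + 2) * (s + 2 - 1)^-1)) +
    -1 * (F (s + 2) + t * (H (s + 2) * (s + 2 - 1)^-1))).
  have e : s - (1 - 2) = s + 2 - 1 by ring.
  by rewrite /Z /simple_polar e /D; move: (s + 2 - 1)^-1 => u; ring.
exists Z; split; first exact: meromorphic_simple_polar.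
- move=> s s1; have s2 := ReDn 2 s1; rewrite Z2 EE // FE //.
  apply: acsums_eq (acsumsZ _ (acsumsD
    (acsumsD (acsums_pzeta p1 s2) (acsums_pzeta (V1 p1) s2))
    (acsumsZ _ (acsumsD (acsums_pzeta q1 s2) (acsums_pzeta (V1 q1) s2))))) => n.
  rewrite /weyl_zeta_term !weyl_sum_noncentral // /pz_term pX pVX qX qVX /K -/l1 -/l2.
  move: (l1 - l1^-1)^-1 (l2 - l2^-1)^-1 (l1 ^+ _) (l2 ^+ _) (l1^-1 ^+ _) (l2^-1 ^+ _) => x y z c u v.
  ring.
move=> m m0 em; have m2 : (2 <= m)%N by case: m m0 em => [|[|]].
split; last first.
  rewrite Z2 shift_opp // Ek ?Fk ?oddB // ?addbF //.
  by rewrite mulN1r subrr mulr0.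
apply: hol_derivable; apply: hol_simple_polar => //.
rewrite -subr_eq0 opprB addrA shift_opp // -opprD oppr_eq0 -natrD pnatr_eq0. Qed.
End WeylZeta.

Lemma exists_weyl_zeta (R : realType) (a1 a2 : R) : exists Z, weyl_zeta a1 a2 Z.
Proof.
have [e1|e1] := eqVneq (cis a1 ^+ 2) 1; have [e2|e2] := eqVneq (cis a2 ^+ 2) 1.
- exact: weyl_zeta_central2.
- exact: weyl_zeta_mixed.
- by have [Z /weyl_zetaC] := weyl_zeta_mixed e2 e1; exists Z.
- exact: weyl_zeta_noncentral2.
Qed.

Lemma trace_irrep_angle (R : realType) (g : 'M[R[i]]_2) : g \in @SU2 R ->
  exists a, forall rho : irrep R, \tr (rho g) = weyl_sum (irrep_deg rho).-1 a.
Proof.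
move=> gS; have [a [h [hS gE]]] := exists_torus_conj gS.
exists a => rho; rewrite trace_irrep // gE.
rewrite (trace_conj (sympow_unirep _ _) hS (torus_su2 a)).
exact: trace_sympow_torus.
Qed.

Theorem theorem2 (R : realType) (g1 g2 : 'M[R[i]]_2)
  (hg1 : g1 \in @SU2 R) (hg2 : g2 \in @SU2 R) :
  exists Z : R[i] -> R[i],
    zetaW_continuation g1 g2 Z /\
    forall m : nat, (0 < m)%N -> ~~ odd m ->
      derivable Z (- m%:R) 1 /\ Z (- m%:R) = 0.
Proof.
have [a1 tr1] := trace_irrep_angle hg1; have [a2 tr2] := trace_irrep_angle hg2.
have [Z [mZ ZE Zm]] := exists_weyl_zeta a1 a2.
exists Z; split => //; split => // s /ZE sZ.
have -> : zetaW_term g1 g2 s = fun c => weyl_zeta_term a1 a2 s (class_deg c).-1.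
  apply/funext => c; rewrite /zetaW_term /weyl_zeta_term tr1 tr2 prednK ?class_deg_gt0 //.
  by rewrite /natcpow /cpow -cexpN mulNr.
exact: (acsums_partial_sum (@class_deg_inj R) (@class_deg_gt0 R) (@class_deg_surj R) sZ).
Qed.
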